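(* For all integers $n>m>0$, $$\mathbb{P}\left(T_m<n\right)=\mathbb{P}\left(\mathcal{Z}_n([-m,m])=0\right),$$ where $T_m$ is the coalescence time of the two semi-infinite geodesics in direction $(1,1)$ started at $(m,0)$ and $(0,m)$ in exponential last-passage percolation on $\mathbb{Z}^2$, and $\mathcal{Z}_n$ is the exit-point counting measure of the stationary last-passage percolation model with $\mathrm{Exp}(1/2)$ boundary weights.
   Context: Notation: $\mathbf e_1=(1,0)$, $\mathbf e_2=(0,1)$, $\mathbf 0=(0,0)$; for $\mathbf x,\mathbf y\in\mathbb{Z}^2$, $\mathbf x\le \mathbf y$ means $x(i)\le y(i)$ for $i=1,2$, and $\mathbf x>\mathbf 0$ means both coordinates are positive. $\mathrm{Exp}(\rho)$ is the exponential distribution with parameter (rate) $\rho$. Last-passage percolation. Given an environment of weights $\omega=\{W_{\mathbf x}\}$ and $\mathbf x\le\mathbf y$, let $\Gamma(\mathbf x,\mathbf y)$ be the set of up-right paths $\gamma=(\mathbf x_0,\dots,\mathbf x_k)$ with $\mathbf x_0=\mathbf x$, $\mathbf x_k=\mathbf y$, $\mathbf x_{j+1}-\mathbf x_j\in\{\mathbf e_1,\mathbf e_2\}$. Put $W(\gamma)=\sum_{j=1}^k W_{\mathbf x_j}$ and $L_\omega(\mathbf x,\mathbf y)=\max_{\gamma\in\Gamma(\mathbf x,\mathbf y)}W(\gamma)$. The geodesic $\gamma_\omega(\mathbf x,\mathbf y)$ is the a.s. unique maximizing path. Coalescence time. Let $\omega=\{W_{\mathbf x}:\mathbf x\in\mathbb{Z}^2\}$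 be i.i.d. $\mathrm{Exp}(1)$ and write $\gamma(\mathbf x,\mathbf y)=\gamma_\omega(\mathbf x,\mathbf y)$. It is known that a.s., for each $\mathbf x\in\mathbb{Z}^2$ there is a unique semi-infinite up-right path $\gamma(\mathbf x)=(\mathbf x_n)_{n\ge0}$ such that (i) $\mathbf x_0=\mathbf x$ and $\gamma(\mathbf x_k,\mathbf x_n)=(\mathbf x_k,\dots,\mathbf x_n)$ for all $k<n$; (ii) for every sequence of lattice points $\mathbf y_n\ge\mathbf 0$ with $|\mathbf y_n|\to\infty$ and $y_n(2)/y_n(1)\to1$, $\gamma(\mathbf x,\mathbf x+\mathbf y_n)\to\gamma(\mathbf x)$ (on each finite set $K\subseteq \mathbb{Z}^2$ the paths eventually coincide). It is also known that a.s. (iii) for all $\mathbf x,\mathbf y$ there is $\mathbf c\in\mathbb{Z}^2$ such that $\gamma(\mathbf x)$ is the concatenation of $\gamma(\mathbf x,\mathbf c)$ and $\gamma(\mathbf c)$, and $\gamma(\mathbf y)$ is the concatenation of $\gamma(\mathbf y,\mathbf c)$ and $\gamma(\mathbf c)$. Let $\mathbf c(\mathbf x,\mathbf y)$ be the first such point, i.e. the one with $\mathbf c'\ge\mathbf c(\mathbf x,\mathbf y)$ for every other $\mathbf c'$ satisfying (iii). For $m\ge1$, $T_m$ is the second coordinate of $\mathbf c((m,0),(0,m))$. Exit points. Let $\bar\omega=\{\bar W_{\mathbf z}:\mathbf z\in\mathbb{Z}^2,\ \mathbf z\ge\mathbf 0\}$ be independent with $\bar W_{\mathbf 0}=0$,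 $\bar W_{\mathbf z}\sim\mathrm{Exp}(1)$ if $\mathbf z>\mathbf 0$, and $\bar W_{\mathbf z}\sim\mathrm{Exp}(1/2)$ if $\mathbf z\neq\mathbf 0$ lies on one of the two coordinate axes. For $\mathbf x>\mathbf 0$, the exit point of $\gamma_{\bar\omega}(\mathbf 0,\mathbf x)$ is the last point of this path (in the up-right orientation) lying on the coordinate axes. Let $Z(\mathbf x)$ be the nonzero integer such that the exit point is $(Z(\mathbf x),0)$ if $Z(\mathbf x)>0$, and $(0,-Z(\mathbf x))$ if $Z(\mathbf x)<0$. For $n\ge1$ and $z\in\mathbb{Z}$ let $\zeta_n(z)=1$ if $z=Z(x,n)$ for some integer $x\ge1$, and $\zeta_n(z)=0$ otherwise. For a set $A$ of integers, $\mathcal{Z}_n(A)=\sum_{z\in A}\zeta_n(z)$; here $[-m,m]$ denotes the integers from $-m$ to $m$. *)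

(* Defs.v *)
From HB Require Import structures.
From mathcomp Require Import all_boot all_order all_algebra finmap.
From mathcomp Require Import all_classical all_reals all_analysis.
Import Order.TTheory GRing.Theory Num.Theory.
Import numFieldNormedType.Exports.

Set Implicit Arguments.
Unset Strict Implicit.
Unset Printing Implicit Defensive.

Local Open Scope classical_set_scope.
Local Open Scope ring_scope.

(* [E] belongs to the completion of [P] and has completed probability [p];
   [p] is determined by [E].  Events defined through almost surely existing
   objects are only measurable in this sense. *)
Definition has_probability (d : measure_display) (T : measurableType d)
    (R : realType) (P : probability T R) (E : set T) (p : \bar R) : Prop :=
  exists A : set T, [/\ measurable A, P.-negligible (A `+` E) & P A = p].

Definition mutually_independent (d : measure_display) (T : measurableType d)
    (R : realType) (P : probability T R) (I : choiceType) (D : set I)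
    (X : I -> {RV P >-> R}) : Prop :=
  forall (s : {fset I}) (A : I -> set R),
    [set` s] `<=` D -> (forall i, i \in s -> measurable (A i)) ->
    P (\bigcap_(i in [set` s]) (X i @^-1` A i)) =
      (\prod_(i <- s) P (X i @^-1` A i))%E.

Definition exp_distributed (d : measure_display) (T : measurableType d)
    (R : realType) (P : probability T R) (X : {RV P >-> R}) (rate : R) : Prop :=
  forall A : set R, measurable A -> distribution P X A = exponential_prob rate A.

Notation site := (int * int)%type.

Definition e1 : site := (1, 0).
Definition e2 : site := (0, 1).

Definition le_pt (x y : site) : bool := (x.1 <= y.1) && (x.2 <= y.2).
Definition pos_pt (x : site) : bool := (0 < x.1) && (0 < x.2).
Definition on_axis (x : site) : bool := (x.1 == 0) || (x.2 == 0).

Definition up_right : rel site :=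
  fun x y => (y == x + e1) || (y == x + e2).

(* A path is the sequence of all its points, both endpoints included. *)
Definition up_right_paths (x y : site) : set (seq site) :=
  [set g | exists p, [/\ g = x :: p, path up_right x p & last x p = y]].

Section LastPassage.
Context {R : realType}.
Implicit Types (w : site -> R) (x y c : site).

(* The weight of the initial point is not counted. *)
Definition path_weight w (g : seq site) : R := \sum_(z <- behead g) w z.

(* There are finitely many up-right paths from [x] to [y], so that the
   supremum is a maximum as soon as [le_pt x y]. *)
Definition last_passage_time w x y : R :=
  sup [set path_weight w g | g in up_right_paths x y].

(* The choice made by [xget] matters only if the maximizer is not unique; the
   default value [::] is taken only if there is no path from [x] to [y]. *)
Definition geodesic w x y : seq site :=
  xget [::] [set g | up_right_paths x y g /\
                     path_weight w g = last_passage_time w x y].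

Definition locally_geodesic w (g : nat -> site) : Prop :=
  forall k n : nat, (k < n)%N ->
    geodesic w (g k) (g n) = [seq g i | i <- iota k (n - k).+1].

Definition to_diagonal_infinity (y : nat -> site) : Prop :=
  [/\ forall n, le_pt 0 (y n),
      ((`|(y n).1| + `|(y n).2|)%:~R : R) @[n --> \oo] --> +oo &
      ((y n).2%:~R / (y n).1%:~R : R) @[n --> \oo] --> (1 : R)].

Definition is_diagonal_geodesic w x (g : nat -> site) : Prop :=
  [/\ g 0%N = x,
      forall k, up_right (g k) (g k.+1),
      locally_geodesic w g &
      forall y : nat -> site, to_diagonal_infinity y ->
        forall K : {fset site}, \forall n \near \oo,
          forall z, z \in K -> (z \in geodesic w x (x + y n)) <-> range g z].

(* Semi-infinite geodesic in direction (1,1); the default value is taken only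
   if there is no such path. *)
Definition diagonal_geodesic w x : nat -> site :=
  xget (fun=> x) [set g | is_diagonal_geodesic w x g].

(* [g] is [p] followed by [h], the last point of [p] being [h 0]. *)
Definition is_concatenation (g : nat -> site) (p : seq site)
    (h : nat -> site) : Prop :=
  exists k : nat, p = [seq g i | i <- iota 0 k.+1] /\
                  forall i : nat, h i = g (k + i)%N.

Definition is_meeting_point w x y c : Prop :=
  is_concatenation (diagonal_geodesic w x) (geodesic w x c)
    (diagonal_geodesic w c) /\
  is_concatenation (diagonal_geodesic w y) (geodesic w y c)
    (diagonal_geodesic w c).

Definition is_coalescence_point w x y c : Prop :=
  is_meeting_point w x y c /\
  forall c', is_meeting_point w x y c' -> le_pt c c'.

(* By convention [+oo] if there is no coalescence point, an event of
   probability zero. *)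
Definition coalescence_time w (m : int) : \bar int :=
  xget +oo%E [set c.2%:E | c in is_coalescence_point w (m, 0) (0, m)].

Definition exit_point w x : site :=
  last 0 [seq z <- geodesic w 0 x | on_axis z].

(* Positive on the horizontal axis, negative on the vertical one; the exit
   point is never the origin for positive [x]. *)
Definition exit_coordinate w x : int :=
  let z := exit_point w x in if z.2 == 0 then z.1 else - z.2.

Definition exit_indicator w (n z : int) : \bar R :=
  if `[< exists2 x : int, 1 <= x & z = exit_coordinate w (x, n) >]
  then 1%E else 0%E.

Definition exit_measure w (n : int) (A : set int) : \bar R :=
  \esum_(z in A) exit_indicator w n z.

End LastPassage.

Definition iid_exp1_environment (d : measure_display) (T : measurableType d)
    (R : realType) (P : probability T R) (W : site -> {RV P >-> R}) : Prop :=
  mutually_independent setT W /\ forall z, exp_distributed (W z) 1.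

(* Only the weights in the closed first quadrant are constrained: no path
   started at the origin sees the others. *)
Definition stationary_environment (d : measure_display) (T : measurableType d)
    (R : realType) (P : probability T R) (W : site -> {RV P >-> R}) : Prop :=
  [/\ mutually_independent [set z | le_pt 0 z] W,
      forall om, W 0 om = 0,
      forall z, pos_pt z -> exp_distributed (W z) 1 &
      forall z, le_pt 0 z -> z != 0 -> on_axis z ->
        exp_distributed (W z) 2^-1].

(* Main.v *)
Require Import Defs.
From mathcomp Require Import all_boot all_order all_algebra finmap.
From mathcomp Require Import all_classical all_reals all_analysis measurable_realfun.
From mathcomp Require Import ring lra zify.
Import Order.TTheory GRing.Theory Num.Theory.
Import numFieldNormedType.Exports.

Set Implicit Arguments.
Unset Strict Implicit.
Unset Printing Implicit Defensive.

Local Open Scope classical_set_scope.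
Local Open Scope ring_scope.

(* Stationary last passage percolation is self-dual: by Burke's property the
   increments along the axes of any window, together with the minima of pairs of
   increments, form again a stationary environment.  Seen from a corner of a
   large square, the arrows of the geodesic tree of the model with parameter 1/2
   therefore have the law of the dual arrows of the model rooted at the opposite
   corner.

   In the latter model geodesics from the origin do not cross dual paths; hence
   no exit point at height n lies in [-m, m] exactly when the dual paths from
   (m, 0) and (0, m) meet below height n.

   In the i.i.d. model, stationary environments with parameters slightly off 1/2
   squeeze the first steps of the geodesics from z to all far targets close to
   the diagonal, and show that with high probability they agree with the arrow
   at z of the model with parameter 1/2 rooted at a far corner.  So these first
   steps converge almost surely, the semi-infinite geodesics are the paths which
   follow their limits, and the geodesics from (m, 0) and (0, m) meet below height
   n with the limiting probability that two branches of the tree of the model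
   with parameter 1/2 do. *)

(** * Exponential laws *)

(** All parameters are coupled through the same weights: the axis weights of the environment with
    parameter [a] are rescaled weights of one row and one column. The arrow at a site is then
    monotone in [a] and horizontal with probability [a], so the arrows with parameters [(1 - t) / 2]
    and [(1 + t) / 2] differ with probability exactly [t], however far the root is. When they agree,
    a plain arrow can deviate from them only if one of these two stationary passage times fails to
    exceed the one with parameter 1/2. The mean [i / a + j / (1 - a)] is minimal at 1/2 on the
    diagonal, with a relative gap of order [t ^ 2], which survives in a cone of aperture of order
    [t]; Chernoff bounds make the failure summable over that cone. The resulting bound is uniform in
    the root. Hence all targets below a root can be compared with one stationary arrow, which gives
    almost sure convergence, and the meeting probability of the stationary model, being the same for
    all roots, passes to the limit. *)

Section Exponential.
Context {R : realType}.
Local Notation leb := (@lebesgue_measure R).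
Implicit Types (r s t x : R) (A B : set R).

Lemma finite_measure_unique_rays
    (m1 m2 : {measure set (measurableTypeR R) -> \bar R}) :
  (m1 setT < +oo)%E ->
  (forall x, m1 [set` `]x, +oo[] = m2 [set` `]x, +oo[]) ->
  forall A, measurable A -> m1 A = m2 A.
Proof.
move=> fin12 rays A mA.
apply: (@measure_unique _ R (measurableTypeR R) (@RGenOInfty.G R)
  (fun n => [set` `](- n%:R)%R, +oo[])) => //.
- exact: RGenOInfty.measurableE.
- move=> _ _ [x ->] [y ->]; exists (Num.max x y).
  by apply/seteqP; split => z/=; rewrite !in_itv/= !andbT gt_max => /andP.
- by move=> i; eexists.
- rewrite -subTset => x _.
  have [k xk] : exists k : nat, - x < k%:R.
    by exists (Num.truncn (- x)).+1; exact: truncnS_gt.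
  by exists k => //=; rewrite in_itv/= andbT ltrNl.
- by move=> B [x ->].
- by move=> k; apply: le_lt_trans fin12; apply: le_measure; rewrite ?inE.
Qed.

Definition exp_law r (r0 : 0 < r) : probability (measurableTypeR R) R :=
  exponential_distribution_exponential_prob__canonical__probability_measure_Probability r0.

Lemma exp_lawE r (r0 : 0 < r) A : exp_law r0 A = exponential_prob r A.
Proof. by []. Qed.

Lemma exponential_prob_set1 r x : 0 < r -> exponential_prob r [set x] = 0%E.
Proof. by move=> r0; rewrite /exponential_prob (@integral_Sset1 _ _ _ x). Qed.

Lemma exponential_prob_Iio0 r : 0 < r -> exponential_prob r `]-oo, 0[ = 0%E.
Proof.
move=> r0; rewrite /exponential_prob integral0_eq// => x /=.
by rewrite in_itv/= => x0; rewrite lt0_exponential_pdf.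
Qed.

Lemma exponential_prob_tail r t : 0 < r -> 0 <= t ->
  exponential_prob r `]t, +oo[ = (expR (- r * t))%:E.
Proof.
move=> r0 t0; rewrite -(exp_lawE r0).
have -> : `]t, +oo[%classic = ~` (`]-oo, 0[ `|` `[0, t])%classic :> set R.
  rewrite -setCitvl; congr (~` _); apply/seteqP; split=> x/=; rewrite !in_itv/=.
    by move=> xt; case: (ltP x 0) => x0; [left|right].
  by case=> [/ltW /le_trans|/andP[]//]; exact.
rewrite probability_setC//; last exact: measurableU.
rewrite measureU//; last first.
  by apply/seteqP; split => x//=; rewrite !in_itv/= => -[]; case: ltP.
move: t0; rewrite le_eqVlt => /predU1P[<-|t0].
  rewrite set_itv1 [X in (1 - (X + _))%E](exponential_prob_Iio0 r0).
  by rewrite [X in (1 - (_ + X))%E](exponential_prob_set1 _ r0) mulr0 expR0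
    adde0 sube0.
rewrite [X in (1 - (X + _))%E](exponential_prob_Iio0 r0) add0e.
rewrite [X in (1 - X)%E](exponential_prob_itv0c r t0).
by rewrite -!EFinD; congr EFin; rewrite opprB addrC subrK.
Qed.

Lemma exponential_prob_eq_rays r (r0 : 0 < r)
    (m : probability (measurableTypeR R) R) :
  (forall t, 0 <= t -> m [set` `]t, +oo[] = (expR (- r * t))%:E) ->
  forall A, measurable A -> m A = exponential_prob r A.
Proof.
move=> mE A mA; rewrite -(exp_lawE r0).
apply: finite_measure_unique_rays => //.
  exact: le_lt_trans (probability_le1 m measurableT) (ltry _).
move=> x; case: (leP 0 x) => x0.
  by rewrite [LHS]mE// [RHS]exponential_prob_tail.
have m1 (m' : probability (measurableTypeR R) R) :
    m' [set` `]0%R, +oo[] = 1%E -> m' [set` `]x, +oo[] = 1%E.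
  move=> H; apply/eqP; rewrite eq_le probability_le1//= -H.
  apply: le_measure; rewrite ?inE//.
  by move=> z/=; rewrite !in_itv/= !andbT; exact: lt_trans.
rewrite [LHS]m1; last by rewrite [LHS]mE// mulr0 expR0.
by apply/esym/m1; rewrite [LHS]exponential_prob_tail// mulr0 expR0.
Qed.

Lemma exp_law_dom r (r0 : 0 < r) : exp_law r0 `<< leb.
Proof.
apply/null_content_dominatesP => A mA A0.
change (exponential_prob r A = 0%E).
rewrite /exponential_prob null_set_integral//.
by apply: measurable_funTS; apply: measurableT_comp => //; exact: measurable_exponential_pdf.
Qed.

Lemma ge0_integral_exp_law r (r0 : 0 < r) (f : R -> \bar R) A :
  measurable A -> measurable_fun A f -> (forall x, 0 <= f x)%E ->
  (\int[exp_law r0]_(x in A) f x =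
   \int[leb]_(x in A) (f x * (exponential_pdf r x)%:E))%E.
Proof.
move=> mA mf f0.
rewrite -(Radon_Nikodym_SigmaFinite.change_of_variables (exp_law_dom r0))//=.
apply: ae_eq_integral => //.
- apply: emeasurable_funM => //; apply: (measurable_int leb).
  apply: (integrableS _ _ (@subsetT _ _)) => //=.
  exact: Radon_Nikodym_SigmaFinite.f_integrable (exp_law_dom r0).
- apply: emeasurable_funM => //=; apply/measurableT_comp => //=.
  by apply/measurable_funTS; exact: measurable_exponential_pdf.
- apply: ae_eqe_mul2l => /=.
  apply: integral_ae_eq => //=.
  + apply: (integrableS _ _ (@subsetT _ _)) => //=.
    exact: Radon_Nikodym_SigmaFinite.f_integrable (exp_law_dom r0).
  + by apply/measurable_funTS/measurableT_comp =>//; exact: measurable_exponential_pdf.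
  + move=> E EA mE.
    by rewrite -(Radon_Nikodym_SigmaFinite.f_integral (exp_law_dom r0)).
Qed.

(** Tilting: [expR (- s * x)] times the density of rate [r] is the density of rate [r + s] up to the
    ratio of the rates. Negative [s] is allowed, which the upper Chernoff bound needs. *)
Lemma integral_exp_law_expR r (r0 : 0 < r) s A : 0 < r + s -> measurable A ->
  (\int[exp_law r0]_(x in A) (expR (- s * x))%:E =
   (r / (r + s))%:E * exponential_prob (r + s) A)%E.
Proof.
move=> rs0 mA; rewrite ge0_integral_exp_law//; last first.
  apply: measurable_funTS; apply: measurableT_comp => //.
  by apply: measurableT_comp => //; exact: measurable_funM.
transitivity (\int[leb]_(x in A)
    ((r / (r + s))%:E * (exponential_pdf (r + s) x)%:E))%E; last first.
  apply: ge0_integralZl => //.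
  - by apply: measurable_funTS; apply: measurableT_comp => //; exact: measurable_exponential_pdf.
  - by move=> x _; rewrite lee_fin exponential_pdf_ge0// ltW.
  - by rewrite lee_fin divr_ge0// ltW.
apply: eq_integral => x _; rewrite -!EFinM; congr EFin.
case: (ltP x 0) => x0; first by rewrite !lt0_exponential_pdf// !mulr0.
rewrite !exponential_pdfE// mulrCA -expRD [RHS]mulrA divfK ?gt_eqF//.
by congr (_ * expR _); ring.
Qed.

(** Memorylessness, in the form in which it appears in a section over the smaller of two
    variables. *)
Lemma exponential_prob_shift r t B : 0 < r -> 0 <= t -> measurable B ->
  exponential_prob r [set x | t < x /\ B (x - t)] =
  ((expR (- r * t))%:E * exponential_prob r (B `&` [set` `]0%R, +oo[]))%E.
Proof.
move=> r0 t0 mB.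
have msub : @measurable_fun _ _ (measurableTypeR R) (measurableTypeR R) setT
    (fun x : R => x - t).
  exact: (@measurable_funB _ (measurableTypeR R) R).
pose e : {nonneg R} := NngNum (expR_ge0 (- r * t)).
pose m2 := mscale e (mrestr (exp_law r0) (measurable_itv `]0%R, +oo[%R)).
pose m1' : {measure set (measurableTypeR R) -> \bar R} :=
  @measure_function_pushforward__canonical__measure_function_Measure
   _ _ (measurableTypeR R) (measurableTypeR R) R
   (mrestr (exp_law r0) (measurable_itv `]t, +oo[%R)) _ msub.
have -> : exponential_prob r [set x | t < x /\ B (x - t)] = m1' B.
  rewrite /m1'/= /pushforward /mrestr; congr exponential_prob.
  apply/seteqP; split => x/=; rewrite in_itv/= andbT => -[? ?]; by split.
have -> : ((expR (- r * t))%:E * exponential_prob r (B `&` [set` `]0%R, +oo[]))%E = m2 B by [].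
apply: finite_measure_unique_rays => //.
  rewrite /m1'/= /pushforward /mrestr.
  apply: (@le_lt_trans _ _ 1%E) (ltry _); apply: (probability_le1 (exp_law r0)).
  by rewrite preimage_setT setTI.
move=> x; rewrite /m1' /m2/= /pushforward /mrestr /mscale/=.
have E (y z : R) : 0 <= z ->
    [set` `]y, +oo[] `&` [set` `]z, +oo[] = [set` `](Num.max 0 (y - z) + z), +oo[] :> set R.
  move=> z0; apply/seteqP; split => w/=; rewrite !in_itv/= !andbT -ltrBrDr gt_max ltrD2r subr_gt0.
    by case=> -> ->.
  by move=> /andP[-> ->].
have -> : (fun x0 : R => x0 - t) @^-1` [set` `]x, +oo[] = [set` `](x + t), +oo[].
  by apply/seteqP; split => w/=; rewrite !in_itv/= !andbT ltrBrDr.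
transitivity (exponential_prob r [set` `](Num.max 0 x + t), +oo[]).
  by congr exponential_prob; rewrite E// addrK.
transitivity ((expR (- r * t))%:E * exponential_prob r [set` `](Num.max 0%R x), +oo[])%E; last first.
  have /esym H := E x 0%R (lexx _); rewrite subr0 addr0 in H.
  exact: (congr1 (fun S => (expR (- r * t))%:E * exponential_prob r S)%E H).
rewrite !exponential_prob_tail//.
- by rewrite -EFinM -expRD; congr (expR _)%:E; ring.
- by rewrite le_max lexx.
- by rewrite addr_ge0// le_max lexx.
Qed.

Lemma exponential_prob_scale c A : 0 < c -> measurable A ->
  exponential_prob 1 [set x | A (c^-1 * x)] = exponential_prob c A.
Proof.
move=> c0 mA.
have mc : @measurable_fun _ _ (measurableTypeR R) (measurableTypeR R) setT
    (fun x : R => c^-1 * x).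
  exact: (@measurable_funM _ (measurableTypeR R) R).
pose X : {mfun measurableTypeR R >-> measurableTypeR R} := @mfun_Sub _ _ (measurableTypeR R) (measurableTypeR R) _ (mem_set mc).
rewrite -(@exponential_prob_eq_rays c c0 (distribution (exp_law ltr01) X))// => t t0.
rewrite /distribution /pushforward/=.
have -> : (fun x : R => c^-1 * x) @^-1` [set` `]t, +oo[] = [set` `](c * t), +oo[].
  by apply/seteqP; split => w/=; rewrite !in_itv/= !andbT ltr_pdivlMl.
rewrite [LHS]exponential_prob_tail//; last by rewrite mulr_ge0// ltW.
by congr (expR _)%:E; ring.
Qed.

End Exponential.

(** * Families of independent random variables *)

Section Cylinders.
Context {R : realType} {K : choiceType}.
Implicit Types (s : seq K) (A : K -> set R).

Definition cylinder s A : set (K -> R) := [set x | forall k, k \in s -> A k (x k)].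

Definition cylinders : set (set (K -> R)) :=
  [set C | exists s A, [/\ uniq s, forall k, measurable (A k) & C = cylinder s A]].

(** The product sigma-algebra on [K -> R]. Its generators are stable under intersection, so a finite
    law on it is determined by its values on cylinders. *)
Definition env := g_sigma_algebraType cylinders.

Lemma cylinders_setI : setI_closed cylinders.
Proof.
move=> _ _ [s [A [us mA ->]]] [t [B [ut mB ->]]].
exists (undup (s ++ t)), (fun k => (if k \in s then A k else setT) `&`
                                  (if k \in t then B k else setT)).
split; first exact: undup_uniq.
  by move=> k; apply: measurableI; case: ifP.
apply/seteqP; split => x /=.
  by move=> [Ax Bx] k _; split; case: ifP => // kin; [exact: Ax|exact: Bx].
move=> H; split => k ks.
  by have /(_ _)[|] := H k; [rewrite mem_undup mem_cat ks|rewrite ks].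
by have /(_ _)[|] := H k; [rewrite mem_undup mem_cat ks orbT|rewrite ks].
Qed.

Lemma cylinder_nil A : cylinder [::] A = setT.
Proof. by apply/seteqP; split. Qed.

Lemma cylinderE s A : cylinder s A = \bigcap_(k in [set` s]) [set x | A k (x k)].
Proof. by apply/seteqP; split => x /= H k; exact: H. Qed.

Lemma env_coord k : measurable_fun [set: env] (fun x : env => x k).
Proof.
move=> _ B mB; rewrite setTI; apply: sub_sigma_algebra.
exists [:: k], (fun _ => B); split => //.
by apply/seteqP; split => x /=; [move=> Bx k'; rewrite inE => /eqP ->|apply; rewrite inE].
Qed.

Lemma measurable_env d (T : measurableType d) (X : T -> K -> R) :
  (forall k, measurable_fun setT (fun om => X om k)) ->
  measurable_fun setT (X : T -> env).
Proof.
move=> mX; apply: (@measurability _ _ T env setT X cylinders) => // _ [_ [s [A [us mA ->]]] <-].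
rewrite setTI cylinderE preimage_bigcap; apply: fin_bigcap_measurable.
  exact: finite_seq.
by move=> k _; rewrite -[X in measurable X]setTI; exact: mX.
Qed.

Lemma measurable_cylinder s A : (forall k, measurable (A k)) ->
  measurable (cylinder s A : set env).
Proof.
move=> mA; rewrite cylinderE; apply: fin_bigcap_measurable; first exact: finite_seq.
by move=> k _; rewrite -[X in measurable X]setTI; exact: (env_coord k).
Qed.

End Cylinders.
Arguments env R K : clear implicits.

Section IndependentFamily.
Context {R : realType} {K : choiceType}.

(** Independence and marginal laws in one formula, so that a change of variables has a single
    property to preserve. *)
Definition indep_family d (T : measurableType d) (P : {measure set T -> \bar R})
    (X : T -> K -> R) (mu : K -> set R -> \bar R) : Prop :=
  (forall k, measurable_fun setT (fun om => X om k)) /\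
  (forall s (A : K -> set R), uniq s -> (forall k, measurable (A k)) ->
    P (X @^-1` cylinder s A) = (\prod_(k <- s) mu k (A k))%E).

Section laws.
Context d (T : measurableType d) (P : {measure set T -> \bar R}).
Variables (X : T -> K -> R) (mu : K -> set R -> \bar R).
Hypothesis indepX : indep_family P X mu.

Lemma indep_family_env : measurable_fun setT (X : T -> env R K).
Proof. by apply: measurable_env; case: indepX. Qed.

Lemma indep_family_marginal k A : measurable A ->
  P ((fun om => X om k) @^-1` A) = mu k A.
Proof.
move=> mA; have := indepX.2 [:: k] (fun _ => A) isT (fun _ => mA).
rewrite big_seq1 => <-; congr (P _).
by apply/seteqP; split => om /=; [move=> ? k'; rewrite inE => /eqP ->|apply; rewrite inE].
Qed.

Lemma indep_family_setT : P setT = 1%E.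
Proof.
have := indepX.2 [::] (fun=> setT) isT (fun _ => measurableT).
by rewrite big_nil cylinder_nil preimage_setT.
Qed.

Lemma indep_family_ext (nu : K -> set R -> \bar R) :
  (forall k A, measurable A -> mu k A = nu k A) -> indep_family P X nu.
Proof.
move=> E; split; first by case: indepX.
by move=> s A us mA; rewrite indepX.2//; apply: eq_bigr => k _; exact: E.
Qed.

Lemma indep_family_map (f : K -> R -> R) :
  (forall k, measurable_fun setT (f k)) ->
  indep_family P (fun om k => f k (X om k)) (fun k A => mu k (f k @^-1` A)).
Proof.
move=> mf; split.
  by move=> k; apply: measurableT_comp => //; case: indepX.
move=> s A us mA; rewrite -indepX.2// => k.
by rewrite -[X in measurable X]setTI; exact: mf.
Qed.

End laws.

Lemma indep_family_law d (T : measurableType d) (P : {measure set T -> \bar R})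
   d' (T' : measurableType d') (P' : {measure set T' -> \bar R})
   X X' (mu : K -> set R -> \bar R) :
  indep_family P X mu -> indep_family P' X' mu ->
  forall B : set (env R K), measurable B -> P (X @^-1` B) = P' (X' @^-1` B).
Proof.
move=> iX iX' B mB.
pose m1 : {measure set (env R K) -> \bar R} :=
  measure_function_pushforward__canonical__measure_function_Measure P (indep_family_env iX).
pose m2 : {measure set (env R K) -> \bar R} :=
  measure_function_pushforward__canonical__measure_function_Measure P' (indep_family_env iX').
apply: (@measure_unique _ R (env R K) cylinders (fun=> setT) _ _ _ _ m1 m2) => //.
- exact: cylinders_setI.
- by move=> _; exists [::], (fun=> setT); split => //; rewrite cylinder_nil.
- by rewrite bigcup_const//; exists 0%N.
- move=> _ [s [A [us mA ->]]]; rewrite /m1 /m2 /= /pushforward.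
  by rewrite [LHS](iX.2)// [RHS](iX'.2).
- by move=> _; rewrite /m1/= /pushforward preimage_setT (indep_family_setT iX) ltry.
Qed.

Lemma indep_family_integral d (T : measurableType d) (P : {measure set T -> \bar R})
   d' (T' : measurableType d') (P' : {measure set T' -> \bar R})
   X X' (mu : K -> set R -> \bar R) (f : env R K -> \bar R) :
  indep_family P X mu -> indep_family P' X' mu ->
  measurable_fun setT f -> (forall x, 0 <= f x)%E ->
  (\int[P]_om f (X om) = \int[P']_om f (X' om))%E.
Proof.
move=> iX iX' mf f0.
have mX := indep_family_env iX; have mX' := indep_family_env iX'.
have := @ge0_integral_pushforward _ _ _ _ R _ mX P setT f measurableT mf (fun x _ => f0 x).
rewrite preimage_setT => <-.
have := @ge0_integral_pushforward _ _ _ _ R _ mX' P' setT f measurableT mf (fun x _ => f0 x).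
rewrite preimage_setT => <-.
by apply: eq_measure_integral => A mA _; exact: (indep_family_law iX iX').
Qed.

Lemma indep_family_relabel d (T : measurableType d) (P : {measure set T -> \bar R})
    X (mu : K -> set R -> \bar R) (K' : choiceType) (phi : K' -> K) :
  indep_family P X mu -> injective phi ->
  (forall k, measurable_fun setT (fun om => X om (phi k))) /\
  (forall s (A : K' -> set R), uniq s -> (forall k, measurable (A k)) ->
    P ((fun om k => X om (phi k)) @^-1` cylinder s A) =
      (\prod_(k <- s) mu (phi k) (A k))%E).
Proof.
move=> iX phiI; split; first by move=> k; case: iX.
move=> s A us mA.
pose A' k := nth setT (map A s) (index k (map phi s)).
have A'E k : k \in s -> A' (phi k) = A k.
  move=> ks; rewrite /A' index_map// (nth_map k) ?index_mem//.
  by rewrite nth_index.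
transitivity (P (X @^-1` cylinder (map phi s) A')).
  congr (P _); apply/seteqP; split => om /= H k.
    by move=> /mapP[k' k's ->]; rewrite A'E//; exact: H.
  by move=> ks; rewrite -A'E//; apply: H; exact: map_f.
rewrite iX.2.
- by rewrite big_map big_seq [RHS]big_seq; apply: eq_bigr => k ks; rewrite A'E.
- by rewrite map_inj_uniq.
- move=> k; rewrite /A'; case: (ltnP (index k (map phi s)) (size (map A s))) => h.
    by have /mapP[k' _ ->] := mem_nth setT h; exact: mA.
  by rewrite nth_default.
Qed.

End IndependentFamily.

Section Resampling.
Context {R : realType} {K : choiceType}.
Context d (T : measurableType d) (P : probability T R).
Variables (X : T -> K -> R) (mu : K -> set R -> \bar R).
Hypothesis indepX : indep_family P X mu.

(** Two independent copies of the family, mixed site by site. As the law does not change, Fubini on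
    [T * T] plays the role of conditioning on the sites in [S]. *)
Definition resample (S : pred K) (om : T * T) (k : K) : R :=
  if S k then X om.1 k else X om.2 k.

Lemma indep_family_resample (S : pred K) :
  indep_family (P \x P)%E (resample S) mu.
Proof.
have mX := indepX.1; split.
  move=> k; rewrite /resample; case: (S k).
    by apply: (measurableT_comp (f := fun om => X om k)) => //; exact: mX.
  by apply: (measurableT_comp (f := fun om => X om k)) => //; exact: mX.
move=> s A us mA.
have -> : resample S @^-1` cylinder s A =
    (X @^-1` cylinder [seq k <- s | S k] A) `*`
    (X @^-1` cylinder [seq k <- s | ~~ S k] A).
  apply/seteqP; split => -[u v]; rewrite /resample /=.
    move=> H; split => k; rewrite mem_filter => /andP[Sk /H]; first by rewrite Sk.
    by rewrite (negbTE Sk).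
  move=> [H1 H2] k ks; case: ifP => Sk.
    by apply: H1; rewrite mem_filter Sk.
  by apply: H2; rewrite mem_filter /= Sk.
have mXE := indep_family_env indepX.
have mcyl s' : measurable (X @^-1` cylinder s' A).
  by rewrite -[X in measurable X]setTI; apply: mXE => //; exact: measurable_cylinder.
rewrite [LHS]product_measure1E//.
rewrite !(indepX.2)// ?filter_uniq//.
rewrite !big_filter.
by rewrite [RHS](bigID S).
Qed.

End Resampling.

Lemma measure_eq_null (R : realType) d (T : measurableType d)
    (m : {measure set T -> \bar R}) (A B N : set T) :
  measurable A -> measurable B -> measurable N -> m N = 0%E ->
  (forall x, ~ N x -> A x <-> B x) -> m A = m B.
Proof.
move=> mA mB mN N0 AB.
rewrite -(measureU0 mA mN N0) -(measureU0 mB mN N0); congr (m _).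
apply/seteqP; split => x /= [h|h]; try by right.
  by case: (pselect (N x)) => [|nN]; [right|left; apply/(AB x nN)].
by case: (pselect (N x)) => [|nN]; [right|left; apply/(AB x nN)].
Qed.

Section ExponentialPair.
Context {R : realType} {K : choiceType}.
Context d (T : measurableType d) (P : probability T R).
Variables (X : T -> K -> R) (mu : K -> set R -> \bar R).
Hypothesis indepX : indep_family P X mu.

Let mX k : measurable_fun setT (fun om => X om k).
Proof. exact: indepX.1. Qed.

Lemma measurable_env_pre (B : set (env R K)) : measurable B -> measurable (X @^-1` B).
Proof.
move=> mB; rewrite -[X in measurable X]setTI.
by apply: (indep_family_env indepX).
Qed.

Lemma indep_family_integral_exp k r (r0 : 0 < r) (f : R -> \bar R) A :
  mu k = exponential_prob r -> measurable A -> 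
  @measurable_fun _ _ (measurableTypeR R) _ A f -> (forall x, 0 <= f x)%E ->
  (\int[P]_(om in (fun om => X om k) @^-1` A) f (X om k) =
   \int[exp_law r0]_(x in A) f x)%E.
Proof.
move=> muk mA mf f0.
have mXk : @measurable_fun _ _ T (measurableTypeR R) setT (fun om => X om k) := mX k.
have := @ge0_integral_pushforward _ _ _ (measurableTypeR R) R _ mXk P A f mA mf (fun x _ => f0 x).
move=> <-; apply: eq_measure_integral => B mB _.
by rewrite /pushforward [LHS](indep_family_marginal indepX)// muk.
Qed.

(** Resampling the site [k] alone keeps the value of [F] fixed, and an atomless variable avoids a
    fixed value. *)
Lemma indep_family_tie k (F : env R K -> R) :
  (forall t, mu k [set t] = 0%E) -> measurable_fun setT F ->
  (forall x y : K -> R, (forall k', k' != k -> x k' = y k') -> F x = F y) ->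
  P [set om | X om k = F (X om)] = 0%E.
Proof.
move=> mu0 mF Fk.
pose E : set (env R K) := [set x | x k = F x].
have mE : measurable E.
  have -> : E = (fun x => x k - F x) @^-1` [set 0].
    apply/seteqP; split => x; rewrite /E/=; first by move=> ->; rewrite subrr.
    by move/eqP; rewrite subr_eq0 => /eqP.
  rewrite -[X in measurable X]setTI.
  by apply: (@measurable_funB _ (env R K) R) => //; exact: env_coord.
rewrite [LHS](indep_family_law indepX (indep_family_resample indepX (predC1 k)) mE).
transitivity (\int[P]_om P (xsection (resample X (predC1 k) @^-1` E) om))%E; first by [].
apply: integral0_eq => om _.
rewrite -[RHS](mu0 (F (X om))) -(indep_family_marginal indepX)//.
congr (P _); apply/seteqP; split => u; rewrite /xsection /= inE /E /resample /= eqxx /=.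
  by move=> ->; apply: Fk => k' ->.
by move=> ->; apply: Fk => k' ->.
Qed.

Variables (i j : K) (a b : R).
Hypotheses (ij : i != j) (a0 : 0 < a) (b0 : 0 < b).
Hypotheses (mui : mu i = exponential_prob a) (muj : mu j = exponential_prob b).

(** Given the smaller variable [X j], the excess of [X i] is again exponential by memorylessness;
    integrating the factor [expR (- a * X j)] tilts the rate of [X j] to [b + a]. *)
Lemma exponential_pair_lt A B : measurable A -> measurable B ->
  P [set om | [/\ A (X om j), X om j < X om i & B (X om i - X om j)]] =
  ((b / (b + a))%:E * exponential_prob (b + a) A *
     exponential_prob a (B `&` [set` `]0%R, +oo[]))%E.
Proof.
move=> mA mB.
have ba0 : 0 < b + a by rewrite addr_gt0.
pose E (C : set R) : set (env R K) := [set x | [/\ C (x j), x j < x i & B (x i - x j)]].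
have mE C : measurable C -> measurable (E C).
  move=> mC.
  have -> : E C = (fun x => x j) @^-1` C `&`
      ((fun x => x i - x j) @^-1` (B `&` [set` `]0%R, +oo[])).
    apply/seteqP; split => x; rewrite /E/= in_itv/= andbT subr_gt0.
      by case.
    by move=> [? [? ?]].
  apply: measurableI.
    by rewrite -[X in measurable X]setTI; exact: env_coord.
  rewrite -[X in measurable X]setTI.
  apply: (@measurable_funB _ (env R K) R) => //; [exact: env_coord|exact: env_coord|].
  exact: measurableI.
(* The shift by [X j] asks for a nonnegative threshold; negative values are null. *)
pose A' := A `&` [set` `[0%R, +oo[].
have mA' : measurable A' by exact: measurableI.
have Xneg : P ((fun om => X om j) @^-1` [set` `]-oo, 0%R[]) = 0%E.
  by rewrite [LHS](indep_family_marginal indepX)// muj exponential_prob_Iio0.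
have mXneg : measurable ((fun om => X om j) @^-1` [set` `]-oo, 0%R[]).
  by rewrite -[X in measurable X]setTI; exact: mX.
have -> : exponential_prob (b + a) A = exponential_prob (b + a) A'.
  rewrite -!(exp_lawE ba0).
  apply: (@measure_eq_null _ _ _ (exp_law ba0) _ _ [set` `]-oo, 0%R[]) => //.
    exact: exponential_prob_Iio0.
  by move=> x /=; rewrite /A' /= !in_itv/= andbT => /negP; rewrite -leNgt; tauto.
transitivity (P (X @^-1` E A')).
  apply: (@measure_eq_null _ _ _ P _ _ _ (measurable_env_pre (mE _ mA))
    (measurable_env_pre (mE _ mA')) mXneg Xneg) => om /=.
  rewrite /E /A' /= !in_itv/= andbT => /negP; rewrite -leNgt => X0.
  by split=> [[]|[[]]].
rewrite (indep_family_law indepX (indep_family_resample indepX (pred1 j)) (mE _ mA')).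
set c := exponential_prob a _.
have c0 : (0 <= c)%E by rewrite /c -(exp_lawE a0).
transitivity (\int[P]_(om in (fun om => X om j) @^-1` A')
    ((expR (- a * X om j))%:E * c))%E; last first.
  rewrite (indep_family_integral_exp b0 (f := fun x => (expR (- a * x))%:E * c)%E)//.
  - rewrite ge0_integralZr//=.
    + by rewrite (integral_exp_law_expR b0 ba0 mA').
    + by apply: measurable_funTS; apply: measurableT_comp => //; apply: measurableT_comp => //;
        exact: measurable_funM.
  - apply: emeasurable_funM => //; apply: measurable_funTS; apply: measurableT_comp => //.
    by apply: measurableT_comp => //; exact: measurable_funM.
  - by move=> x; rewrite mule_ge0// lee_fin expR_ge0.
transitivity (\int[P]_om P (xsection (resample X (pred1 j) @^-1` E A') om))%E; first by [].
rewrite [RHS]integral_mkcond; apply: eq_integral => om _ /=.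
rewrite patchE; case: ifPn; rewrite ?inE ?notin_setE /= => omA.
  rewrite /c -exponential_prob_shift//; last by move: omA; rewrite /A' /= in_itv/= andbT => -[].
  rewrite -[in RHS]mui -(indep_family_marginal indepX); last first.
    rewrite (_ : [set _ | _] = [set` `](X om j), +oo[] `&` (fun x => x - X om j) @^-1` B); last first.
      by apply/seteqP; split => x /=; rewrite in_itv/= andbT.
    apply: measurableI => //; rewrite -[X in measurable X]setTI.
    by apply: (@measurable_funB _ R R) => //.
  congr (P _); apply/seteqP; split => u; rewrite /xsection /= inE /E /resample /=.
    by rewrite (negbTE ij) eqxx => -[].
  by rewrite (negbTE ij) eqxx => -[].
rewrite (_ : xsection _ _ = set0) ?measure0//.
apply/seteqP; split => u //; rewrite /xsection /= inE /E /resample /=.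
by rewrite eqxx => -[].
Qed.

End ExponentialPair.

Section MinDiff.
Context {R : realType} {K : choiceType}.
Context d (T : measurableType d) (P : probability T R).
Variables (X : T -> K -> R) (mu : K -> set R -> \bar R).
Hypothesis indepX : indep_family P X mu.
Variables (i j : K) (a b : R).
Hypotheses (ij : i != j) (a0 : 0 < a) (b0 : 0 < b) (ab1 : a + b = 1).
Hypotheses (mui : mu i = exponential_prob a) (muj : mu j = exponential_prob b).

Let ba1 : b + a = 1. Proof. by rewrite addrC. Qed.

Lemma exponential_pair_ltE :
  P [set om | X om j < X om i] = b%:E.
Proof.
have := @exponential_pair_lt _ _ _ _ _ _ _ indepX _ _ _ _ ij a0 b0 mui muj setT setT
  measurableT measurableT.
rewrite ba1 setTI exponential_prob_tail// mulr0 expR0 mule1.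
rewrite -[in X in _ = X -> _](exp_lawE ltr01) probability_setT mule1 divr1 => <-.
by congr (P _); apply/seteqP; split => x /= [].
Qed.

Let tie0 : P [set om | X om i = X om j] = 0%E.
Proof.
apply: (indep_family_tie indepX (F := fun x => x j)).
- by move=> t; rewrite mui exponential_prob_set1.
- exact: env_coord.
- by move=> x y; apply; rewrite eq_sym.
Qed.

(** Two-sided exponential law of the difference of independent variables with rates [a] and [b], for
    [a + b = 1]: it is positive with probability [b], the rate of the subtracted variable. *)
Definition diff_law (B : set R) : \bar R :=
  (b%:E * exponential_prob a (B `&` [set` `]0%R, +oo[]) +
   a%:E * exponential_prob b (-%R @^-1` B `&` [set` `]0%R, +oo[]))%E.

Let mpre (B : set (env R K)) : measurable B -> measurable (X @^-1` B).
Proof. exact: (measurable_env_pre indepX). Qed.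

(** Each of the two orderings of the pair yields the same law for the minimum, so their sum
    factorizes. *)
Lemma exponential_min_diff A B : measurable A -> measurable B ->
  P [set om | A (Num.min (X om i) (X om j)) /\ B (X om i - X om j)] =
  (exponential_prob 1 A * diff_law B)%E.
Proof.
move=> mA mB.
have mNB : measurable (-%R @^-1` B).
  by rewrite -[X in measurable X]setTI; exact: (@oppr_measurable R setT).
have mcoord k : measurable_fun [set: env R K] (fun x : env R K => x k) by exact: env_coord.
pose E := [set x : env R K | A (Num.min (x i) (x j)) /\ B (x i - x j)].
have mE : measurable E.
  have -> : E = (fun x => Num.min (x i) (x j)) @^-1` A `&` (fun x => x i - x j) @^-1` B by [].
  apply: measurableI; rewrite -[X in measurable X]setTI.
    by apply: (@measurable_minr _ (env R K) R).
  by apply: (@measurable_funB _ (env R K) R).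
have mlt k l : measurable [set x : env R K | x k < x l].
  rewrite -[X in measurable X]setTI.
  by apply: (@measurable_fun_ltr _ (env R K) R _ _ _ _ _ measurableT [set true]).
have := @exponential_pair_lt _ _ _ _ _ _ _ indepX _ _ _ _ ij a0 b0 mui muj A B mA mB.
have ji : j != i by rewrite eq_sym.
have := @exponential_pair_lt _ _ _ _ _ _ _ indepX _ _ _ _ ji b0 a0 muj mui A _ mA mNB.
rewrite ab1 ba1 !divr1 => H2 H1.
rewrite /diff_law muleDr ?ge0_adde_def ?inE//; last 2 first.
  by rewrite -(exp_lawE a0) mule_ge0// lee_fin ltW.
  by rewrite -(exp_lawE b0) mule_ge0// lee_fin ltW.
rewrite muleA (muleC _ b%:E) -H1 muleA (muleC _ a%:E) -H2.
have E1 : [set om | [/\ A (X om j), X om j < X om i & B (X om i - X om j)]] =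
    X @^-1` (E `&` [set x | x j < x i]).
  apply/seteqP; split => om; rewrite /E /=.
    by move=> [? l ?]; rewrite min_r// ltW.
  by move=> [[+ ?] l]; rewrite min_r// ltW.
have E2 : [set om | [/\ A (X om i), X om i < X om j &
        (-%R @^-1` B) (X om j - X om i)]] =
    X @^-1` (E `&` [set x | x i < x j]).
  apply/seteqP; split => om; rewrite /E /= opprB.
    by move=> [? l ?]; rewrite min_l// ltW.
  by move=> [[+ ?] l]; rewrite min_l// ltW.
rewrite E1 E2 -measureU; first last.
- by apply/seteqP; split => om //= [[_ l1] [_ l2]]; have := lt_trans l1 l2; rewrite ltxx.
- by apply: mpre; exact: measurableI.
- by apply: mpre; exact: measurableI.
apply: (@measure_eq_null _ _ _ P _ _ [set om | X om i = X om j]) => //.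
- exact: (mpre mE).
- by apply: measurableU; apply: mpre; exact: measurableI.
- rewrite (_ : [set _ | _] = X @^-1` (~` ([set x | x i < x j] `|` [set x | x j < x i]))).
    by apply: mpre; apply: measurableC; exact: measurableU.
  apply/seteqP; split => om /=; first by move=> ->; rewrite ltxx; case.
  by move=> /not_orP[] /negP + /negP; rewrite -!leNgt => h1 h2; apply/le_anti; rewrite h1 h2.
- move=> om /= /eqP; rewrite /E /=; case: ltgtP => // l _;
  split=> [h|[[]|[]]] //; (by left; split) || (by right; split).
by rewrite -(exp_lawE ltr01) fin_num_measure.
Qed.

End MinDiff.

Section Move.
Context {R : realType} {K : choiceType}.
Context d (T : measurableType d) (P : probability T R).

(** Coordinates missing from [s] are added with the constraint [setT], so only cylinders that
    involve all of [t] have to be computed. *)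
Lemma indep_family_superset (X : T -> K -> R) (mu : K -> set R -> \bar R)
    (t : seq K) : uniq t ->
  (forall k, measurable_fun setT (fun om => X om k)) ->
  (forall k, mu k setT = 1%E) ->
  (forall s A, uniq s -> {subset t <= s} -> (forall k, measurable (A k)) ->
    P (X @^-1` cylinder s A) = (\prod_(k <- s) mu k (A k))%E) ->
  indep_family P X mu.
Proof.
move=> ut mX muT H; split => // s A us mA.
pose s' := s ++ [seq k <- t | k \notin s].
pose A' k := if k \in s then A k else setT.
have -> : cylinder s A = cylinder s' A'.
  apply/seteqP; split => x /= h k.
    by move=> _; rewrite /A'; case: ifP => // /h.
  move=> ks; have := h k; rewrite /A' ks; apply.
  by rewrite mem_cat ks.
rewrite [LHS]H.
- rewrite big_cat /= [X in (_ * X)%E]big_seq [X in (_ * X)%E]big1 ?mule1; last first.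
    by move=> k; rewrite mem_filter /A' => /andP[/negbTE -> _].
  by rewrite big_seq [RHS]big_seq; apply: eq_bigr => k; rewrite /A' => ->.
- rewrite cat_uniq us filter_uniq// andbT.
  by apply/hasPn => k; rewrite mem_filter => /andP[].
- by move=> k kt; rewrite mem_cat mem_filter kt andbT; case: (k \in s).
- by move=> k; rewrite /A'; case: ifP.
Qed.

Variables (X : T -> K -> R) (mu : K -> set R -> \bar R).
Hypothesis indepX : indep_family P X mu.
Variables (i j k : K) (a b : R).
Hypotheses (ij : i != j) (ik : i != k) (jk : j != k).
Hypotheses (a0 : 0 < a) (b0 : 0 < b) (ab1 : a + b = 1).
Hypotheses (mui : mu i = exponential_prob a) (muj : mu j = exponential_prob b).
Hypotheses (muk : mu k = exponential_prob 1).

Definition min_diff (x : K -> R) (l : K) : R :=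
  if l == i then Num.min (x i) (x j) else if l == j then x i - x j else x l.

Let nu (l : K) : set R -> \bar R :=
  if l == i then exponential_prob 1 else if l == j then diff_law a b else mu l.

Let mmin_diff : measurable_fun [set: env R K] (min_diff : env R K -> env R K).
Proof.
apply: measurable_env => l; rewrite /min_diff; case: (l == i).
  by apply: (@measurable_minr _ (env R K) R); exact: env_coord.
case: (l == j); last exact: env_coord.
by apply: (@measurable_funB _ (env R K) R); exact: env_coord.
Qed.

Lemma indep_family_min_diff : indep_family P (fun om => min_diff (X om)) nu.
Proof.
have ji : j == i = false by rewrite eq_sym (negbTE ij).
have ut : uniq [:: i; j] by rewrite /= inE ij.
apply: (indep_family_superset ut).
- move=> l; have mX := indepX.1; rewrite /min_diff; case: (l == i).
    exact: (@measurable_minr _ T R).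
  by case: (l == j) => //; exact: (@measurable_funB _ T R).
- move=> l; rewrite /nu; case: ifP => _.
    by rewrite -(exp_lawE ltr01) probability_setT.
  case: ifP => _.
    rewrite /diff_law preimage_setT !setTI !exponential_prob_tail// !mulr0 expR0 !mule1.
    by rewrite -EFinD addrC ab1.
  rewrite -(indep_family_marginal indepX)// preimage_setT.
  exact: probability_setT.
move=> s A us ts mA.
pose s' := [seq l <- s | (l != i) && (l != j)].
have sE : perm_eq s [:: i, j & s'].
  apply: uniq_perm => //.
    by rewrite /= !inE !mem_filter !eqxx /= (negbTE ij) ji /= filter_uniq.
  move=> l; rewrite !inE mem_filter.
  have [->|/=] := eqVneq l i; first by rewrite ts ?inE ?eqxx.
  have [->|/=] := eqVneq l j; first by rewrite ts ?inE ?eqxx ?orbT.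
  by [].
have mE : measurable (min_diff @^-1` cylinder s A : set (env R K)).
  by rewrite -[X in measurable X]setTI; apply: mmin_diff => //; exact: measurable_cylinder.
rewrite [LHS](indep_family_law indepX
  (indep_family_resample indepX (fun l => (l == i) || (l == j))) mE).
pose E1 := [set om | A i (Num.min (X om i) (X om j)) /\ A j (X om i - X om j)].
have -> : resample X (fun l => (l == i) || (l == j)) @^-1` (min_diff @^-1` cylinder s A)
    = E1 `*` (X @^-1` cylinder s' A).
  apply/seteqP; split => -[u v]; rewrite /E1 /min_diff /resample /= !eqxx ?orbT /=.
    move=> h; split.
      split; first by have := h i; rewrite eqxx; apply; apply: ts; rewrite inE eqxx.
      by have := h j; rewrite ji eqxx; apply; apply: ts; rewrite !inE eqxx orbT.
    move=> l; rewrite mem_filter => /andP[/andP[li lj] ls].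
    by have := h l ls; rewrite (negbTE li) (negbTE lj).
  move=> [[h1 h2] h3] l ls; case: (eqVneq l i) => [->//|li].
  case: (eqVneq l j) => [->//|lj] /=.
  by apply: h3; rewrite mem_filter li lj.
have mE1 : measurable E1.
  apply: (measurableI (_ @^-1` A i) ((fun om => X om i - X om j) @^-1` A j));
    rewrite -[X in measurable X]setTI.
    by apply: (@measurable_minr _ T R) => //; exact: indepX.1.
  by apply: (@measurable_funB _ T R) => //; exact: indepX.1.
rewrite [LHS]product_measure1E//; last exact: (measurable_env_pre indepX (measurable_cylinder _ _)).
rewrite [X in (X * _)%E](exponential_min_diff indepX ij a0 b0 ab1 mui muj)//.
rewrite [X in (_ * X)%E]indepX.2 ?filter_uniq//.
rewrite (perm_big _ sE) /= !big_cons /nu !eqxx ji muleA; congr (_ * _)%E.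
rewrite big_seq [RHS]big_seq; apply: eq_bigr => l.
by rewrite mem_filter => /andP[/andP[/negbTE -> /negbTE ->]].
Qed.

(** One cell of corner growth: [i] and [j] hold the incoming horizontal and vertical increments and
    [k] the weight of the cell; afterwards they hold the outgoing increments and the dual weight. *)
Definition corner_move (x : K -> R) (l : K) : R :=
  if l == i then x k + Num.max 0 (x i - x j)
  else if l == j then x k + Num.max 0 (x j - x i)
  else if l == k then Num.min (x i) (x j) else x l.

(* The move swaps [x k] and [min (x i) (x j)], which are equidistributed and,
   by [indep_family_min_diff], independent of each other and of
   [x i - x j]. *)
Lemma indep_family_corner_move : indep_family P (fun om => corner_move (X om)) mu.
Proof.
have ji : j == i = false by rewrite eq_sym (negbTE ij).
have ki : k == i = false by rewrite eq_sym (negbTE ik).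
have kj : k == j = false by rewrite eq_sym (negbTE jk).
pose sw l := if l == i then k else if l == k then i else l.
have swK : involutive sw.
  move=> l; rewrite /sw; case: (eqVneq l i) => [->|li]; first by rewrite ki eqxx.
  case: (eqVneq l k) => [->|lk]; first by rewrite eqxx.
  by rewrite (negbTE li) (negbTE lk).
(* Inverse of [min_diff]; after the exchange of the slots [i] and [k] it yields [corner_move]. *)
pose rebuild (y : K -> R) l := if l == i then y i + Num.max 0 (y j)
  else if l == j then y i + Num.max 0 (- y j) else y l.
have mrebuild : measurable_fun [set: env R K] (rebuild : env R K -> env R K).
  apply: measurable_env => l; rewrite /rebuild; case: (l == i).
    apply: (@measurable_funD _ (env R K) R); first exact: env_coord.
    by apply: (@measurable_maxr _ (env R K) R) => //; exact: env_coord.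
  case: (l == j); last exact: env_coord.
  apply: (@measurable_funD _ (env R K) R); first exact: env_coord.
  apply: (@measurable_maxr _ (env R K) R) => //.
  by apply: (@measurable_funN _ (env R K) R); exact: env_coord.
have iY := indep_family_min_diff.
have iY' : indep_family P (fun om l => min_diff (X om) (sw l)) nu.
  apply: (indep_family_ext (mu := fun l => nu (sw l))).
    exact: (indep_family_relabel iY (inv_inj swK)).
  move=> l A mA; rewrite /sw /nu; case: (eqVneq l i) => [_|li].
    by rewrite ki kj muk.
  by case: (eqVneq l k) => [->|lk]; rewrite ?eqxx ?kj ?muk // (negbTE li).
have XE x : rebuild (min_diff x) = x.
  apply/funext => l; rewrite /rebuild /min_diff !eqxx ji.
  case: (eqVneq l i) => [->|li].
    by rewrite /Num.min /Num.max; do ! case: ifP; lra.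
  case: (eqVneq l j) => [->|lj] //.
  by rewrite /Num.min /Num.max; do ! case: ifP; lra.
have mvE x : rebuild (fun l => min_diff x (sw l)) = corner_move x.
  apply/funext => l; rewrite /rebuild /corner_move /min_diff /sw.
  rewrite !(eqxx, ji, ki, kj, negbTE jk)/=.
  have [//|li] := eqVneq l i.
  have [_|lj] := eqVneq l j; first by rewrite opprB.
  by have [_|lk] := eqVneq l k; rewrite ?eqxx// (negbTE li) (negbTE lj).
split.
  move=> l; rewrite /corner_move.
  have mX := indepX.1.
  case: (l == i).
    apply: (@measurable_funD _ T R) => //; apply: (@measurable_maxr _ T R) => //.
    by apply: (@measurable_funB _ T R).
  case: (l == j).
    apply: (@measurable_funD _ T R) => //; apply: (@measurable_maxr _ T R) => //.
    by apply: (@measurable_funB _ T R).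
  by case: (l == k) => //; apply: (@measurable_minr _ T R).
move=> s A us mA; rewrite -indepX.2//.
have mC : measurable (rebuild @^-1` cylinder s A : set (env R K)).
  by rewrite -[X in measurable X]setTI; apply: mrebuild => //; exact: measurable_cylinder.
transitivity (P ((fun om l => min_diff (X om) (sw l)) @^-1` (rebuild @^-1` cylinder s A))).
  by congr (P _); apply/seteqP; split => om /=; rewrite mvE.
rewrite [LHS](indep_family_law iY' iY mC).
by congr (P _); apply/seteqP; split => om /=; rewrite XE.
Qed.

End Move.

(** * Chernoff bounds for sums of exponential variables *)

Section Chernoff.
Context {R : realType} {K : choiceType}.
Context d (T : measurableType d) (P : probability T R).
Variables (X : T -> K -> R) (mu : K -> set R -> \bar R).
Hypothesis indepX : indep_family P X mu.

Lemma exponential_sum_mgf (r c : R) (s : seq K) : 0 < r -> 0 < r + c -> uniq s ->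
  (forall k, k \in s -> mu k = exponential_prob r) ->
  (\int[P]_om (expR (- c * \sum_(k <- s) X om k))%:E =
   ((r / (r + c)) ^+ size s)%:E)%E.
Proof.
move=> r0 rc0; elim: s => [_ _|k s IH /= /andP[ks us] mus].
  under eq_integral do rewrite big_nil mulr0 expR0.
  rewrite integral_cst// mul1e; exact: probability_setT.
have mexp c' : measurable_fun [set: R] (fun x : R => expR (c' * x)).
  by apply: measurableT_comp => //; exact: measurable_funM.
have msum t : measurable_fun [set: env R K] (fun x : env R K => \sum_(k <- t) x k).
  by apply: (@measurable_sum _ (env R K) R) => l; exact: env_coord.
pose f (x : env R K) := (expR (- c * \sum_(l <- k :: s) x l))%:E.
have mf : measurable_fun setT f.
  apply/measurable_EFinP; exact: (measurableT_comp (mexp _) (msum _)).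
have f0 x : (0 <= f x)%E by rewrite lee_fin expR_ge0.
rewrite [LHS](indep_family_integral indepX (indep_family_resample indepX (pred1 k)) mf f0).
pose g (om : T * T) := ((expR (- c * X om.1 k))%:E *
   (expR (- c * \sum_(k <- s) X om.2 k))%:E)%E.
have mX l : measurable_fun setT (fun om => X om l) by exact: indepX.1.
have mXs : measurable_fun setT (fun om => \sum_(k <- s) X om k).
  exact: measurable_sum.
have fg om : f (resample X (pred1 k) om) = g om.
  rewrite /f /g -EFinM -expRD; congr (expR _)%:E.
  rewrite big_cons {1}/resample /= eqxx mulrDr; congr (_ + - c * _).
  rewrite big_seq [RHS]big_seq; apply: eq_bigr => l ls; rewrite /resample /=.
  by case: eqP => // lk; rewrite -lk ls in ks.
under eq_integral do rewrite fg.
have mg1 : measurable_fun setT (fun om => (expR (- c * X om k))%:E).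
  by apply/measurable_EFinP; exact: (measurableT_comp (mexp _)).
have mg2 : measurable_fun setT (fun om => (expR (- c * \sum_(k <- s) X om k))%:E).
  by apply/measurable_EFinP; exact: (measurableT_comp (mexp _)).
have mg : measurable_fun setT g.
  apply: emeasurable_funM; first exact: (measurableT_comp mg1).
  exact: (measurableT_comp mg2).
rewrite fubini_tonelli1//; last by move=> om; rewrite /g mule_ge0// lee_fin expR_ge0.
rewrite /fubini_F /g /=.
under eq_integral do rewrite ge0_integralZl ?lee_fin ?expR_ge0//.
rewrite IH//; last by move=> l ls; apply: mus; rewrite inE ls orbT.
rewrite ge0_integralZr//; last first.
  by rewrite lee_fin exprn_ge0// divr_ge0// ltW.
have muk : mu k = exponential_prob r by apply: mus; rewrite inE eqxx.
have := indep_family_integral_exp indepX r0 (f := fun x => (expR (- c * x))%:E) muk measurableT.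
rewrite preimage_setT => ->//; last first.
  by apply/measurable_EFinP; exact: mexp.
rewrite (integral_exp_law_expR r0 rc0 measurableT).
have rc1 : exponential_prob (r + c) [set: R] = 1%E.
  by rewrite -(exp_lawE rc0) probability_setT.
by rewrite rc1 mule1 -EFinM exprS.
Qed.

(** Positive [c] controls the lower tail of the sum and negative [c] the upper one. *)
Lemma exponential_sum_chernoff (r c v : R) (s : seq K) : 0 < r -> 0 < r + c -> uniq s ->
  (forall k, k \in s -> mu k = exponential_prob r) ->
  (P [set om | (v <= - c * \sum_(k <- s) X om k)%R] <=
   ((r / (r + c)) ^+ size s * expR (- v))%:E)%E.
Proof.
move=> r0 rc0 us mus.
have mX l : measurable_fun setT (fun om => X om l) by exact: indepX.1.
have mS : measurable_fun setT (fun om => - c * \sum_(k <- s) X om k).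
  by apply: measurable_funM => //; exact: measurable_sum.
pose S : {RV P >-> R} := mfun_Sub (mem_set mS).
have := @chernoff _ _ _ P S 1 v ltr01.
rewrite /mmt_gen_fun unlock mul1r EFinM => /le_trans; apply.
rewrite -(exponential_sum_mgf r0 rc0 us mus) le_eqVlt; apply/orP; left; apply/eqP.
by congr (_ * _)%E; apply: eq_integral => om _ /=; rewrite mulr1.
Qed.

End Chernoff.

Section LargeDeviations.
Context {R : realType}.
Implicit Types (e : R).

(** The larger of the Chernoff factors per summand for a relative deviation [e] below or above the
    mean. The tilts [r * (e / 2)] and [- (r * (e / 2))] are not optimal, but keep the comparison
    with 1 polynomial. *)
Definition chernoff_rate e : R :=
  Num.max (expR (e / 2 * (1 - e)) / (1 + e / 2)) (expR (- (e / 2 * (1 + e))) / (1 - e / 2)).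

Let half_lt1 e : e < 1 -> 0 < 1 - e / 2.
Proof. lra. Qed.

Let fracD (r e : R) : 0 < r -> 0 < e -> r / (r + r * (e / 2)) = (1 + e / 2)^-1.
Proof.
move=> r0 e0; have -> : r + r * (e / 2) = r * (1 + e / 2) by ring.
by rewrite invfM mulrA divff ?mul1r// gt_eqF.
Qed.

Let fracB (r e : R) : 0 < r -> e < 1 -> r / (r + - (r * (e / 2))) = (1 - e / 2)^-1.
Proof.
move=> r0 e0; have -> : r + - (r * (e / 2)) = r * (1 - e / 2) by ring.
by rewrite invfM mulrA divff ?mul1r// gt_eqF.
Qed.

Lemma chernoff_rate_bounds e : 0 < e -> e < 1 -> 0 < chernoff_rate e < 1.
Proof.
move=> e0 e1; rewrite /chernoff_rate lt_max divr_gt0 ?expR_gt0//=; last by lra.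
rewrite gt_max !ltr_pdivrMr ?mul1r; [|lra|lra].
(* The inequality [1 + u <= expR u] at the opposite exponent bounds each exponential by an inverse,
   which leaves polynomial inequalities. *)
have D (x y : R) : 0 < x -> 1 < y * x -> x^-1 < y.
  by move=> x0 h; rewrite -[ltLHS]mul1r ltr_pdivrMr.
apply/andP; split.
  have h : 0 < 1 + - (e / 2 * (1 - e)) by nra.
  have h2 : (1 + - (e / 2 * (1 - e)))^-1 < 1 + e / 2 by apply: D => //; nra.
  apply: le_lt_trans h2; rewrite -[leLHS]invrK lef_pV2 ?posrE ?invr_gt0 ?expR_gt0//.
  by rewrite -expRN; exact: expR_ge1Dx.
have h : 0 < 1 + e / 2 * (1 + e) by nra.
have h3 : 0 < e * e * (1 - e) by rewrite !mulr_gt0// subr_gt0.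
have h2 : (1 + e / 2 * (1 + e))^-1 < 1 - e / 2.
  apply: D => //.
  by have -> : (1 - e / 2) * (1 + e / 2 * (1 + e)) = 1 + e * e * (1 - e) / 4;
    [field|rewrite ltrDl divr_gt0].
apply: le_lt_trans h2; rewrite expRN lef_pV2 ?posrE ?expR_gt0//.
exact: expR_ge1Dx.
Qed.

Context {K : choiceType} d (T : measurableType d) (P : probability T R).
Variables (X : T -> K -> R) (mu : K -> set R -> \bar R).
Hypothesis indepX : indep_family P X mu.
Variables (e r : R) (s : seq K).
Hypotheses (e0 : 0 < e) (e1 : e < 1) (r0 : 0 < r) (us : uniq s).
Hypothesis mus : forall k, k \in s -> mu k = exponential_prob r.

Lemma exponential_sum_lower :
  (P [set om | (\sum_(k <- s) X om k <= (1 - e) * (size s)%:R / r)%R] <=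
   (chernoff_rate e ^+ size s)%:E)%E.
Proof.
have c0 : 0 < r + r * (e / 2) by rewrite addr_gt0// mulr_gt0// divr_gt0.
have := @exponential_sum_chernoff _ _ _ _ _ _ _ indepX r (r * (e / 2))
  (- (e / 2 * (1 - e) * (size s)%:R)) s r0 c0 us mus.
have -> : [set om | - (e / 2 * (1 - e) * (size s)%:R) <=
     - (r * (e / 2)) * \sum_(k <- s) X om k] =
   [set om | (\sum_(k <- s) X om k <= (1 - e) * (size s)%:R / r)%R].
  apply/seteqP; split => om /=; rewrite mulNr lerN2 ler_pdivlMr//;
   set S := \sum_(k <- s) _; set N := (size s)%:R;
    (have -> : e / 2 * (1 - e) * N = e / 2 * ((1 - e) * N) by ring);
    (have -> : r * (e / 2) * S = e / 2 * (S * r) by ring);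
    by rewrite ler_pM2l// divr_gt0.
move=> /le_trans; apply; rewrite lee_fin opprK expRM_natr -exprMn.
apply: lerXn2r; rewrite ?nnegrE.
- by rewrite mulr_ge0 ?expR_ge0// divr_ge0 ?ltW.
- by have /andP[/ltW] := chernoff_rate_bounds e0 e1.
rewrite /chernoff_rate le_max; apply/orP; left.
by rewrite fracD// mulrC.
Qed.

Lemma exponential_sum_upper :
  (P [set om | ((1 + e) * (size s)%:R / r <= \sum_(k <- s) X om k)%R] <=
   (chernoff_rate e ^+ size s)%:E)%E.
Proof.
have c0 : 0 < r + - (r * (e / 2)).
  have -> : r + - (r * (e / 2)) = r * (1 - e / 2) by ring.
  by apply: mulr_gt0 => //; exact: half_lt1.
have := @exponential_sum_chernoff _ _ _ _ _ _ _ indepX r (- (r * (e / 2)))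
  (e / 2 * (1 + e) * (size s)%:R) s r0 c0 us mus.
have -> : [set om | e / 2 * (1 + e) * (size s)%:R <=
     - - (r * (e / 2)) * \sum_(k <- s) X om k] =
   [set om | ((1 + e) * (size s)%:R / r <= \sum_(k <- s) X om k)%R].
  apply/seteqP; split => om /=; rewrite opprK ler_pdivrMr//;
   set S := \sum_(k <- s) _; set N := (size s)%:R;
    (have -> : e / 2 * (1 + e) * N = e / 2 * ((1 + e) * N) by ring);
    (have -> : r * (e / 2) * S = e / 2 * (S * r) by ring);
    by rewrite ler_pM2l// divr_gt0.
move=> /le_trans; apply; rewrite lee_fin -[- (_ * _%:R)]mulNr expRM_natr -exprMn.
apply: lerXn2r; rewrite ?nnegrE.
- by rewrite mulr_ge0 ?expR_ge0// divr_ge0 ?ltW.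
- by have /andP[/ltW] := chernoff_rate_bounds e0 e1.
rewrite /chernoff_rate le_max; apply/orP; right.
by rewrite fracB// mulrC.
Qed.

End LargeDeviations.

Lemma exponential_sum_sequence (R : realType) (K : choiceType) d (T : measurableType d)
    (P : probability T R) (X : T -> K -> R) (mu : K -> set R -> \bar R) (f : nat -> K)
    (n : nat) (r e : R) :
  indep_family P X mu -> injective f -> 0 < r -> 0 < e -> e < 1 ->
  (forall k, mu (f k) = exponential_prob r) ->
  (P [set om | (\sum_(k < n) X om (f k) <= (1 - e) * n%:R / r)%R] <=
     (chernoff_rate e ^+ n)%:E)%E /\
  (P [set om | ((1 + e) * n%:R / r <= \sum_(k < n) X om (f k))%R] <=
     (chernoff_rate e ^+ n)%:E)%E.
Proof.
move=> iX fI r0 e0 e1 fr; pose s := [seq f k | k <- iota 0 n].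
have us : uniq s by rewrite map_inj_uniq// iota_uniq.
have ms k : k \in s -> mu k = exponential_prob r by move=> /mapP[l _ ->].
have ss : size s = n by rewrite size_map size_iota.
have sE om : \sum_(k < n) X om (f k) = \sum_(k <- s) X om k.
  by rewrite big_map -(big_mkord xpredT (fun k => X om (f k))) /index_iota subn0.
have := exponential_sum_lower iX e0 e1 r0 us ms.
have := exponential_sum_upper iX e0 e1 r0 us ms.
rewrite ss => U L; split.
  by under eq_set do rewrite sE.
by under eq_set do rewrite sE.
Qed.

(** * Corner growth and Burke's property *)

Section CornerGrowth.
Context {R : realDomainType}.
Implicit Types (x y : nat * nat -> R) (i j p q r : nat).

(* The axis weights are the increments along the axes; [x (0, 0)] is not used. *)
Fixpoint grow x i : nat -> R :=
  match i with
  | 0 => fix axis j := if j is j'.+1 then axis j' + x (0%N, j'.+1) else 0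
  | i'.+1 => fix column j :=
      if j is j'.+1
      then x (i'.+1, j'.+1) + Num.max (grow x i' j'.+1) (column j')
      else grow x i' 0%N + x (i'.+1, 0%N)
  end.

Definition hinc x i j : R := grow x i.+1 j - grow x i j.
Definition vinc x i j : R := grow x i j.+1 - grow x i j.

Lemma grow_xaxis x i : grow x i.+1 0 = grow x i 0 + x (i.+1, 0%N). Proof. by []. Qed.

Lemma grow_yaxis x j : grow x 0 j.+1 = grow x 0 j + x (0%N, j.+1). Proof. by []. Qed.

Lemma growSS x i j :
  grow x i.+1 j.+1 = x (i.+1, j.+1) + Num.max (grow x i j.+1) (grow x i.+1 j).
Proof. by []. Qed.

Lemma grow_ind (Q : nat -> nat -> Prop) : Q 0%N 0%N ->
  (forall i, Q i 0%N -> Q i.+1 0%N) -> (forall j, Q 0%N j -> Q 0%N j.+1) ->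
  (forall i j, Q i j.+1 -> Q i.+1 j -> Q i.+1 j.+1) -> forall i j, Q i j.
Proof.
move=> Q00 QS0 Q0S QSS; elim => [|i IH]; elim => [|j IHj] //.
- exact: Q0S.
- exact: QS0.
- exact: QSS.
Qed.

Lemma grow_ext x y (M N : nat) :
  (forall i j, (i <= M)%N -> (j <= N)%N -> (i, j) != (0%N, 0%N) -> x (i, j) = y (i, j)) ->
  forall i j, (i <= M)%N -> (j <= N)%N -> grow x i j = grow y i j.
Proof.
move=> xy; apply: grow_ind => //.
- by move=> i IH iM _; rewrite !grow_xaxis IH ?xy// ltnW.
- by move=> j IH _ jN; rewrite !grow_yaxis IH ?xy// ltnW.
- by move=> i j IH1 IH2 iM jN; rewrite !growSS IH1 ?IH2 ?xy// ltnW.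
Qed.

Lemma grow_swap x i j : grow (fun z => x (z.2, z.1)) i j = grow x j i.
Proof.
elim: i j => [|i IHi] j.
  by elim: j => // j IHj; rewrite grow_yaxis grow_xaxis IHj.
elim: j => [|j IHj]; first by rewrite grow_yaxis grow_xaxis IHi.
by rewrite !growSS IHj IHi /= maxC.
Qed.

Lemma hinc0 x i : hinc x i 0 = x (i.+1, 0%N).
Proof. by rewrite /hinc grow_xaxis; ring. Qed.

Lemma vinc0 x j : vinc x 0 j = x (0%N, j.+1).
Proof. by rewrite /vinc grow_yaxis; ring. Qed.

Lemma hincS x i j :
  hinc x i j.+1 = x (i.+1, j.+1) + Num.max 0 (hinc x i j - vinc x i j).
Proof. by rewrite /hinc growSS /vinc /Num.max; do ! case: ifP; lra. Qed.

Lemma vincS x i j :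
  vinc x i.+1 j = x (i.+1, j.+1) + Num.max 0 (vinc x i j - hinc x i j).
Proof. by rewrite /vinc growSS /hinc /Num.max; do ! case: ifP; lra. Qed.

(** In [hincS] and [vincS] an outgoing increment increases with the incoming one of its own kind and
    decreases with the other, so an ordering of the boundary propagates. *)
Lemma inc_monotone x y :
  (forall i, y (i.+1, 0%N) <= x (i.+1, 0%N)) ->
  (forall j, x (0%N, j.+1) <= y (0%N, j.+1)) ->
  (forall i j, x (i.+1, j.+1) = y (i.+1, j.+1)) ->
  forall i j, hinc y i j <= hinc x i j /\ vinc x i j <= vinc y i j.
Proof.
move=> h v w i j; elim: {i j}(i + j)%N {-2}i {-2}j (leqnn (i + j)) => [|n IH] i j.
  rewrite leqn0 addn_eq0 => /andP[/eqP -> /eqP ->].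
  by rewrite !hinc0 !vinc0; split.
move=> ijn; split.
  case: j ijn => [|j] ijn; first by rewrite !hinc0.
  have [h1 v1] := IH i j ltac:(lia).
  by rewrite !hincS w lerD2l /Num.max; do ! case: ifP; lra.
case: i ijn => [|i] ijn; first by rewrite !vinc0.
have [h1 v1] := IH i j ltac:(lia).
by rewrite !vincS w lerD2l /Num.max; do ! case: ifP; lra.
Qed.

Lemma grow_le x y :
  (forall i j, (i, j) != (0%N, 0%N) -> x (i, j) <= y (i, j)) ->
  forall i j, grow x i j <= grow y i j.
Proof.
move=> xy; apply: grow_ind => //.
- by move=> i IH; rewrite !grow_xaxis lerD// xy.
- by move=> j IH; rewrite !grow_yaxis lerD// xy.
- by move=> i j IH1 IH2; rewrite !growSS lerD ?xy// ge_max !le_max IH1 IH2 orbT.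
Qed.

Definition keep_axes (bx by_ : bool) x (z : nat * nat) : R :=
  if z.1 is 0%N then (if by_ then x z else 0)
  else if z.2 is 0%N then (if bx then x z else 0) else x z.

(** A path collects weights on one axis only, so those on the other axis may be erased. *)
Lemma grow_keep_axes x i j : (forall i, 0 <= x (i.+1, 0%N)) ->
  (forall j, 0 <= x (0%N, j.+1)) ->
  grow x i j = Num.max (grow (keep_axes true false x) i j)
                       (grow (keep_axes false true x) i j).
Proof.
move=> hx hy.
have h0 i' : 0 <= grow x i' 0 /\ grow (keep_axes false true x) i' 0 = 0 /\
    grow (keep_axes true false x) i' 0 = grow x i' 0.
  elim: i' => [//|i' [IH1 [IH2 IH3]]]; rewrite !grow_xaxis IH2 IH3 /= addr0.
  by split => //; rewrite addr_ge0.
have v0 j' : 0 <= grow x 0 j' /\ grow (keep_axes true false x) 0 j' = 0 /\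
    grow (keep_axes false true x) 0 j' = grow x 0 j'.
  elim: j' => [//|j' [IH1 [IH2 IH3]]]; rewrite !grow_yaxis IH2 IH3 /= addr0.
  by split => //; rewrite addr_ge0.
move: i j; apply: grow_ind.
- by rewrite maxxx.
- by move=> i _; have [a [b c]] := h0 i.+1; rewrite b c max_l.
- by move=> j _; have [a [b c]] := v0 j.+1; rewrite b c max_r.
move=> i j IH1 IH2; rewrite !growSS IH1 IH2 /= -addr_maxr; congr (_ + _).
by rewrite maxACA.
Qed.

(* Weights on the x-axis favour a vertical last step, which is preferred already
   without axis weights; so the horizontal last step is due to the weights on the
   y-axis, and these are larger in [y]. *)
Lemma grow_sandwich x y i j :
  (forall i, 0 <= x (i.+1, 0%N)) -> (forall j, 0 <= x (0%N, j.+1)) ->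
  (forall i, 0 <= y (i.+1, 0%N)) -> (forall j, x (0%N, j.+1) <= y (0%N, j.+1)) ->
  (forall i j, x (i.+1, j.+1) = y (i.+1, j.+1)) ->
  grow x i.+1 j < grow x i j.+1 ->
  grow (keep_axes false false x) i j.+1 < grow (keep_axes false false x) i.+1 j ->
  grow x i.+1 j.+1 <= grow y i.+1 j.+1.
Proof.
move=> x0 y0 hy vy w lt1 lt2.
have [h1 v1] : hinc (keep_axes false false x) i j <= hinc (keep_axes true false x) i j /\
    vinc (keep_axes true false x) i j <= vinc (keep_axes false false x) i j.
  by apply: inc_monotone.
have lt3 : grow (keep_axes true false x) i j.+1 < grow (keep_axes true false x) i.+1 j.
  by move: h1 v1 lt2; rewrite /hinc /vinc; lra.
have E := grow_keep_axes i j.+1 x0 y0.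
have E' := grow_keep_axes i.+1 j x0 y0.
have -> : grow x i.+1 j.+1 = x (i.+1, j.+1) + grow (keep_axes false true x) i j.+1.
  rewrite growSS max_l ?ltW//; congr (_ + _).
  move: lt1; rewrite E E' gt_max => /andP[l1 l2].
  apply: max_r; rewrite leNgt; apply/negP => l3.
  by move: l1; rewrite max_l ?(ltW l3)// => /lt_trans/(_ lt3); rewrite ltxx.
rewrite growSS w lerD2l le_max; apply/orP; left.
apply: grow_le => -[|k] [|l] //= _.
  exact: vy.
by rewrite /keep_axes/= w.
Qed.

End CornerGrowth.

Section Windows.
Context {R : realType}.
Implicit Types (x y : nat * nat -> R) (i j p q r : nat).

(** Growth beyond [(p, q)] depends on the past only through the increments along the two half-lines
    leaving [(p, q)]; these serve as axis weights. *)
Definition window p q x (z : nat * nat) : R :=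
  match z with
  | (0, 0) => x (0, 0)
  | (i.+1, 0) => hinc x (p + i) q
  | (0, j.+1) => vinc x p (q + j)
  | (i.+1, j.+1) => x (p + i.+1, q + j.+1)
  end%N.

Lemma grow_window p q x i j :
  grow (window p q x) i j = grow x (p + i) (q + j) - grow x p q.
Proof.
move: i j; apply: grow_ind.
- by rewrite !addn0 subrr.
- by move=> i IH; rewrite grow_xaxis IH /= /hinc addn0 addnS; ring.
- by move=> j IH; rewrite grow_yaxis IH /= /vinc addn0 addnS; ring.
- move=> i j IH1 IH2; rewrite growSS IH1 IH2 /= !addnS growSS.
  by rewrite /Num.max; do ! case: ifP; lra.
Qed.

Lemma window_window p q p' q' x :
  window p' q' (window p q x) =1 window (p + p') (q + q') x.
Proof.
move=> [[|i] [|j]] //=; rewrite ?addn0 ?addnS ?addnA//.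
- by rewrite /vinc !grow_window !addnS addnA; ring.
- by rewrite /hinc !grow_window !addnS addnA; ring.
Qed.

Definition dual_weight x i j : R := Num.min (hinc x i j) (vinc x i j).

(* State after [p] columns have been updated up to height [q], and the next one
   up to height [r]. *)
Definition partial_state p q r x (z : nat * nat) : R :=
  match z with
  | (0, 0) => x (0, 0)
  | (i.+1, 0) => if i < p then hinc x i q else if i == p then hinc x p r else x (i.+1, 0)
  | (0, j.+1) => if j < r then vinc x p.+1 j else if j < q then vinc x p j else x (0, j.+1)
  | (i.+1, j.+1) => if (i < p) && (j < q) || (i == p) && (j < r)
                    then dual_weight x i j else x (i.+1, j.+1)
  end%N.

(** The axis slots store the increments along the current frontier, so updating one cell reads and
    writes only three slots. *)
Lemma partial_state_move p q r x : (r < q)%N ->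
  partial_state p q r.+1 x =
  corner_move (p.+1, 0%N) (0%N, r.+1) (p.+1, r.+1) (partial_state p q r x).
Proof.
move=> rq; apply/funext => -[[|i] [|j]]; rewrite /corner_move !xpair_eqE //=.
- rewrite eqSS !ltnn eqxx rq /= ltnS; case: (ltngtP j r) => // ->.
  by rewrite vincS.
- rewrite !eqSS !ltnn !eqxx rq /=; case: (eqVneq i p) => [->|//] /=.
  by rewrite ltnn hincS.
- rewrite !eqSS !ltnn !eqxx rq /= ltnS; case: (eqVneq i p) => [->|ip] /=.
    by rewrite !ltnn /=; case: (ltngtP j r) => // ->.
  by [].
Qed.

Lemma partial_state0 q x : partial_state 0 q 0 x = x.
Proof.
by apply/funext => -[[|i] [|j]] //=; rewrite ?vinc0 ?hinc0; [case: ifP|case: eqP => [->|]|case: eqP].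
Qed.

Lemma partial_stateS p q x : partial_state p q q x = partial_state p.+1 q 0 x.
Proof.
apply/funext => -[[|i] [|j]] //=.
- by case: ltnP.
- by rewrite ltnS; case: ltngtP => [//|pi|->//]; case: eqP => [->|//]; rewrite hinc0.
- by rewrite ltn0 andbF orbF -andb_orl ltnS [in RHS]leq_eqVlt orbC.
Qed.

(* The dual weights and the outgoing increments of the square of side [K],
   seen from its opposite corner *)
Definition reflected K x (z : nat * nat) : R :=
  match z with
  | (0, 0) => x (0, 0)
  | (i.+1, 0) => hinc x (K - i.+1) K
  | (0, j.+1) => vinc x K (K - j.+1)
  | (i.+1, j.+1) => dual_weight x (K - i.+1) (K - j.+1)
  end%N.

(** [dual_weight] is the increment to the smaller of the two successors, so that the time left until
    [(K, K)] obeys the growth recursion backwards. *)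
Lemma grow_reflected K x i j : (i <= K)%N -> (j <= K)%N ->
  grow (reflected K x) i j = grow x K K - grow x (K - i) (K - j).
Proof.
move: i j; apply: grow_ind.
- by rewrite !subn0 subrr.
- move=> i IH iK _; rewrite grow_xaxis (IH (ltnW iK) isT) /reflected /hinc !subn0 (subnSK iK).
  by rewrite addrA subrK.
- move=> j IH _ jK; rewrite grow_yaxis (IH isT (ltnW jK)) /reflected /vinc !subn0 (subnSK jK).
  by rewrite addrA subrK.
- move=> i j IH1 IH2 iK jK; rewrite growSS (IH1 (ltnW iK) jK) (IH2 iK (ltnW jK)) /reflected.
  rewrite /dual_weight /hinc /vinc (subnSK iK) (subnSK jK).
  move: (grow x K K) (grow x (K - i.+1) (K - j)) (grow x (K - i) (K - j.+1))
    (grow x (K - i.+1) (K - j.+1)) => a b c e.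
  by rewrite /Num.max /Num.min; do ! case: ifP; lra.
Qed.

End Windows.

Section MeasurableSets.
Context {R : realType} d (T : measurableType d).
Implicit Types (f g : T -> R).

Lemma measurable_set_ler f g : measurable_fun setT f -> measurable_fun setT g ->
  measurable [set x | f x <= g x].
Proof.
move=> mf mg; rewrite -[X in measurable X]setTI.
by apply: (@measurable_fun_ler _ T R setT f g mf mg measurableT [set true]).
Qed.

Lemma measurable_set_ltr f g : measurable_fun setT f -> measurable_fun setT g ->
  measurable [set x | f x < g x].
Proof.
move=> mf mg; rewrite -[X in measurable X]setTI.
by apply: (@measurable_fun_ltr _ T R setT f g mf mg measurableT [set true]).
Qed.

Lemma measurable_set_eqr f g : measurable_fun setT f -> measurable_fun setT g ->
  measurable [set x | f x = g x].
Proof.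
move=> mf mg.
rewrite (_ : [set x | f x = g x] = [set x | f x <= g x] `&` [set x | g x <= f x]).
  by apply: measurableI; apply: measurable_set_ler.
by apply/seteqP; split => x /=; [move=> ->|case=> h1 h2; apply/le_anti; rewrite h1 h2].
Qed.

Lemma measure_le_setU (P : {measure set T -> \bar R}) E A B x y :
  measurable E -> measurable A -> measurable B -> E `<=` A `|` B ->
  (P A <= x)%E -> (P B <= y)%E -> (P E <= x + y)%E.
Proof.
move=> mE mA mB EAB Ax By; apply: le_trans (leeD Ax By).
apply: le_trans (measureU2 P mA mB); apply: le_measure; rewrite ?inE//.
exact: measurableU.
Qed.

End MeasurableSets.

Section StationaryLaw.
Context {R : realType}.
Definition stat_law (m0 : set R -> \bar R) (a : R) (z : nat * nat) : set R -> \bar R :=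
  match z with
  | (0, 0) => m0
  | (_.+1, 0) => exponential_prob a
  | (0, _.+1) => exponential_prob (1 - a)
  | (_.+1, _.+1) => exponential_prob 1
  end%N.

Context d (T : measurableType d) (P : probability T R).
Variables (X : T -> nat * nat -> R) (m0 : set R -> \bar R) (a : R).
Hypotheses (a0 : 0 < a) (a1 : a < 1).
Hypothesis indepX : indep_family P X (stat_law m0 a).

Let mX k : measurable_fun setT (fun om => X om k) := indepX.1 k.

Let b0 : 0 < 1 - a. Proof. by rewrite subr_gt0. Qed.

Let ab1 : a + (1 - a) = 1. Proof. by rewrite addrC subrK. Qed.

Lemma stat_partial_state p q r : (r <= q)%N ->
  indep_family P (fun om => partial_state p q r (X om)) (stat_law m0 a).
Proof.
elim: p r => [|p IHp]; elim => [|r IHr] rq.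
- rewrite (_ : (fun om => _) = X)//; apply/funext => om; exact: partial_state0.
- rewrite (_ : (fun om => _) = (fun om => corner_move (1%N, 0%N) (0%N, r.+1) (1%N, r.+1)
      (partial_state 0 q r (X om)))); last first.
    by apply/funext => om; exact: partial_state_move.
  apply: (@indep_family_corner_move R (nat * nat)%type _ T P _ _ (IHr (ltnW rq)) _ _ _ a (1 - a)) => //;
    by rewrite xpair_eqE andbF.
- rewrite (_ : (fun om => _) = (fun om => partial_state p q q (X om))); first exact: IHp.
  by apply/funext => om; rewrite partial_stateS.
- rewrite (_ : (fun om => _) = (fun om => corner_move (p.+2, 0%N) (0%N, r.+1) (p.+2, r.+1)
      (partial_state p.+1 q r (X om)))); last first.
    by apply/funext => om; exact: partial_state_move.
  apply: (@indep_family_corner_move R (nat * nat)%type _ T P _ _ (IHr (ltnW rq)) _ _ _ a (1 - a)) => //;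
    by rewrite xpair_eqE andbF.
Qed.

Lemma measurable_grow i j : measurable_fun [set: env R (nat * nat)%type]
  (fun x : env R (nat * nat)%type => grow x i j).
Proof.
move: i j; apply: grow_ind.
- exact: measurable_cst.
- move=> i IH; apply: (@measurable_funD _ (env R _) R) => //; exact: env_coord.
- move=> j IH; apply: (@measurable_funD _ (env R _) R) => //; exact: env_coord.
- move=> i j IH1 IH2; apply: (@measurable_funD _ (env R _) R); first exact: env_coord.
  exact: (@measurable_maxr _ (env R _) R).
Qed.

Lemma measurable_window p q z : measurable_fun [set: env R (nat * nat)%type]
  (fun x : env R (nat * nat)%type => window p q x z).
Proof.
case: z => [[|i] [|j]] /=; try exact: env_coord.
  by apply: (@measurable_funB _ (env R _) R); exact: measurable_grow.
by apply: (@measurable_funB _ (env R _) R); exact: measurable_grow.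
Qed.

(* A window along one axis looks, on each finite set of sites, like a
   relabelled partial state. *)
Lemma stat_window_axis (p q : nat) : (p == 0) || (q == 0) ->
  indep_family P (fun om => window p q (X om)) (stat_law m0 a).
Proof.
move=> pq; split.
  move=> z; apply: (measurableT_comp (f := fun x : env R _ => window p q x z)).
    exact: measurable_window.
  exact: indep_family_env indepX.
move=> s A us mA.
pose M := (\max_(z <- s) (z.1 + z.2)).+1.
have zM z : z \in s -> (z.1 < M)%N /\ (z.2 < M)%N.
  move=> zs; have : (z.1 + z.2 <= \max_(z <- s) (z.1 + z.2))%N.
    by rewrite (bigD1_seq z)//= leq_maxl.
  rewrite /M; lia.
pose shift (z : nat * nat) := (if z.1 is i.+1 then (p + i).+1 else 0%N,
                               if z.2 is j.+1 then (q + j).+1 else 0%N).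
have shiftI : injective shift.
  have aux k i i' : (if i is l.+1 then (k + l).+1 else 0%N) =
      (if i' is l.+1 then (k + l).+1 else 0%N) -> i = i'.
    by case: i => [|i]; case: i' => [|i'] //=; lia.
  by move=> [i j] [i' j'] [/aux -> /aux ->].
(* One side of the updated block is the offset of the window; the other is [M], beyond all sites of
   [s], in place of an infinite axis. *)
pose P' := if p == 0%N then M else p; pose Q' := if p == 0%N then q else M.
have iS := stat_partial_state P' (leq0n Q').
have [_ H] := indep_family_relabel iS shiftI.
transitivity (\prod_(k <- s) stat_law m0 a (shift k) (A k))%E; last first.
  by apply: eq_bigr => -[[|i] [|j]].
rewrite -(H s A us mA); congr (P _); apply/seteqP.
suff E om z : z \in s -> window p q (X om) z = partial_state P' Q' 0 (X om) (shift z).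
  by split => om /= h k ks; move: (h k ks); rewrite E.
move=> /zM; rewrite /P' /Q' /shift; move: pq; case: (eqVneq p 0%N) => [->|p0] /=.
  move=> _; case: z => [[|i] [|j]] //= [iM _].
  - by rewrite vinc0 ltnNge leq_addr.
  - by rewrite (ltnW iM) add0n.
  - by rewrite !addnS [(q + j < q)%N]ltnNge leq_addr !andbF.
move=> /eqP ->; case: z => [[|i] [|j]] //= [_ jM].
- by rewrite add0n (ltnW jM).
- rewrite ltnNge leq_addr /= !hinc0.
  by case: eqP => [->|].
- by rewrite !addnS [(p + i < p)%N]ltnNge leq_addr /= ltn0 andbF.
Qed.

End StationaryLaw.

Section StationaryGrowth.
Context {R : realType}.
Context d (T : measurableType d) (P : probability T R).
Variables (X : T -> nat * nat -> R) (m0 : set R -> \bar R) (a : R).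
Hypotheses (a0 : 0 < a) (a1 : a < 1).
Hypothesis indepX : indep_family P X (stat_law m0 a).

Let b0 : 0 < 1 - a. Proof. by rewrite subr_gt0. Qed.

Lemma stat_window p q : indep_family P (fun om => window p q (X om)) (stat_law m0 a).
Proof.
have i1 := stat_window_axis a0 a1 indepX (p := p) (q := 0) (orbT _).
have i2 := stat_window_axis a0 a1 i1 (p := 0) (q := q) isT.
rewrite (_ : (fun om => _) = fun om => window 0 q (window p 0 (X om)))//.
apply/funext => om; apply/funext => z.
by rewrite window_window addn0 add0n.
Qed.

(** Fixing the indices outside [1, ..., K] makes the reversal a bijection, so that relabelling keeps
    the whole family independent. *)
Definition flip (K i : nat) : nat := if (0 < i <= K)%N then (K - i).+1 else i.

Lemma flipK K : involutive (flip K).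
Proof. by move=> i; rewrite /flip; do ! case: ifP; lia. Qed.

(** [reflected] is meaningful only in the square. The fully updated [partial_state], with flipped
    indices, grows like it there and keeps the original weights outside, hence is stationary
    everywhere. *)
Lemma stat_reflected K :
  exists Y : T -> nat * nat -> R, indep_family P Y (stat_law m0 a) /\
    forall om i j, (i <= K)%N -> (j <= K)%N ->
      grow (Y om) i j = grow (X om) K K - grow (X om) (K - i) (K - j).
Proof.
pose phi (z : nat * nat) := (flip K z.1, flip K z.2).
have phiI : injective phi.
  by move=> [i j] [i' j'] [/(inv_inj (flipK K)) -> /(inv_inj (flipK K)) ->].
exists (fun om z => partial_state K K 0 (X om) (phi z)); split.
  apply: (indep_family_ext (mu := fun z => stat_law m0 a (phi z))).
    exact: (indep_family_relabel (stat_partial_state a0 a1 indepX K (leq0n K)) phiI).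
  move=> [i j] A mA; rewrite /phi /flip /=.
  by case: i => [|i]; case: j => [|j] //=; do ? case: ifP => //=; lia.
move=> om i j iK jK; rewrite -grow_reflected//.
apply: (@grow_ext _ _ _ K K) => // {i j iK jK} i j iK jK ij0.
rewrite /phi /flip /=; case: i iK ij0 => [|i] iK; case: j jK => [|j] jK //= _.
- rewrite jK /= (_ : K - j.+1 < K)%N//; lia.
- rewrite iK /= (_ : K - i.+1 < K)%N//; lia.
- have hi : (K - i.+1 < K)%N by lia.
  have hj : (K - j.+1 < K)%N by lia.
  by rewrite iK jK /= hi hj.
Qed.

(** By Burke's property each of the two sums consists of independent exponential variables, so the
    passage time concentrates without any estimate over paths. *)
Lemma grow_boundary (x : nat * nat -> R) i j :
  grow x i j = \sum_(k < i) x (k.+1, 0%N) + \sum_(l < j) window i 0 x (0%N, l.+1).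
Proof.
elim: j => [|j IH]; last first.
  by rewrite big_ord_recr addrA -IH /= add0n /vinc addrC subrK.
rewrite big_ord0 addr0; elim: i => [|i IH]; first by rewrite big_ord0.
by rewrite big_ord_recr /= -IH.
Qed.

Lemma stat_hinc_lt_vinc i j : P [set om | hinc (X om) i j < vinc (X om) i j] = a%:E.
Proof.
have iW := stat_window i j.
have := @exponential_pair_ltE _ _ _ _ _ _ _ iW (0%N, 1%N) (1%N, 0%N) (1 - a) a isT b0 a0.
rewrite subrK => /(_ erefl erefl erefl) <-; congr (P _).
by apply/seteqP; split => om /=; rewrite !addn0.
Qed.

Lemma stat_hinc_tie i j : P [set om | hinc (X om) i j = vinc (X om) i j] = 0%E.
Proof.
have iW := stat_window i j.
have := @indep_family_tie _ _ _ _ _ _ _ iW (1%N, 0%N) (fun x => x (0%N, 1%N)).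
move=> H; rewrite -[RHS]H.
- by congr (P _); apply/seteqP; split => om /=; rewrite !addn0.
- by move=> t; exact: exponential_prob_set1.
- exact: env_coord.
- by move=> x y; apply.
Qed.

(** The two sums of [grow_boundary] may depend on each other, but a deviation of the total forces a
    deviation of one of them. *)
Lemma stat_grow_bounds i j (e : R) : 0 < e -> e < 1 ->
  (P [set om | (grow (X om) i j <= (1 - e) * (i%:R / a + j%:R / (1 - a)))%R] <=
     (chernoff_rate e ^+ i + chernoff_rate e ^+ j)%:E)%E /\
  (P [set om | ((1 + e) * (i%:R / a + j%:R / (1 - a)) <= grow (X om) i j)%R] <=
     (chernoff_rate e ^+ i + chernoff_rate e ^+ j)%:E)%E.
Proof.
move=> e0 e1.
have fI : injective (fun k : nat => (k.+1, 0%N)) by move=> k l [].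
have gI : injective (fun k : nat => (0%N, k.+1)) by move=> k l [].
have [L1 U1] := exponential_sum_sequence i indepX fI a0 e0 e1 (fun=> erefl).
have [L2 U2] := exponential_sum_sequence j (stat_window i 0) gI b0 e0 e1 (fun=> erefl).
have mS (Y : T -> nat * nat -> R) (f : nat -> nat * nat) l :
    indep_family P Y (stat_law m0 a) -> measurable_fun setT (fun om => \sum_(k < l) Y om (f k)).
  by move=> iY; apply: measurable_sum => k; exact: iY.1.
have mle (Y : T -> nat * nat -> R) (f : nat -> nat * nat) l (c : R) : indep_family P Y (stat_law m0 a) ->
    measurable [set om | \sum_(k < l) Y om (f k) <= c].
  by move=> iY; apply: (measurable_set_ler (mS _ f l iY)).
have mge (Y : T -> nat * nat -> R) (f : nat -> nat * nat) l (c : R) : indep_family P Y (stat_law m0 a) ->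
    measurable [set om | c <= \sum_(k < l) Y om (f k)].
  by move=> iY; apply: (measurable_set_ler _ (mS _ f l iY)).
have mG : measurable_fun setT (fun om => grow (X om) i j).
  apply: (measurableT_comp (f := fun x : env R _ => grow x i j)).
    exact: measurable_grow.
  exact: indep_family_env indepX.
split; rewrite EFinD.
  apply: (measure_le_setU _ _ _ _ L1 L2).
  - exact: (measurable_set_ler mG).
  - exact: (mle _ (fun k => (k.+1, 0%N)) _ _ indepX).
  - exact: (mle _ (fun k => (0%N, k.+1)) _ _ (stat_window i 0)).
  move=> om /=; rewrite grow_boundary mulrDr !mulrA => h.
  case: (leP (\sum_(k < i) X om (k.+1, 0%N)) ((1 - e) * i%:R / a)) => h1; first by left.
  by right; move: h h1; lra.
apply: (measure_le_setU _ _ _ _ U1 U2).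
- exact: (measurable_set_ler _ mG).
- exact: (mge _ (fun k => (k.+1, 0%N)) _ _ indepX).
- exact: (mge _ (fun k => (0%N, k.+1)) _ _ (stat_window i 0)).
move=> om /=; rewrite grow_boundary mulrDr !mulrA => h.
case: (leP ((1 + e) * i%:R / a) (\sum_(k < i) X om (k.+1, 0%N))) => h1; first by left.
by right; move: h h1; lra.
Qed.

End StationaryGrowth.

(** * Arrows of the i.i.d. environment *)

Section CornerEnvironment.
Context {R : realType}.
Implicit Types (w : int * int -> R) (c : int * int) (a b : R) (i j p q : nat).

(* Stationary environment rooted at [c] and growing towards the south-west; the
   boundary weights are the rescaled weights of the row and of the column of
   [c]. *)
Definition corner_env w c a (z : nat * nat) : R :=
  match z with
  | (0, 0)%N => 0
  | (i.+1, 0)%N => a^-1 * w (c.1 - i.+1%:Z, c.2)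
  | (0, j.+1)%N => (1 - a)^-1 * w (c.1, c.2 - j.+1%:Z)
  | (i.+1, j.+1)%N => w (c.1 - i.+1%:Z, c.2 - j.+1%:Z)
  end.

Definition plain_env w c (z : nat * nat) : R :=
  match z with
  | (i.+1, j.+1)%N => w (c.1 - i.+1%:Z, c.2 - j.+1%:Z)
  | _ => 0
  end.

(* [plain w (v + (1, 1)) i j] is the last passage time between [v + (1, 1) -
   (i, j)] and [v], both ends included. *)
Definition plain w c i j : R := grow (plain_env w c) i j.

Lemma plain_window w c a p q i j :
  grow (keep_axes false false (window p q (corner_env w c a))) i j =
  plain w (c.1 - p%:Z, c.2 - q%:Z) i j.
Proof.
congr (grow _ i j); apply/funext => -[[|k] [|l]] //=.
by rewrite /keep_axes /= !addnS /=; congr (w (_, _)); lia.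
Qed.

Lemma hinc_ge0 (x : nat * nat -> R) i j : (forall z, 0 <= x z) -> 0 <= hinc x i j.
Proof.
by move=> x0; case: j => [|j]; rewrite ?hinc0// hincS addr_ge0// le_max lexx.
Qed.

Lemma vinc_ge0 (x : nat * nat -> R) i j : (forall z, 0 <= x z) -> 0 <= vinc x i j.
Proof.
by move=> x0; case: i => [|i]; rewrite ?vinc0// vincS addr_ge0// le_max lexx.
Qed.

Section nonneg.
Variables (w : int * int -> R) (c : int * int) (a b : R) (p q : nat).
Hypotheses (w0 : forall z, 0 <= w z) (a0 : 0 < a) (ab : a <= b) (b1 : b < 1).

Let b0 : 0 < b. Proof. exact: lt_le_trans ab. Qed.
Let a1 : a < 1. Proof. exact: le_lt_trans ab b1. Qed.

Lemma corner_env_ge0 e z : 0 < e -> e < 1 -> 0 <= corner_env w c e z.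
Proof.
by move=> e0 e1; case: z => [[|i] [|j]] //=; rewrite mulr_ge0// invr_ge0 ?subr_ge0 ltW.
Qed.

Lemma corner_env_inc i j :
  hinc (corner_env w c b) i j <= hinc (corner_env w c a) i j /\
  vinc (corner_env w c a) i j <= vinc (corner_env w c b) i j.
Proof.
apply: inc_monotone => //= k; rewrite ler_wpM2r//.
  by rewrite lef_pV2 ?posrE.
by rewrite lef_pV2 ?posrE ?subr_gt0// lerD2l lerN2.
Qed.

Let x := window p q (corner_env w c a).
Let y := window p q (corner_env w c b).

Let x0 z : 0 <= x z.
Proof.
rewrite /x; case: z => [[|i] [|j]] //=.
- by apply: vinc_ge0 => z; exact: corner_env_ge0.
- by apply: hinc_ge0 => z; exact: corner_env_ge0.
- by have := corner_env_ge0 (p + i.+1, q + j.+1)%N a0 a1; rewrite !addnS.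
Qed.

Let y0 z : 0 <= y z.
Proof.
rewrite /y; case: z => [[|i] [|j]] //=.
- by apply: vinc_ge0 => z; exact: corner_env_ge0.
- by apply: hinc_ge0 => z; exact: corner_env_ge0.
- by have := corner_env_ge0 (p + i.+1, q + j.+1)%N b0 b1; rewrite !addnS.
Qed.

(** Used with [b = 2^-1], whose passage time is typically the smaller one near the diagonal: the
    conclusion is then a rare event, and so is a plain arrow that disagrees with a horizontal arrow
    of parameter [a]. *)
Lemma plain_sandwich_low i j :
  grow x i.+1 j < grow x i j.+1 ->
  plain w (c.1 - p%:Z, c.2 - q%:Z) i j.+1 < plain w (c.1 - p%:Z, c.2 - q%:Z) i.+1 j ->
  grow x i.+1 j.+1 <= grow y i.+1 j.+1.
Proof.
move=> h1 h2; apply: grow_sandwich => //.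
- by move=> k; rewrite /x /y /=; have [] := corner_env_inc p (q + k).
- by move=> k l; rewrite /x /y /= !addnS.
- by rewrite !plain_window.
Qed.

(** Reflection in the diagonal exchanges the axes and thereby reverses the order of the
    parameters. *)
Lemma plain_sandwich_high i j :
  grow y i j.+1 < grow y i.+1 j ->
  plain w (c.1 - p%:Z, c.2 - q%:Z) i.+1 j < plain w (c.1 - p%:Z, c.2 - q%:Z) i j.+1 ->
  grow y i.+1 j.+1 <= grow x i.+1 j.+1.
Proof.
move=> h1 h2; pose sw (u : nat * nat -> R) z := u (z.2, z.1).
rewrite -(grow_swap y) -(grow_swap x).
apply: (@grow_sandwich _ (sw y) (sw x)) => //.
- by move=> k; exact: y0.
- by move=> k; exact: y0.
- by move=> k; exact: x0.
- by move=> k; rewrite /sw /x /y /=; have [] := corner_env_inc (p + k) q.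
- by move=> k l; rewrite /sw /x /y /= !addnS.
- by rewrite !grow_swap.
have E k l : grow (keep_axes false false (sw y)) k l =
    plain w (c.1 - p%:Z, c.2 - q%:Z) l k.
  rewrite -(plain_window _ _ b) -/y; transitivity (grow (sw (keep_axes false false y)) k l).
    by congr grow; apply/funext => -[[|k'] [|l']].
  exact: grow_swap.
by rewrite !E.
Qed.

Lemma corner_env_arrow i j :
  hinc (corner_env w c a) i j < vinc (corner_env w c a) i j ->
  hinc (corner_env w c b) i j < vinc (corner_env w c b) i j.
Proof. by have [h v] := corner_env_inc i j; lra. Qed.

End nonneg.

End CornerEnvironment.

(** * Cones around the diagonal and the gap between stationary speeds *)

Section Cone.
Context {R : realType}.
Implicit Types (i j k : nat).

(** The sum of the two truncated differences is [|i - j|]; a larger [k] means a narrower cone, and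
    [N] cuts off its tip. *)
Definition cone k N i j : bool :=
  (N <= i + j)%N && (((i - j) + (j - i)) * k <= i + j)%N.

Lemma coneS k N i j : cone k N i j -> cone k N i.+1 j.+1.
Proof. by move=> /andP[h1 h2]; apply/andP; split; rewrite ?subSS; lia. Qed.

Lemma cone_gt0 k N i j : (1 < k)%N -> (0 < N)%N -> cone k N i j -> (0 < i)%N /\ (0 < j)%N.
Proof. by rewrite /cone => k1 N0 /andP[]; nia. Qed.

(** With [k >= 2] the difference is at most half of [i + j], so each coordinate is at least a
    quarter of the sum; hence the factor 4. *)
Lemma cone_bounds k M i j : (1 < k)%N -> cone k (4 * M) i j ->
  [/\ (M <= i)%N, (M <= j)%N, (i <= 3 * j)%N & (j <= 3 * i)%N].
Proof. by rewrite /cone => k1 /andP[h1 h2]; split; nia. Qed.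

(** By Bernoulli's inequality its sixth power is at least [q]. In the cone [M + i + j] is at most
    [5 * i] and at most [5 * j], so [q ^+ i] and [q ^+ j] are dominated by the power [M + i + j] of
    this rate, which sums to a double geometric series. *)
Definition slow_rate (q : R) : R := 1 - (1 - q) / 6.

Lemma slow_rate_bounds q : 0 < q < 1 -> 0 < slow_rate q < 1 /\ q <= slow_rate q ^+ 6.
Proof.
move=> /andP[q0 q1]; rewrite /slow_rate; split; first by apply/andP; split; lra.
set h := (1 - q) / 6; have h0 : 0 <= h by rewrite /h; lra.
have h1 : h <= 1 by rewrite /h; lra.
have B n : 1 - n%:R * h <= (1 - h) ^+ n.
  elim: n => [|n IH]; first by rewrite mul0r subr0.
  rewrite exprS; have h3 : 0 <= 1 - h by lra.
  apply: le_trans (ler_wpM2l h3 IH); rewrite -natr1.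
  have : 0 <= n%:R * h * h :> R by rewrite mulr_ge0// mulr_ge0.
  rewrite -[1 - h]/(1 - h); lra.
by apply: le_trans (B 6%N); rewrite /h; lra.
Qed.

Lemma cone_sum_bound (q : R) k M N : 0 < q < 1 -> (1 < k)%N ->
  \sum_(i < N) \sum_(j < N | cone k (4 * M) i j) (q ^+ i + q ^+ j) <=
  2 * slow_rate q ^+ M / (1 - slow_rate q) ^+ 2.
Proof.
move=> q01 k1; have [/andP[r0 r1] qr] := slow_rate_bounds q01.
move: (slow_rate q) r0 r1 qr => r r0 r1 qr.
have /andP[q0 _] := q01.
have qi (l n : nat) : (n <= 6 * l)%N -> q ^+ l <= r ^+ n.
  move=> nl; apply: (@le_trans _ _ (r ^+ (6 * l))).
    by rewrite exprM lerXn2r// ?nnegrE ?exprn_ge0 ?ltW.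
  by apply: ler_wiXn2l => //; exact: ltW.
have term i j : cone k (4 * M) i j -> q ^+ i + q ^+ j <= 2 * r ^+ M * (r ^+ i * r ^+ j).
  move=> /(cone_bounds k1)[Mi Mj ij ji].
  rewrite -mulrA -!exprD (_ : 2 = 1 + 1)// mulrDl mul1r lerD//.
    by apply: qi; lia.
  by apply: qi; lia.
have geo : \sum_(i < N) r ^+ i <= (1 - r)^-1.
  have h : 0 < 1 - r by lra.
  have E : (1 - r) * (\sum_(i < N) r ^+ i) = 1 - r ^+ N.
    by rewrite -(opprB r 1) mulNr -subrX1 opprB.
  by rewrite -(ler_pM2l h) E mulfV ?gt_eqF// gerBl exprn_ge0// ltW.
apply: (@le_trans _ _ (\sum_(i < N) \sum_(j < N) 2 * r ^+ M * (r ^+ i * r ^+ j))).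
  apply: ler_sum => i _; rewrite big_mkcond; apply: ler_sum => j _.
  case: ifP => [/term//|_]; rewrite !mulr_ge0 ?exprn_ge0 ?ltW//.
have -> : \sum_(i < N) \sum_(j < N) 2 * r ^+ M * (r ^+ i * r ^+ j) =
    2 * r ^+ M * (\sum_(i < N) r ^+ i) ^+ 2.
  rewrite expr2 mulr_suml mulr_sumr; apply: eq_bigr => i _.
  by rewrite mulr_sumr mulr_sumr; apply: eq_bigr => j _.
rewrite -exprVn; apply: ler_wpM2l.
  by rewrite mulr_ge0// exprn_ge0// ltW.
apply: lerXn2r => //; rewrite nnegrE.
  by apply: sumr_ge0 => i _; rewrite exprn_ge0// ltW.
by rewrite invr_ge0 subr_ge0 ltW.
Qed.

End Cone.

(* Mean of the stationary passage time of parameter [(1 - t) / 2] against that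
   of parameter [1 / 2], for a nearly diagonal displacement [(I, J)]. *)
Lemma stationary_speed_gap (R : realType) (t I J : R) : 0 <= I -> 0 <= J ->
  `|t| < 1 -> - (t ^+ 2 * (I + J)) <= 4 * (t * (I - J)) ->
  (1 + t ^+ 2 / 8) * (2 * I + 2 * J) <=
  (1 - t ^+ 2 / 8) * (I / ((1 - t) / 2) + J / (1 - (1 - t) / 2)).
Proof.
move=> I0 J0; rewrite ltr_norml => /andP[tm tp] h.
have u0 : 0 < (1 - t) * (1 + t) by rewrite mulr_gt0; lra.
have uE : (1 - t) * (1 + t) = 1 - t ^+ 2 by ring.
have -> : 1 - (1 - t) / 2 = (1 + t) / 2 by field.
have -> : I / ((1 - t) / 2) + J / ((1 + t) / 2) =
    2 * (I + J + t * (I - J)) / ((1 - t) * (1 + t)).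
  have e1 : 1 - t != 0 by rewrite gt_eqF//; lra.
  have e2 : 1 + t != 0 by rewrite gt_eqF//; lra.
  by field; rewrite e1 e2.
rewrite mulrA ler_pdivlMr// uE; rewrite uE in u0.
set u := t ^+ 2 in h u0 *; have un : 0 <= u by exact: sqr_ge0.
have u1 : u < 1 by lra.
set s := I + J in h *; have s0 : 0 <= s by rewrite addr_ge0.
have -> : 2 * I + 2 * J = 2 * s by rewrite mulrDr.
move: (t * (I - J)) h => v h.
(* The asymmetry of the displacement costs at most the fraction [u / 4], while the denominator
   [1 - u] gains [u]; the margin pays for both deviations [u / 8]. *)
have h2 : (1 - u / 8) * (2 * (s - u * s / 4)) <= (1 - u / 8) * (2 * (s + v)).
  by apply: ler_wpM2l; lra.
apply: le_trans h2.
have us : 0 <= u * s by rewrite mulr_ge0.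
have uus : 0 <= u * (u * s) by rewrite mulr_ge0.
have -> : (1 + u / 8) * (2 * s) * (1 - u) = 2 * s - 7 / 4 * (u * s) - (u * (u * s)) / 4.
  by field.
have -> : (1 - u / 8) * (2 * (s - u * s / 4)) = 2 * s - 3 / 4 * (u * s) + (u * (u * s)) / 16.
  by field.
lra.
Qed.

Section NullSets.
Context {R : realType} d (T : measurableType d) (P : {measure set T -> \bar R}).

Lemma measurable_exists (I : countType) (F : I -> set T) :
  (forall i, measurable (F i)) -> measurable [set om | exists i, F i om].
Proof.
move=> mF; pose G n := oapp F set0 (@choice.unpickle I n).
rewrite (_ : [set _ | _] = \bigcup_n G n).
  apply: bigcup_measurable => n _; rewrite /G; case: choice.unpickle => [i|] /=.
    exact: mF.
  exact: measurable0.
apply/seteqP; split => om /=.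
  by move=> [i Fi]; exists (choice.pickle i) => //; rewrite /G choice.pickleK.
by move=> [n _]; rewrite /G; case: choice.unpickle => // i Fi; exists i.
Qed.

Lemma null_exists (I : countType) (F : I -> set T) :
  (forall i, measurable (F i)) -> (forall i, P (F i) = 0%E) ->
  P [set om | exists i, F i om] = 0%E.
Proof.
move=> mF F0; pose G n := oapp F set0 (@choice.unpickle I n).
apply: measure_negligible; first exact: measurable_exists.
rewrite (_ : [set _ | _] = \bigcup_n G n).
  apply: negligible_bigcup => n; rewrite /G; case: choice.unpickle => [i|]; last exact: negligible_set0.
  by exists (F i); split.
apply/seteqP; split => om /=.
  by move=> [i Fi]; exists (choice.pickle i) => //; rewrite /G choice.pickleK.
by move=> [n _]; rewrite /G; case: choice.unpickle => // i Fi; exists i.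
Qed.

End NullSets.

Section IidEnvironment.
Context {R : realType} d (T : measurableType d) (P : probability T R).
Variable X : T -> int * int -> R.
Hypothesis indepX : indep_family P X (fun=> exponential_prob 1).
Implicit Types (c z : int * int) (a t : R) (i j p q k : nat).

Let mX z : measurable_fun setT (fun om => X om z) := indepX.1 z.

Lemma corner_env_stat c a : 0 < a -> a < 1 ->
  indep_family P (fun om => corner_env (X om) c a) (stat_law (\d_(0 : R)) a).
Proof.
move=> a0 a1; have b0 : 0 < 1 - a by rewrite subr_gt0.
pose phi (z : nat * nat) : int * int := (c.1 - z.1%:Z, c.2 - z.2%:Z).
have phiI : injective phi.
  by move=> [i j] [i' j'] [] h1 h2; congr (_, _); lia.
pose f (z : nat * nat) : R -> R := match z with
  | (0, 0)%N => cst 0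
  | (i.+1, 0)%N => fun x => a^-1 * x
  | (0, j.+1)%N => fun x => (1 - a)^-1 * x
  | _ => id end.
have mf (z : nat * nat) : measurable_fun setT (f z).
  case: z => [[|i] [|j]] /=.
  - exact: measurable_cst.
  - exact: measurable_funM.
  - exact: measurable_funM.
  - exact: measurable_id.
have i1 := indep_family_relabel indepX phiI.
rewrite (_ : (fun om => _) = fun om (z : nat * nat) => f z (X om (phi z))); last first.
  apply/funext => om; apply/funext => -[[|i] [|j]] //=; rewrite /phi/= subr0//.
apply: (indep_family_ext (indep_family_map (mu := fun=> exponential_prob 1) i1 mf)).
move=> [[|i] [|j]] A mA /=.
- rewrite diracE preimage_cst; case: ifPn => _.
    by rewrite -(exp_lawE ltr01) probability_setT.
  by rewrite -(exp_lawE ltr01) measure0.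
- exact: exponential_prob_scale.
- exact: exponential_prob_scale.
- by rewrite preimage_id.
Qed.

Lemma negative_weight_null :
  measurable [set om | exists z, X om z < 0] /\ P [set om | exists z, X om z < 0] = 0%E.
Proof.
have m z : measurable [set om | X om z < 0] by exact: measurable_set_ltr.
split; first exact: measurable_exists.
apply: null_exists => // z.
rewrite -[RHS](@exponential_prob_Iio0 R 1 ltr01) -(indep_family_marginal indepX z)//.
Qed.

Lemma measurable_plain c i j : measurable_fun setT (fun om => plain (X om) c i j).
Proof.
apply: (measurableT_comp (f := fun x : env R _ => grow x i j)).
  exact: measurable_grow.
apply: measurable_env => -[[|k] [|l]] /=; try exact: measurable_cst; exact: mX.
Qed.

Lemma measurable_corner_env_grow c a p q i j :
  measurable_fun setT (fun om => grow (window p q (corner_env (X om) c a)) i j).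
Proof.
apply: (measurableT_comp (f := fun x : env R _ => grow x i j)).
  exact: measurable_grow.
apply: measurable_env => z.
apply: (measurableT_comp (f := fun x : env R _ => window p q x z)).
  exact: measurable_window.
apply: measurable_env => -[[|k] [|l]] /=; try exact: measurable_cst; try exact: mX.
  by apply: measurable_funM.
by apply: measurable_funM.
Qed.

Lemma measurable_corner_env_inc c a i j :
  measurable_fun setT (fun om => hinc (corner_env (X om) c a) i j) /\
  measurable_fun setT (fun om => vinc (corner_env (X om) c a) i j).
Proof.
have m k l : measurable_fun setT (fun om => grow (corner_env (X om) c a) k l).
  have := measurable_corner_env_grow c a 0 0 k l; congr measurable_fun.
  by apply/funext => om; rewrite grow_window /= subr0.
by split; apply: (@measurable_funB _ T R).
Qed.

(** The shift of the first index leaves out [plain c 1 0 = plain c 0 1], which always holds. *)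
Definition plain_tie c i j := [set om | plain (X om) c i.+2 j = plain (X om) c i.+1 j.+1].

Lemma plain_tie_null :
  measurable [set om | exists cij, plain_tie cij.1 cij.2.1 cij.2.2 om] /\
  P [set om | exists cij, plain_tie cij.1 cij.2.1 cij.2.2 om] = 0%E.
Proof.
have m (cij : (int * int) * (nat * nat)) : measurable (plain_tie cij.1 cij.2.1 cij.2.2).
  by apply: measurable_set_eqr; exact: measurable_plain.
split; first exact: measurable_exists.
apply: null_exists => // -[c [i j]] /=.
have iE := @corner_env_stat c 2^-1 ltac:(lra) ltac:(lra).
pose K := keep_axes (R := R) false false.
(* A tie means that the weight at [(i.+1, j.+1)] equals [F], which depends on the other weights
   only. *)
pose F (x : nat * nat -> R) := grow (K x) i.+2 j - Num.max (grow (K x) i j.+1) (grow (K x) i.+1 j).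
have mK : measurable_fun [set: env R (nat * nat)%type] (K : env R _ -> env R _).
  apply: measurable_env => -[[|k] [|l]] /=; try exact: measurable_cst; exact: env_coord.
have mgK k l : measurable_fun [set: env R (nat * nat)%type] (fun x => grow (K x) k l).
  by apply: (measurableT_comp (f := fun x : env R _ => grow x k l)) => //; exact: measurable_grow.
rewrite -[RHS](@indep_family_tie _ _ _ _ _ _ _ iE (i.+1, j.+1) F).
- have Eom om : plain_tie c i j om <-> corner_env (X om) c 2^-1 (i.+1, j.+1) =
      F (corner_env (X om) c 2^-1).
    have E k l : grow (K (corner_env (X om) c 2^-1)) k l = plain (X om) c k l.
      by congr (grow _ k l); apply/funext => -[[|?] [|?]].
    rewrite /F !E /plain_tie /=.
    have -> : plain (X om) c i.+1 j.+1 = X om (c.1 - i.+1%:Z, c.2 - j.+1%:Z) +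
      Num.max (plain (X om) c i j.+1) (plain (X om) c i.+1 j) by [].
    by split=> ->; ring.
  by congr (P _); apply/seteqP; split => om; rewrite /= -?Eom//; move/Eom.
- by move=> t /=; exact: exponential_prob_set1.
- apply: (@measurable_funB _ (env R (nat * nat)%type) R); first exact: mgK.
  by apply: (@measurable_maxr _ (env R (nat * nat)%type) R); exact: mgK.
move=> x y xy; rewrite /F.
have E M N : (M < i.+1)%N || (N < j.+1)%N -> grow (K x) M N = grow (K y) M N.
  move=> MN; apply: (@grow_ext _ _ _ M N) => // k l kM lN _.
  rewrite /K /keep_axes; case: k kM => [//|k] kM; case: l lN => [//|l] lN /=.
  by apply: xy; rewrite xpair_eqE; lia.
by rewrite !E ?ltnSn ?orbT.
Qed.

(** Outside the exceptional events both times stay within the relative error [t ^+ 2 / 8] of means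
    that [stationary_speed_gap] separates in the cone. The sign of [t] is free, so both sides of the
    parameter 1/2 are covered. *)
Lemma corner_env_bad c t p q i j k : t != 0 -> `|t| < 1 -> (4 <= k%:R * `|t|) ->
  cone k 1 i j ->
  (P [set om | (grow (window p q (corner_env (X om) c ((1 - t) / 2))) i j <=
               grow (window p q (corner_env (X om) c 2^-1)) i j)%R] <=
   (2 * (chernoff_rate (t ^+ 2 / 8) ^+ i + chernoff_rate (t ^+ 2 / 8) ^+ j))%:E)%E.
Proof.
move=> t0 t1 kt /andP[ij1 cij].
set a := (1 - t) / 2; set e := t ^+ 2 / 8; set Q := chernoff_rate e ^+ i + _.
have tt : t < 1 /\ -1 < t by move: t1; rewrite ltr_norml => /andP[]; lra.
have a0 : 0 < a by rewrite /a; lra.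
have a1 : a < 1 by rewrite /a; lra.
have t2 : 0 < t ^+ 2 by rewrite exprn_even_gt0.
have t21 : t ^+ 2 < 1 by rewrite -real_normK ?num_real// expr_lt1.
have e0 : 0 < e by rewrite /e; lra.
have e1 : e < 1 by rewrite /e; lra.
have h0 : 0 < 2^-1 :> R by lra.
have h1 : 2^-1 < 1 :> R by lra.
have [La Ua] := stat_grow_bounds a0 a1 (stat_window a0 a1 (corner_env_stat c a0 a1) p q) i j e0 e1.
have [Lh Uh] := stat_grow_bounds h0 h1 (stat_window h0 h1 (corner_env_stat c h0 h1) p q) i j e0 e1.
have -> : (2 * Q)%:E = (Q%:E + Q%:E)%E by rewrite -EFinD; congr EFin; ring.
apply: (measure_le_setU _ _ _ _ La Uh).
- by apply: measurable_set_ler; exact: measurable_corner_env_grow.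
- by apply: measurable_set_ler => //; exact: measurable_corner_env_grow.
- by apply: measurable_set_ler => //; exact: measurable_corner_env_grow.
move=> om /= bad.
case: (leP (grow (window p q (corner_env (X om) c a)) i j)
  ((1 - e) * (i%:R / a + j%:R / (1 - a)))) => [|lt1]; first by left.
right; rewrite leNgt; apply/negP => lt2.
suff : (1 + e) * (i%:R / 2^-1 + j%:R / (1 - 2^-1)) <= (1 - e) * (i%:R / a + j%:R / (1 - a)).
  by move: bad lt1 lt2; lra.
have -> : 2^-1 = (1 - 0) / 2 :> R by rewrite subr0 div1r.
have -> : 1 - (1 - 0) / 2 = (1 - 0) / 2 :> R by lra.
rewrite subr0 div1r invrK -mulrDl [X in (1 + e) * X]mulrDl -!(mulrC 2).
apply: stationary_speed_gap => //; rewrite ?ler0n//.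
have kR : `|i%:R - j%:R| * k%:R <= i%:R + j%:R :> R.
  have -> : `|i%:R - j%:R| = ((i - j) + (j - i))%:R :> R.
    case: (leqP i j) => ij.
      have /eqP -> : (i - j == 0)%N by rewrite subn_eq0.
      by rewrite add0n natrB// distrC ger0_norm// subr_ge0 ler_nat.
    have /eqP -> : (j - i == 0)%N by rewrite subn_eq0 ltnW.
    by rewrite addn0 natrB ?(ltnW ij)// ger0_norm// subr_ge0 ler_nat ltnW.
  by rewrite -natrM -natrD ler_nat.
have n0 := normr_ge0 (i%:R - j%:R : R); have nt := normr_ge0 t.
have h4 : 4 * (`|t| * `|i%:R - j%:R|) <= t ^+ 2 * (i%:R + j%:R).
  rewrite -real_normK ?num_real//.
  have h5 : `|t| ^+ 2 * (`|i%:R - j%:R| * k%:R) <= `|t| ^+ 2 * (i%:R + j%:R).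
    by rewrite ler_wpM2l.
  apply: le_trans h5.
  have h6 : 4 * (`|t| * `|i%:R - j%:R|) <= k%:R * `|t| * (`|t| * `|i%:R - j%:R|).
    by rewrite ler_wpM2r// mulr_ge0.
  by apply: le_trans h6 _; rewrite le_eqVlt; apply/orP; left; apply/eqP; ring.
have := ler_norm (- (t * (i%:R - j%:R))); rewrite normrN normrM; lra.
Qed.

Definition arrow_gap c t i j : set T :=
  [set om | hinc (corner_env (X om) c ((1 + t) / 2)) i j <=
            vinc (corner_env (X om) c ((1 + t) / 2)) i j] `\`
  [set om | hinc (corner_env (X om) c ((1 - t) / 2)) i j <
            vinc (corner_env (X om) c ((1 - t) / 2)) i j].

Lemma measurable_arrow_gap c t i j : measurable (arrow_gap c t i j).
Proof.
have [mh mv] := measurable_corner_env_inc c ((1 + t) / 2) i j.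
have [mh' mv'] := measurable_corner_env_inc c ((1 - t) / 2) i j.
by apply: measurableD; [exact: measurable_set_ler|exact: measurable_set_ltr].
Qed.

(** Coupled by the same weights, the two events are nested outside a null set, and their
    probabilities are the parameters. *)
Lemma arrow_gap_prob c t i j : 0 < t -> t < 1 -> P (arrow_gap c t i j) = t%:E.
Proof.
move=> t0 t1; rewrite /arrow_gap.
have a0 : 0 < (1 - t) / 2 by lra.
have a1 : (1 - t) / 2 < 1 by lra.
have b0 : 0 < (1 + t) / 2 by lra.
have b1 : (1 + t) / 2 < 1 by lra.
have [mh mv] := measurable_corner_env_inc c ((1 + t) / 2) i j.
have [mh' mv'] := measurable_corner_env_inc c ((1 - t) / 2) i j.
have mA := measurable_set_ltr mh' mv'; have mB := measurable_set_ler mh mv.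
have mB' := measurable_set_ltr mh mv; have mE := measurable_set_eqr mh mv.
have [mN N0] := negative_weight_null.
rewrite measureD//=; last first.
  by apply: le_lt_trans (probability_le1 P mB) (ltry _).
have -> : P [set om | hinc (corner_env (X om) c ((1 + t) / 2)) i j <=
            vinc (corner_env (X om) c ((1 + t) / 2)) i j] = ((1 + t) / 2)%:E.
  rewrite -(stat_hinc_lt_vinc b0 b1 (corner_env_stat c b0 b1) i j).
  apply: (measure_eq_null mB mB' mE).
    exact: (stat_hinc_tie b0 b1 (corner_env_stat c b0 b1) i j).
  by move=> om /=; rewrite le_eqVlt; case: eqP.
rewrite setIC (@measure_eq_null _ _ _ P _ _ _ (measurableI _ _ mA mB) mA mN N0).
  have /= -> := stat_hinc_lt_vinc a0 a1 (corner_env_stat c a0 a1) i j.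
  by rewrite -EFinB; congr EFin; lra.
move=> om /= /forallNP wN; split=> [[]//|h]; split => //; apply/ltW.
apply: corner_env_arrow h => //; last lra.
by move=> z; rewrite leNgt; exact/negP.
Qed.

End IidEnvironment.

Section Arrows.
Context {R : realType}.
Implicit Types (w : int * int -> R) (z : int * int) (i j p q I J k N : nat) (t : R).

(* First step, horizontal or not, of the geodesic from [z] to [z + (i, j)]. *)
Definition arrow w z i j : bool :=
  plain w (z.1 + i.+1%:Z, z.2 + j.+1%:Z) i.+1 j < plain w (z.1 + i.+1%:Z, z.2 + j.+1%:Z) i j.+1.

Definition half_arrow w z i j : bool :=
  hinc (corner_env w (z.1 + i.+1%:Z, z.2 + j.+1%:Z) 2^-1) i j <
  vinc (corner_env w (z.1 + i.+1%:Z, z.2 + j.+1%:Z) 2^-1) i j.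

Lemma corner_shift (x : int) i I : (i <= I)%N -> x + I.+1%:Z - (I - i)%:Z = x + i.+1%:Z.
Proof. lia. Qed.

(* Arrows are monotone in the parameter. Either both arrows with parameters
   [(1 - t) / 2] and [(1 + t) / 2] agree, and force the plain arrow up to the
   two speed comparisons, or the pair lies in the gap excluded here. *)
Lemma arrow_half_arrow w z t I J i j : (forall z, 0 <= w z) ->
  (forall c k l, plain w c k.+2 l != plain w c k.+1 l.+1) ->
  0 < t -> t < 1 -> (0 < i)%N -> (i <= I)%N -> (j <= J)%N ->
  let c := (z.1 + I.+1%:Z, z.2 + J.+1%:Z) in
  let x a := window (I - i) (J - j) (corner_env w c a) in
  (hinc (corner_env w c ((1 + t) / 2)) I J <= vinc (corner_env w c ((1 + t) / 2)) I J ->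
   hinc (corner_env w c ((1 - t) / 2)) I J < vinc (corner_env w c ((1 - t) / 2)) I J) ->
  grow (x 2^-1) i.+1 j.+1 < grow (x ((1 - t) / 2)) i.+1 j.+1 ->
  grow (x 2^-1) i.+1 j.+1 < grow (x ((1 + t) / 2)) i.+1 j.+1 ->
  arrow w z i j = half_arrow w z I J.
Proof.
move=> w0 ties t0 t1 i0 iI jJ c x gap bada badb.
have a0 : 0 < (1 - t) / 2 by lra.
have ah : (1 - t) / 2 <= 2^-1 by lra.
have h1 : 2^-1 < 1 :> R by lra.
have h0 : 0 < 2^-1 :> R by lra.
have hb : 2^-1 <= (1 + t) / 2 by lra.
have b1 : (1 + t) / 2 < 1 by lra.
have xE a : (grow (x a) i.+1 j < grow (x a) i j.+1) =
    (hinc (corner_env w c a) I J < vinc (corner_env w c a) I J).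
  rewrite /x !grow_window !addnS (subnK iI) (subnK jJ) /hinc /vinc.
  by rewrite !ltrD2r.
have xE' a : (grow (x a) i j.+1 < grow (x a) i.+1 j) =
    (vinc (corner_env w c a) I J < hinc (corner_env w c a) I J).
  rewrite /x !grow_window !addnS (subnK iI) (subnK jJ) /hinc /vinc.
  by rewrite !ltrD2r.
have cE : (c.1 - (I - i)%:Z, c.2 - (J - j)%:Z) = (z.1 + i.+1%:Z, z.2 + j.+1%:Z).
  by rewrite /c /= !corner_shift.
have tie : plain w (z.1 + i.+1%:Z, z.2 + j.+1%:Z) i.+1 j !=
    plain w (z.1 + i.+1%:Z, z.2 + j.+1%:Z) i j.+1.
  by case: i i0 {iI x xE xE' cE bada badb} => // i _; exact: ties.
rewrite /arrow /half_arrow -/c.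
case: (leP (hinc (corner_env w c ((1 + t) / 2)) I J) (vinc (corner_env w c ((1 + t) / 2)) I J)).
  move=> /gap hv. rewrite (corner_env_arrow w0 a0 ah h1 hv).
  apply: contraTT bada; rewrite -!leNgt => le.
  apply: (plain_sandwich_low w0 a0 ah h1); first by rewrite xE.
  by rewrite cE lt_neqAle eq_sym tie.
move=> hv; have -> : (hinc (corner_env w c 2^-1) I J < vinc (corner_env w c 2^-1) I J) = false.
  by apply: contraTF hv => /(corner_env_arrow w0 h0 hb b1)/ltW; rewrite leNgt.
apply: contraTF badb; rewrite -leNgt => lt.
apply: (plain_sandwich_high w0 h0 hb b1); first by rewrite xE'.
by rewrite cE.
Qed.

End Arrows.

Section ArrowConvergence.
Context {R : realType} d (T : measurableType d) (P : probability T R).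
Variable X : T -> int * int -> R.
Hypothesis indepX : indep_family P X (fun=> exponential_prob 1).
Implicit Types (z : int * int) (t : R) (i j I J k N : nat).

(** All targets in the cone below [(I, J)] are compared with a single stationary arrow; this makes a
    bound uniform in [I] and [J] possible. *)
Definition arrow_mismatch k N z I J : set T :=
  [set om | exists ij : nat * nat, [/\ (ij.1 <= I)%N, (ij.2 <= J)%N, cone k N ij.1 ij.2 &
     arrow (X om) z ij.1 ij.2 != half_arrow (X om) z I J]].

Lemma measurable_arrow z i j : measurable [set om | arrow (X om) z i j].
Proof. by apply: measurable_set_ltr; exact: (measurable_plain indepX). Qed.

Lemma measurable_half_arrow z i j : measurable [set om | half_arrow (X om) z i j].
Proof.
have [mh mv] := measurable_corner_env_inc indepX (z.1 + i.+1%:Z, z.2 + j.+1%:Z) 2^-1 i j.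
exact: measurable_set_ltr.
Qed.

Lemma measurable_neqb (f g : T -> bool) : measurable [set om | f om] ->
  measurable [set om | g om] -> measurable [set om | f om != g om].
Proof.
move=> mf mg; rewrite (_ : [set _ | _] =
  ([set om | f om] `\` [set om | g om]) `|` ([set om | g om] `\` [set om | f om])).
  by apply: measurableU; apply: measurableD.
apply/seteqP; split => om /=; case: (f om); case: (g om) => //= h.
- by left; split.
- by right; split.
- by case: h => -[].
- by case: h => -[].
Qed.

Lemma measurable_and (b : bool) (B : set T) : measurable B -> measurable [set om | b /\ B om].
Proof.
case: b => mB; first by rewrite (_ : [set _ | _] = B)//; apply/seteqP; split => om //= [].
by rewrite (_ : [set _ | _] = set0)//; apply/seteqP; split => om //= [].
Qed.

Lemma measurable_arrow_mismatch k N z I J : measurable (arrow_mismatch k N z I J).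
Proof.
apply: measurable_exists => -[i j] /=.
rewrite [X in measurable X](_ : _ = [set om | [&& (i <= I)%N, (j <= J)%N & cone k N i j] /\
    arrow (X om) z i j != half_arrow (X om) z I J]).
  apply: (@measurable_and _ [set om | arrow (X om) z i j != half_arrow (X om) z I J]).
  apply: measurable_neqb; [exact: measurable_arrow|exact: measurable_half_arrow].
by apply/seteqP; split => om /=; [move=> [-> -> -> ->]|move=> [/and3P[-> -> ->] ->]].
Qed.

Lemma measure_sum_setU (n : nat) (F : 'I_n -> set T) (x : 'I_n -> R) :
  (forall i : 'I_n, measurable (F i)) -> (forall i : 'I_n, (P (F i) <= (x i)%:E)%E) ->
  (P (\big[setU/set0]_(i < n) F i) <= (\sum_(i < n) x i)%:E)%E.
Proof.
elim: n F x => [|n IH] F x mF Fx; first by rewrite !big_ord0 measure0.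
rewrite !big_ord_recr /= EFinD.
have mU : measurable (\big[setU/set0]_(i < n) F (widen_ord (leqnSn n) i)).
  by apply: bigsetU_measurable => i _; exact: mF.
have H := IH (F \o widen_ord (leqnSn n)) (x \o widen_ord (leqnSn n)) (fun l => mF _) (fun l => Fx _).
exact: (measure_le_setU (measurableU _ _ mU (mF ord_max)) mU (mF ord_max) _ H (Fx ord_max)).
Qed.

(** The parameter gap is one event for the whole square and costs [t]. The two speed comparisons at
    [(i, j)] together cost [4 * (q ^+ i + q ^+ j)], and [cone_sum_bound] sums these costs. *)
Lemma arrow_mismatch_le t k (M : nat) (q : R) z I J : 0 < t -> t < 1 -> 4 <= k%:R * t ->
  (1 < k)%N -> (0 < M)%N -> q = chernoff_rate (t ^+ 2 / 8) ->
  (P (arrow_mismatch k (4 * M) z I J) <=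
   (t + 8 * slow_rate q ^+ M / (1 - slow_rate q) ^+ 2)%:E)%E.
Proof.
move=> t0 t1 kt k1 M0 qE.
have e0 : 0 < t ^+ 2 / 8 by rewrite divr_gt0// exprn_gt0.
have e1 : t ^+ 2 / 8 < 1.
  have : t ^+ 2 < 1 by rewrite expr_lt1// ltW.
  lra.
have q01 : 0 < q < 1 by rewrite qE; exact: chernoff_rate_bounds.
have [q0 q1] := andP q01.
pose c := (z.1 + I.+1%:Z, z.2 + J.+1%:Z).
pose x om i j a := grow (window (I - i) (J - j) (corner_env (X om) c a)) i.+1 j.+1.
have mx i j a : measurable_fun setT (fun om => x om i j a) by exact: (measurable_corner_env_grow indepX).
pose N := (I + J).+1.
(* [B (- t)] is the comparison on the other side, with parameter [(1 + t) / 2]. *)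
pose B t i j : set T := [set om | x om i j ((1 - t) / 2) <= x om i j 2^-1].
have mB s i j : measurable (B s i j) by apply: measurable_set_ler; exact: mx.
pose Bad : set T := \big[setU/set0]_(i < N) \big[setU/set0]_(j < N)
  (if cone k (4 * M) i j then B t i j `|` B (- t) i j else set0).
have mBij i j : measurable (if cone k (4 * M) i j then B t i j `|` B (- t) i j else set0).
  by case: ifP => // _; apply: measurableU; exact: mB.
have mBad : measurable Bad.
  by apply: bigsetU_measurable => i _; apply: bigsetU_measurable.
have [mNeg Neg0] := negative_weight_null indepX.
have [mTie Tie0] := plain_tie_null indepX.
have mgap := measurable_arrow_gap indepX c t I J.
have gapE := arrow_gap_prob indepX c I J t0 t1.
have PBad : (P Bad <= (8 * slow_rate q ^+ M / (1 - slow_rate q) ^+ 2)%:E)%E.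
  apply: (@le_trans _ _ (\sum_(i < N) \sum_(j < N) (if cone k (4 * M) i j then
      4 * (q ^+ i + q ^+ j) else 0))%:E); last first.
    rewrite lee_fin.
    under eq_bigr do rewrite -big_mkcond -mulr_sumr.
    rewrite -mulr_sumr (_ : 8 * slow_rate q ^+ M / _ = 4 * (2 * slow_rate q ^+ M /
      (1 - slow_rate q) ^+ 2)); last by rewrite !mulrA; congr (_ * _ * _); lra.
    by apply: ler_wpM2l => //; exact: cone_sum_bound.
  apply: measure_sum_setU => i; first by apply: bigsetU_measurable.
  apply: measure_sum_setU => j //; case: ifP => [cij|_]; last by rewrite measure0.
  have cij1 : cone k 1 i.+1 j.+1.
    by apply: coneS; move: cij; rewrite /cone => /andP[h ->]; rewrite andbT; lia.
  have qle : 2 * (q ^+ i.+1 + q ^+ j.+1) <= 2 * (q ^+ i + q ^+ j).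
    by rewrite ler_wpM2l// lerD// exprS ler_piMl ?exprn_ge0// ltW.
  rewrite (_ : 4 * _ = 2 * (q ^+ i + q ^+ j) + 2 * (q ^+ i + q ^+ j)); last by lra.
  rewrite EFinD; apply: (measure_le_setU (measurableU _ _ (mB _ _ _) (mB _ _ _)) (mB t i j) (mB (- t) i j)) => //.
    apply: (@le_trans _ _ (2 * (q ^+ i.+1 + q ^+ j.+1))%:E); last by rewrite lee_fin.
    rewrite qE; apply: (@corner_env_bad _ _ _ _ X indepX c _ _ _ _ _ k) => //; first by rewrite gt_eqF.
      by rewrite gtr0_norm.
    by rewrite gtr0_norm.
  apply: (@le_trans _ _ (2 * (q ^+ i.+1 + q ^+ j.+1))%:E); last by rewrite lee_fin.
  rewrite qE -(sqrrN t).
  apply: (@corner_env_bad _ _ _ _ X indepX c _ _ _ _ _ k) => //; first by rewrite oppr_eq0 gt_eqF.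
    by rewrite normrN gtr0_norm.
  by rewrite normrN gtr0_norm.
set Neg := [set om | exists z, X om z < 0] in mNeg Neg0.
set Tie := [set om | exists _, _] in mTie Tie0.
have PZ : (P (Neg `|` Tie) <= 0%:E)%E.
  have N0 : (P Neg <= 0%:E)%E by rewrite Neg0.
  have T0 : (P Tie <= 0%:E)%E by rewrite Tie0.
  rewrite -[0%R]addr0 EFinD.
  exact: (measure_le_setU (measurableU _ _ mNeg mTie) mNeg mTie _ N0 T0).
have PGB : (P (arrow_gap X c t I J `|` Bad) <= (t + 8 * slow_rate q ^+ M / (1 - slow_rate q) ^+ 2)%:E)%E.
  have G0 : (P (arrow_gap X c t I J) <= t%:E)%E by rewrite gapE.
  rewrite EFinD; exact: (measure_le_setU (measurableU _ _ mgap mBad) mgap mBad _ G0 PBad).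
rewrite -[X in (_ <= X%:E)%E]addr0 EFinD.
apply: (measure_le_setU _ _ _ _ PGB PZ).
- exact: measurable_arrow_mismatch.
- exact: measurableU.
- exact: measurableU.
move=> om [[i j] /= [iI jJ cij neq]].
apply: contrapT => /not_orP[/not_orP[ngap nbad] /not_orP[nneg ntie]].
have nB s : s = t \/ s = - t -> ~ B s i j om.
  move=> st Bij; apply: nbad; rewrite /Bad.
  have hi : (i < N)%N by rewrite /N ltnS (leq_trans iI)// leq_addr.
  have hj : (j < N)%N by rewrite /N ltnS (leq_trans jJ)// leq_addl.
  rewrite (bigD1 (Ordinal hi))//=; left; rewrite (bigD1 (Ordinal hj))//=; left.
  by rewrite cij; case: st Bij => ->; [left|right].
move/eqP: neq; apply.
have M40 : (0 < 4 * M)%N by rewrite muln_gt0.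
have [i0 j0] := cone_gt0 k1 M40 cij.
apply: (@arrow_half_arrow _ _ _ t) => //.
- by move=> v; rewrite leNgt; apply/negP => h; apply: nneg; exists v.
- by move=> v a b; apply/eqP => h; apply: ntie; exists (v, (a, b)).
- by move=> h1; rewrite ltNge; apply/negP => h2; apply: ngap; split => //=; apply/negP; rewrite -leNgt.
- by rewrite ltNge; apply/negP => h; apply: (nB t); [left|].
- rewrite ltNge; apply/negP => h; apply: (nB (- t)); first by right.
  by rewrite /B /= opprK.
Qed.

Lemma arrow_mismatch_small (e : R) : 0 < e -> exists k N, [/\ (1 < k)%N, (0 < N)%N &
  forall z I J, (P (arrow_mismatch k N z I J) <= e%:E)%E].
Proof.
(* Half of [e] is spent on the gap; [t] then fixes the aperture [k], and a large [M] makes the rest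
   small. *)
move=> e0; pose t := Num.min (e / 2) 2^-1.
have t0 : 0 < t by rewrite /t lt_min; apply/andP; split; lra.
have t1 : t < 1 by rewrite /t gt_min; apply/orP; right; lra.
have te : t <= e / 2 by rewrite /t ge_min lexx.
pose k := (Num.truncn (4 / t)).+1.
have kt : 4 <= k%:R * t.
  by rewrite -ler_pdivrMr// ltW// truncnS_gt.
have k1 : (1 < k)%N.
  rewrite ltnNge; apply/negP => k1; have : k%:R <= 1 :> R by rewrite (ler_nat _ k 1).
  move: kt t1 t0; nra.
have e80 : 0 < t ^+ 2 / 8 by rewrite divr_gt0// exprn_gt0.
have e81 : t ^+ 2 / 8 < 1.
  have : t ^+ 2 < 1 by rewrite expr_lt1// ltW.
  lra.
have [q0 q1] := andP (chernoff_rate_bounds e80 e81).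
set q := chernoff_rate (t ^+ 2 / 8) in q0 q1 *.
have [/andP[r0 r1] _] := slow_rate_bounds (q := q) ltac:(by rewrite q0 q1).
set r := slow_rate q in r0 r1.
have h0 : 0 < e / 2 * (1 - r) ^+ 2 / 8.
  by rewrite divr_gt0// mulr_gt0 ?exprn_gt0//; lra.
have [M M0 rM] : exists2 M, (0 < M)%N & r ^+ M <= e / 2 * (1 - r) ^+ 2 / 8.
  have r1' : `|r| < 1 by rewrite gtr0_norm.
  have /cvgrPdist_lt /(_ _ h0) [M _ HM] := cvg_expr r1'.
  exists M.+1 => //; have := HM M.+1 (leqnSn M); rewrite /= sub0r normrN.
  by rewrite ger0_norm ?exprn_ge0 ?(ltW r0)// => /ltW.
exists k, (4 * M)%N; split => //; first by rewrite muln_gt0.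
move=> z I J; apply: (le_trans (arrow_mismatch_le z I J t0 t1 kt k1 M0 erefl)).
rewrite lee_fin -/q -/r.
suff : 8 * r ^+ M / (1 - r) ^+ 2 <= e / 2 by lra.
by rewrite ler_pdivrMr ?exprn_gt0 ?subr_gt0//; lra.
Qed.

End ArrowConvergence.

(** * Walks that follow arrows, and their meetings *)

Section Walks.
Implicit Types (b : nat * nat -> bool) (z : nat * nat) (k m n K : nat).

Definition step b z : nat * nat := if b z then (z.1.+1, z.2) else (z.1, z.2.+1).

Definition walk b z k : nat * nat := iter k (step b) z.

(** At time [k] both walks are on the antidiagonal [m + k], so they can only meet at equal times. *)
Definition meet b m n k : bool :=
  (walk b (m, 0%N) k == walk b (0%N, m) k) && ((walk b (m, 0%N) k).2 < n)%N.

Lemma walkS b z k : walk b z k.+1 = step b (walk b z k).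
Proof. by []. Qed.

Lemma walk_sum b z k : ((walk b z k).1 + (walk b z k).2 = z.1 + z.2 + k)%N.
Proof.
elim: k => [|k IH]; first by rewrite addn0.
by rewrite addnS -IH /walk iterS /step; case: ifP => _ /=; rewrite ?addSn ?addnS.
Qed.

Lemma walk_local b b' B z k :
  (forall z, (z.1 < B)%N -> (z.2 < B)%N -> b z = b' z) -> (z.1 + z.2 + k <= B)%N ->
  walk b z k = walk b' z k.
Proof.
move=> bb'; elim: k => [//|k IH] kB; have {}IH : walk b z k = walk b' z k by apply: IH; lia.
have := walk_sum b z k; rewrite /walk !iterS -/(walk b z k) -/(walk b' z k) -IH => h.
by rewrite /step bb'//; lia.
Qed.

Lemma meet_local b b' m n K k :
  (forall z, (z.1 < m + K)%N -> (z.2 < m + K)%N -> b z = b' z) -> (k < K)%N ->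
  meet b m n k = meet b' m n k.
Proof.
move=> bb' kK; have h z : (z.1 + z.2 = m)%N -> walk b z k = walk b' z k.
  by move=> zm; apply: (walk_local (B := (m + K)%N)) => //; lia.
by rewrite /meet !h//= addn0.
Qed.

Context d (T : measurableType d).
Variable b : T -> nat * nat -> bool.
Hypothesis mb : forall z, measurable [set om | b om z].

Lemma measurable_walk z k v : measurable [set om | walk (b om) z k = v].
Proof.
have mC (p : Prop) : measurable [set om : T | p].
  case: (pselect p) => hp.
    by rewrite [X in measurable X](_ : _ = setT)//; apply/seteqP; split.
  by rewrite [X in measurable X](_ : _ = set0)//; apply/seteqP; split.
elim: k v => [|k IH] v; first exact: (mC (z = v)).
rewrite [X in measurable X](_ : _ = [set om | exists u,
   (walk (b om) z k = u /\ b om u /\ (u.1.+1, u.2) = v) \/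
   (walk (b om) z k = u /\ ~ b om u /\ (u.1, u.2.+1) = v)]); last first.
  apply/seteqP; split => om; rewrite /= /step.
    by case: ifPn => h <-; exists (walk (b om) z k); [left|right]; do !split => //; apply/negP.
  by move=> [u [[-> [-> //]]|[-> [/negP/negbTE -> //]]]].
apply: (@measurable_exists _ T (nat * nat)%type) => u.
apply: measurableU; apply: measurableI; try exact: IH.
  exact: (measurableI _ _ (mb u) (mC ((u.1.+1, u.2) = v))).
exact: (measurableI _ _ (measurableC (mb u)) (mC ((u.1, u.2.+1) = v))).
Qed.

Lemma measurable_meet m n k : measurable [set om | meet (b om) m n k].
Proof.
rewrite [X in measurable X](_ : _ = [set om | exists u : nat * nat,
   [set om | walk (b om) (m, 0%N) k = u] om /\
   ([set om | walk (b om) (0%N, m) k = u] om /\ (u.2 < n)%N)]).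
  apply: (@measurable_exists _ T (nat * nat)%type) => u.
  apply: measurableI; first exact: measurable_walk.
  case: (u.2 < n)%N.
    rewrite [X in measurable X](_ : _ = [set om | walk (b om) (0%N, m) k = u]).
      exact: measurable_walk.
    by apply/seteqP; split => om //= -[].
  by rewrite [X in measurable X](_ : _ = set0)//; apply/seteqP; split => om //= -[].
apply/seteqP; split => om /=.
  move=> /andP[/eqP h1 h2]; exists (walk (b om) (m, 0%N) k); split=> //; split=> //.
by move=> [u [h1 [h2 h3]]]; rewrite /meet h1 h2 eqxx.
Qed.

End Walks.

Section LimitArrows.
Context {R : realType} d (T : measurableType d) (P : probability T R).
Variable X : T -> int * int -> R.
Hypothesis indepX : indep_family P X (fun=> exponential_prob 1).
Implicit Types (z : int * int) (e : R) (i j I J k N : nat).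

(** Read off along the diagonal only; [lim_arrow_cone] extends it to a cone. Where the arrows do not
    converge the value is [false]. *)
Definition lim_arrow (w : int * int -> R) z : bool :=
  `[< exists N, forall n, (N <= n)%N -> arrow w z n n >].

Definition arrow_osc k N z : set T :=
  [set om | exists u : (nat * nat) * (nat * nat),
    cone k N u.1.1 u.1.2 /\ cone k N u.2.1 u.2.2 /\
    arrow (X om) z u.1.1 u.1.2 != arrow (X om) z u.2.1 u.2.2].

Lemma lim_arrow_cone k N z om : ~ arrow_osc k N z om ->
  forall i j, cone k N i j -> arrow (X om) z i j = lim_arrow (X om) z.
Proof.
move=> nosc; have C i j i' j' : cone k N i j -> cone k N i' j' ->
    arrow (X om) z i j = arrow (X om) z i' j'.
  by move=> c c'; apply/eqP; apply: contrapT => /negP h; apply: nosc; exists ((i, j), (i', j')).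
have D n : (N <= n)%N -> cone k N n n.
  by rewrite /cone subnn addn0 mul0n /=; lia.
move=> i j cij; rewrite /lim_arrow; case: (boolP (arrow (X om) z i j)) => h.
  by apply/esym/asboolP; exists N => n Nn; rewrite (C _ _ i j (D _ Nn)).
apply/esym/asboolPn => -[N' HN'].
have := HN' (maxn N N') (leq_maxr _ _).
by rewrite (C _ _ i j (D _ (leq_maxl _ _)) cij) (negbTE h).
Qed.

Lemma measurable_arrow_osc k N z : measurable (arrow_osc k N z).
Proof.
apply: (@measurable_exists _ T) => -[[i j] [i' j']] /=.
have H := @measurable_neqb _ T _ _ (measurable_arrow indepX z i j) (measurable_arrow indepX z i' j').
by apply: measurable_and; apply: measurable_and.
Qed.

(** Of two different arrows towards targets below [(n, n)], one disagrees with the stationary arrow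
    [half_arrow (X om) z n n]. So the oscillation up to [n] is a mismatch, and the bound survives
    the increasing union over [n]. *)
Lemma arrow_osc_le k N z e : (forall n, (P (arrow_mismatch X k N z n n) <= e%:E)%E) ->
  (P (arrow_osc k N z) <= e%:E)%E.
Proof.
move=> He.
pose F n : set T := [set om | exists u : (nat * nat) * (nat * nat),
    [&& u.1.1 <= n, u.1.2 <= n, u.2.1 <= n & u.2.2 <= n]%N /\
    (cone k N u.1.1 u.1.2 /\ cone k N u.2.1 u.2.2 /\
    arrow (X om) z u.1.1 u.1.2 != arrow (X om) z u.2.1 u.2.2)].
have mF n : measurable (F n).
  apply: (@measurable_exists _ T) => -[[i j] [i' j']] /=.
  have H := @measurable_neqb _ T _ _ (measurable_arrow indepX z i j) (measurable_arrow indepX z i' j').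
  by apply: measurable_and; apply: measurable_and; apply: measurable_and.
have FE : arrow_osc k N z = \bigcup_n F n.
  apply/seteqP; split => om.
    move=> [[[a b] [a' b']] /= h]; exists (a + b + a' + b')%N => //.
    by exists ((a, b), (a', b')); split => //=; apply/and4P; split; lia.
  by move=> [n _ [u [_ h]]]; exists u.
have Fn : {homo F : n n' / (n <= n')%N >-> (n <= n')%O}.
  move=> n n' nn'; apply/subsetPset => om [u [/and4P[h1 h2 h3 h4] h]]; exists u; split => //.
  by apply/and4P; split; apply: leq_trans nn'.
have cF := @nondecreasing_cvg_mu _ T R P F mF (bigcup_measurable (fun n _ => mF n)) Fn.
rewrite FE -(cvg_lim _ cF)//; apply: lime_le; first by apply/cvg_ex; eexists; exact: cF.
apply: nearW => n /=; apply: le_trans (He n); apply: le_measure; rewrite ?inE//.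
  exact: (measurable_arrow_mismatch indepX).
move=> om [[[i j] [i' j']] /= [/and4P[h1 h2 h3 h4] [c1 [c2 neq]]]].
case: (eqVneq (arrow (X om) z i j) (half_arrow (X om) z n n)) => E; last first.
  by exists (i, j); split.
by exists (i', j'); split => //=; rewrite -E eq_sym.
Qed.

Lemma arrow_osc_small e : 0 < e -> exists k N, [/\ (1 < k)%N, (0 < N)%N &
  forall z, (P (arrow_osc k N z) <= e%:E)%E /\
    forall I J, (P (arrow_mismatch X k N z I J) <= e%:E)%E].
Proof.
move=> e0; have [k [N [k1 N0 H]]] := arrow_mismatch_small indepX e0.
exists k, N; split => // z; split; last exact: H.
by apply: arrow_osc_le => n; exact: H.
Qed.

(** Oscillation in every cone implies oscillation in the cone chosen for [e], so its probability is
    at most [e] for each [e > 0]. *)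
Lemma arrow_limit : P.-negligible
  [set om | ~ forall z, exists k N, forall i j, cone k N i j ->
     arrow (X om) z i j = lim_arrow (X om) z].
Proof.
pose C z : set T := [set om | forall k N, arrow_osc k N z om].
have mC z : measurable (C z).
  rewrite [X in measurable X](_ : _ = \bigcap_k \bigcap_N arrow_osc k N z).
    by apply: bigcapT_measurable => k; apply: bigcapT_measurable => N; exact: measurable_arrow_osc.
  apply/seteqP; split => om /= h; first by move=> k _ N _; exact: h.
  by move=> k N; exact: (h k I N I).
have C0 z : P (C z) = 0%E.
  apply/eqP; rewrite eq_le [in X in _ && X]measure_ge0 andbT; apply/lee_addgt0Pr => e e0.
  have [k [N [_ _ /(_ z)[H _]]]] := arrow_osc_small e0.
  rewrite add0e; apply: le_trans H; apply: le_measure; rewrite ?inE//.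
    exact: measurable_arrow_osc.
exists [set om | exists z, C z om]; split.
- exact: (@measurable_exists _ T).
- exact: (@null_exists _ _ T P).
move=> om /= /existsNP[z Hz]; exists z => k N; apply: contrapT => nosc.
by apply: Hz; exists k, N; exact: lim_arrow_cone.
Qed.

Lemma lim_arrow_half_arrow k N z I J om : cone k N I J ->
  lim_arrow (X om) z != half_arrow (X om) z I J ->
  (arrow_osc k N z `|` arrow_mismatch X k N z I J) om.
Proof.
move=> cIJ neq; apply: contrapT => /not_orP[n1 n2]; apply: n2; exists (I, J); split => //=.
by rewrite (lim_arrow_cone n1).
Qed.

Lemma measurable_lim_arrow z : measurable [set om | lim_arrow (X om) z].
Proof.
rewrite [X in measurable X](_ : _ =
   [set om | exists N, (\bigcap_(n in [set n | (N <= n)%N]) [set om | arrow (X om) z n n]) om]).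
  apply: (@measurable_exists _ T nat) => N; apply: bigcap_measurable.
    by exists N => /=.
  by move=> n _; exact: (measurable_arrow indepX).
by apply/seteqP; split => om /= => [/asboolP|?]; [|exact/asboolP].
Qed.

(* Seen from [(N, N)], the arrows of the model with parameter [1 / 2] are, in
   reversed coordinates, the dual arrows of a stationary environment. *)
Definition dual_arrow (x : nat * nat -> R) (z : nat * nat) : bool :=
  grow x z.1.+1 z.2 < grow x z.1 z.2.+1.

Lemma measurable_dual_arrow (z : nat * nat) :
  measurable [set x : env R (nat * nat)%type | dual_arrow x z].
Proof. by apply: measurable_set_ltr; exact: measurable_grow. Qed.

Definition half_arrow_from N (w : int * int -> R) (z : nat * nat) : bool :=
  half_arrow w (z.1%:Z, z.2%:Z) (N - z.1.+1) (N - z.2.+1).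

(** Passing to the time left until the opposite corner reverses the comparison, and reversing the
    coordinates exchanges the two neighbours compared; the two effects cancel. *)
Lemma half_arrow_from_dual N :
  exists2 Y, indep_family P Y (stat_law (\d_(0 : R)) 2^-1) &
  forall om (z : nat * nat), (z.1 < N)%N -> (z.2 < N)%N ->
    half_arrow_from N (X om) z = dual_arrow (Y om) z.
Proof.
have h0 : 0 < 2^-1 :> R by lra.
have h1 : 2^-1 < 1 :> R by lra.
have [Y [iY YE]] := stat_reflected h0 h1 (corner_env_stat indepX (N%:Z, N%:Z) h0 h1) N.
exists Y => // om [i j] /= iN jN.
have E (l : nat) : (l < N)%N -> l%:Z + (N - l.+1).+1%:Z = N%:Z by move=> ?; lia.
rewrite /half_arrow_from /half_arrow /dual_arrow [X in _ = (X < _)]YE ?(ltnW jN)//.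
rewrite [X in _ = (_ < X)]YE ?(ltnW iN)//= !E// ltrD2l ltrN2 /hinc /vinc !subnSK//.
by rewrite ltrD2r.
Qed.


Definition lim_arrow_nat w (u : nat * nat) : bool := lim_arrow w (u.1%:Z, u.2%:Z).

Lemma cone_near B k N i j : (i < B)%N -> (j < B)%N ->
  cone k N ((B * k + B + N).+1 - i.+1) ((B * k + B + N).+1 - j.+1).
Proof.
move=> iB jB; rewrite /cone.
have hB : ((B * k + B + N).+1 - i.+1 - ((B * k + B + N).+1 - j.+1) +
   ((B * k + B + N).+1 - j.+1 - ((B * k + B + N).+1 - i.+1)) <= B)%N by lia.
by apply/andP; split; [lia|apply: leq_trans (leq_mul hB (leqnn k)) _; lia].
Qed.

Lemma lim_arrow_half_small B e : 0 < e ->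
  exists N, [/\ (B <= N)%N & exists S : set T, [/\ measurable S, (P S <= e%:E)%E &
    forall om, ~ S om -> forall u : nat * nat, (u.1 < B)%N -> (u.2 < B)%N ->
      lim_arrow_nat (X om) u = half_arrow_from N (X om) u]].
Proof.
(* Two events for each of the [B ^ 2] sites; [B.+1] avoids a zero denominator. *)
move=> e0; pose e' := e / (2 * B.+1%:R ^+ 2).
have B0 : 0 < B.+1%:R :> R by [].
have e'0 : 0 < e' by rewrite divr_gt0// mulr_gt0// exprn_gt0.
have [k [N0 [_ _ H]]] := arrow_osc_small e'0.
pose N := (B * k + B + N0).+1; exists N; split; first by rewrite /N; lia.
pose F (i j : nat) : set T := arrow_osc k N0 (i%:Z, j%:Z) `|`
  arrow_mismatch X k N0 (i%:Z, j%:Z) (N - i.+1) (N - j.+1).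
have mF i j : measurable (F i j).
  by apply: measurableU; [exact: measurable_arrow_osc|exact: (measurable_arrow_mismatch indepX)].
exists (\big[setU/set0]_(i < B) \big[setU/set0]_(j < B) F i j); split.
- by apply: bigsetU_measurable => i _; apply: bigsetU_measurable.
- apply: (@le_trans _ _ (\sum_(i < B) \sum_(j < B) (e' + e'))%:E).
    apply: measure_sum_setU => i; first by apply: bigsetU_measurable.
    apply: measure_sum_setU => j //; have [H1 H2] := H ((i : nat)%:Z, (j : nat)%:Z).
    rewrite EFinD; exact: (measure_le_setU (mF _ _) (measurable_arrow_osc _ _ _)
      (measurable_arrow_mismatch indepX _ _ _ _ _) (fun _ h => h) H1 (H2 _ _)).
  rewrite lee_fin !sumr_const !card_ord -!mulrnA -mulr_natr natrM /e' -mulr2n -[X in X * _]mulr_natr.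
  have -> : e / (2 * B.+1%:R ^+ 2) * 2 * (B%:R * B%:R) = e * ((B%:R / B.+1%:R) ^+ 2).
    by field; rewrite gt_eqF.
  rewrite -[leRHS]mulr1 ler_wpM2l ?(ltW e0)// expr_le1 ?divr_ge0//.
  by rewrite ler_pdivrMr// mul1r ler_nat.
move=> om nS [i j] /= iB jB; apply/eqP; apply: contrapT => /negP neq; apply: nS.
rewrite (bigD1 (Ordinal iB))//=; left; rewrite (bigD1 (Ordinal jB))//=; left.
by apply: lim_arrow_half_arrow neq; exact: cone_near.
Qed.

Section Comparison.
Context d' (T' : measurableType d') (P' : probability T' R).
Variable X' : T' -> nat * nat -> R.
Hypothesis indepX' : indep_family P' X' (stat_law (\d_(0 : R)) 2^-1).
Implicit Types (m n : nat).

Lemma measurable_meet_lim m n k :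
  measurable [set om | meet (lim_arrow_nat (X om)) m n k].
Proof.
by apply: (@measurable_meet _ T (fun om => lim_arrow_nat (X om))) => u; exact: measurable_lim_arrow.
Qed.

Lemma measurable_meet_dual m n k :
  measurable [set x : env R (nat * nat)%type | meet (dual_arrow x) m n k].
Proof.
apply: (@measurable_meet _ (env R (nat * nat)%type) (fun x => dual_arrow x)) => u.
exact: measurable_dual_arrow.
Qed.

(** A meeting within [K] steps is decided by the arrows of a finite box, where the models can be
    compared. *)
Definition meet_before (b : nat * nat -> bool) m n K : Prop := exists k, (k < K)%N /\ meet b m n k.

Lemma measurable_meet_before d0 (T0 : measurableType d0) (b : T0 -> nat * nat -> bool) m n K :
  (forall k, measurable [set om | meet (b om) m n k]) ->
  measurable [set om | meet_before (b om) m n K].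
Proof.
by move=> H; apply: (@measurable_exists _ T0 nat) => k; exact: (@measurable_and _ T0 (k < K)%N [set om | meet (b om) m n k]).
Qed.

Lemma meet_before_half m n N K : (m + K <= N)%N ->
  measurable [set om | meet_before (half_arrow_from N (X om)) m n K] /\
  P [set om | meet_before (half_arrow_from N (X om)) m n K] =
  P' [set om | meet_before (dual_arrow (X' om)) m n K].
Proof.
move=> KN; have [Y iY YE] := half_arrow_from_dual N.
have mE := measurable_meet_before K (fun k => measurable_meet_dual m n k).
have E : [set om | meet_before (half_arrow_from N (X om)) m n K] =
    Y @^-1` [set x : env R (nat * nat)%type | meet_before (dual_arrow x) m n K].
  apply/seteqP; split => om /= [k [kK h]]; exists k; split => //; move: h;
    rewrite (@meet_local (half_arrow_from N (X om)) (dual_arrow (Y om)) m n K k)// => u u1 u2;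
    by apply: YE; apply: leq_trans KN.
split; first by rewrite E; exact: (measurable_env_pre iY).
by rewrite E (indep_family_law iY indepX' mE).
Qed.

(** [half_arrow_from N] is the bridge: for suitable [N] it agrees with the limit arrows in the box
    up to probability [e], while by [meet_before_half] its meeting probability is the same for all
    large [N]. *)
Lemma meet_before_lim m n K :
  P [set om | meet_before (lim_arrow_nat (X om)) m n K] =
  P' [set om | meet_before (dual_arrow (X' om)) m n K].
Proof.
have mL := measurable_meet_before K (fun k => measurable_meet_lim m n k).
have key e : 0 < e ->
   (P [set om | meet_before (lim_arrow_nat (X om)) m n K] <=
    P' [set om | meet_before (dual_arrow (X' om)) m n K] + e%:E)%E /\
   (P' [set om | meet_before (dual_arrow (X' om)) m n K] <=
    P [set om | meet_before (lim_arrow_nat (X om)) m n K] + e%:E)%E.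
  move=> e0; have [N [KN [S [mS Se HS]]]] := lim_arrow_half_small (m + K) e0.
  have [mH <-] := meet_before_half n KN.
  have E om : ~ S om -> meet_before (lim_arrow_nat (X om)) m n K <->
      meet_before (half_arrow_from N (X om)) m n K.
    move=> /HS h; split=> -[k [kK]].
      by rewrite (meet_local _ h kK); exists k.
    by rewrite -(meet_local _ h kK); exists k.
  split.
    apply: (measure_le_setU mL mH mS _ _ Se) => // om h.
    by case: (pselect (S om)) => [|/E h']; [right|left; apply/h'].
  apply: (measure_le_setU mH mL mS _ _ Se) => // om h.
  by case: (pselect (S om)) => [|/E h']; [right|left; apply/h'].
apply/eqP; rewrite eq_le; apply/andP; split; apply/lee_addgt0Pr => e /key[]//.
Qed.

Lemma meet_lim m n :
  P [set om | exists k, meet (lim_arrow_nat (X om)) m n k] =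
  P' [set om | exists k, meet (dual_arrow (X' om)) m n k].
Proof.
have U (T0 : Type) (b : T0 -> nat * nat -> bool) :
    [set om | exists k, meet (b om) m n k] = \bigcup_K [set om | meet_before (b om) m n K].
  apply/seteqP; split => om /= => [[k h]|[K _ [k [_ h]]]]; last by exists k.
  by exists k.+1 => //; exists k.
have I (T0 : Type) (b : T0 -> nat * nat -> bool) :
    {homo (fun K => [set om | meet_before (b om) m n K]) : K K' / (K <= K')%N >-> (K <= K')%O}.
  move=> K K' KK'; apply/subsetPset => om [k [kK h]]; exists k; split => //.
  exact: leq_trans KK'.
have mL K := measurable_meet_before K (fun k => measurable_meet_lim m n k).
have mD K : measurable [set om | meet_before (dual_arrow (X' om)) m n K].
  have := measurable_env_pre indepX' (measurable_meet_before K (fun k => measurable_meet_dual m n k)).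
  by [].
have c1 := @nondecreasing_cvg_mu _ T R P _ mL (bigcup_measurable (fun n _ => mL n)) (I _ _).
have c2 := @nondecreasing_cvg_mu _ T' R P' _ mD (bigcup_measurable (fun n _ => mD n)) (I _ _).
rewrite !U -(cvg_lim _ c1)// -(cvg_lim _ c2)//; congr (lim (_ @ \oo)).
by apply/funext => K /=; exact: meet_before_lim.
Qed.

End Comparison.

End LimitArrows.

(** * Semi-infinite geodesics and coalescence *)

Section UniqueMaximizers.
Context {R : realType}.
Implicit Types (w : site -> R) (x y z u v c : site) (p q r : seq site).

(** [p] lists the points after [x], exactly those whose weights count. Strictness determines the
    choice of [xget] in [geodesic]. *)
Definition strict_max w x p : Prop := path up_right x p /\
  forall q, path up_right x q -> last x q = last x p -> q != p ->
    \sum_(z <- q) w z < \sum_(z <- p) w z.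

Lemma geodesic_strict_max w x p : strict_max w x p -> geodesic w x (last x p) = x :: p.
Proof.
move=> [px pmax].
have lptE : last_passage_time w x (last x p) = \sum_(z <- p) w z.
  rewrite /last_passage_time; apply/le_anti/andP; split.
    apply: ge_sup; first by exists (path_weight w (x :: p)), (x :: p) => //; exists p.
    move=> _ [_ [q [-> qx lq]] <-]; rewrite /path_weight /=.
    by case: (eqVneq q p) => [->//|qp]; rewrite ltW// pmax.
  apply: ub_le_sup; last by exists (x :: p) => //; exists p.
  exists (\sum_(z <- p) w z) => _ [_ [q [-> qx lq]] <-]; rewrite /path_weight /=.
  by case: (eqVneq q p) => [->//|qp]; rewrite ltW// pmax.
rewrite /geodesic; apply: xget_unique; first by split=> //; exists p.
move=> _ [[q [-> qx lq]]]; rewrite lptE /path_weight /= => E.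
by case: (eqVneq q p) => [->//|/(pmax q qx lq)]; rewrite E ltxx.
Qed.

Lemma strict_max_infix w x p q r :
  strict_max w x (p ++ q ++ r) -> strict_max w (last x p) q.
Proof.
rewrite /strict_max !cat_path => -[/and3P[px qx rx] pmax]; split => // q' q'x lq' neq.
have := pmax (p ++ q' ++ r); rewrite !cat_path px q'x lq' rx !last_cat lq' => /(_ isT erefl).
rewrite eqseq_cat// eqxx /=.
have -> : (q' ++ r == q ++ r) = (q' == q).
  apply/eqP/eqP => [E|-> //]; have /eqP := E; rewrite eqseq_cat => [/andP[/eqP//]|].
  by have := congr1 size E; rewrite !size_cat => /addIn.
by rewrite neq => /(_ isT); rewrite !big_cat /= ltrD2l ltrD2r.
Qed.

End UniqueMaximizers.

Section GreedyPaths.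
Context {R : realType}.
Variable w : site -> R.
Implicit Types (x y z u v c : site) (p q r : seq site) (i j k n : nat) (b : site -> bool).

Lemma site_eq x y : x.1 = y.1 -> x.2 = y.2 -> x = y.
Proof. by case: x y => [? ?] [? ?] /= -> ->. Qed.

Lemma up_right_path_sum x p : path up_right x p ->
  (last x p).1 + (last x p).2 = x.1 + x.2 + (size p)%:Z.
Proof.
elim: p x => [|y p IH] x /=; first by rewrite addr0.
by move=> /andP[/orP[]/eqP -> /IH ->]; rewrite /=; lia.
Qed.

Lemma up_right_path_le x p : path up_right x p -> le_pt x (last x p).
Proof.
elim: p x => [|y p IH] x /=; first by rewrite /le_pt !lexx.
by move=> /andP[/orP[]/eqP -> /IH]; rewrite /le_pt /=; lia.
Qed.

Definition site_step b z : site := z + (if b z then e1 else e2).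

Lemma site_step_up_right b z : up_right z (site_step b z).
Proof. by rewrite /up_right /site_step; case: ifP; rewrite eqxx ?orbT. Qed.

Definition arrow_to v z : bool := arrow w z `|v.1 - z.1|%N `|v.2 - z.2|%N.

Definition greedy v z n : seq site := traject (site_step (arrow_to v)) (site_step (arrow_to v) z) n.

Hypothesis w_ge0 : forall z, 0 <= w z.
Hypothesis no_tie : forall c i j, plain w c i.+2 j <> plain w c i.+1 j.+1.

Lemma plain_ge0 c i j : 0 <= plain w c i j.
Proof.
rewrite /plain; have E0 (u : nat * nat) : 0 <= plain_env w c u by case: u => [[|?] [|?]] /=.
move: i j; apply: grow_ind => //.
- by move=> i h; rewrite [grow _ _ _]grow_xaxis addr_ge0.
- by move=> j h; rewrite [grow _ _ _]grow_yaxis addr_ge0.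
- by move=> i j h1 h2; rewrite growSS addr_ge0// le_max h1.
Qed.

Lemma plain_axis c i : plain w c i 0 = 0 /\ plain w c 0 i = 0.
Proof.
rewrite /plain; elim: i => [//|i [IH1 IH2]].
by rewrite grow_xaxis grow_yaxis IH1 IH2 /= addr0.
Qed.

Lemma strict_max_nil z : strict_max w z [::].
Proof.
split=> // q /up_right_path_sum h lq; move: h; rewrite lq.
by case: q {lq} => //= a q; lia.
Qed.

Lemma strict_max_cons z u q : up_right z u -> strict_max w u q ->
  (forall u' q', u' != u -> up_right z u' -> path up_right u' q' -> last u' q' = last u q ->
     w u' + \sum_(x <- q') w x < w u + \sum_(x <- q) w x) ->
  strict_max w z (u :: q).
Proof.
move=> zu [uq qmax] alt; have zuq : path up_right z (u :: q) by rewrite /= zu.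
split => // -[_ /= zE _|u' q' /= /andP[zu' uq'] lq neq].
  by have := up_right_path_sum zuq; rewrite /= -zE; lia.
rewrite !big_cons; case: (eqVneq u' u) => [E|u'u]; last exact: alt.
rewrite E in uq' lq neq *; rewrite ltrD2l; apply: qmax => //.
by apply: contraNneq neq => ->.
Qed.

Lemma greedyS v z n : greedy v z n.+1 =
  site_step (arrow_to v) z :: greedy v (site_step (arrow_to v) z) n.
Proof. by []. Qed.

(** Arrows compare the exact times from the two neighbours to [v], so following them is dynamic
    programming. The maximum is the passage time without the weight of [z], as in [path_weight]. *)
Lemma greedy_strict_max v i j z : z + (i%:Z, j%:Z) = v ->
  [/\ strict_max w z (greedy v z (i + j)), last z (greedy v z (i + j)) = v &
     \sum_(u <- greedy v z (i + j)) w u =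
       Num.max (plain w (v.1 + 1, v.2 + 1) i j.+1) (plain w (v.1 + 1, v.2 + 1) i.+1 j)].
Proof.
set c := (v.1 + 1, v.2 + 1).
move: {-2}(i + j)%N (erefl (i + j)%N) => n; elim: n i j z => [|n IH] i j z.
  move=> /esym/eqP; rewrite addn_eq0 => /andP[/eqP -> /eqP ->] zv.
  have {}zv : z = v by rewrite -zv; apply: site_eq; rewrite /= addr0.
  have [-> _] := plain_axis c 1; have [_ ->] := plain_axis c 1.
  by rewrite /greedy /= big_nil maxxx; split => //; exact: strict_max_nil.
move=> ijn zv.
have [vE1 vE2] : v.1 = z.1 + i%:Z /\ v.2 = z.2 + j%:Z by rewrite -zv.
have aE : arrow_to v z = (plain w c i.+1 j < plain w c i j.+1).
  have d1 : `|v.1 - z.1|%N = i by lia.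
  have d2 : `|v.2 - z.2|%N = j by lia.
  have cE : (z.1 + i.+1%:Z, z.2 + j.+1%:Z) = c by apply: site_eq; rewrite /=; lia.
  by rewrite /arrow_to /arrow d1 d2 cE.
have right k : k.+1 = i ->
    [/\ strict_max w (z + e1) (greedy v (z + e1) n), last (z + e1) (greedy v (z + e1) n) = v &
      w (z + e1) + \sum_(u <- greedy v (z + e1) n) w u = plain w c i j.+1].
  move=> ki; have nE : n = (k + j)%N by lia.
  have zv' : z + e1 + (k%:Z, j%:Z) = v by apply: site_eq; rewrite /=; lia.
  have [h1 h2 h3] := IH k j (z + e1) nE zv'.
  split => //; rewrite h3 -ki [RHS]growSS; congr (w _ + _).
  by apply: site_eq; rewrite /=; lia.
have up l : l.+1 = j ->
    [/\ strict_max w (z + e2) (greedy v (z + e2) n), last (z + e2) (greedy v (z + e2) n) = v &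
      w (z + e2) + \sum_(u <- greedy v (z + e2) n) w u = plain w c i.+1 j].
  move=> lj; have nE : n = (i + l)%N by lia.
  have zv' : z + e2 + (i%:Z, l%:Z) = v by apply: site_eq; rewrite /=; lia.
  have [h1 h2 h3] := IH i l (z + e2) nE zv'.
  split => //; rewrite h3 -lj [RHS]growSS; congr (w _ + _).
  by apply: site_eq; rewrite /=; lia.
have sub u q : strict_max w u q -> forall q', path up_right u q' -> last u q' = last u q ->
    \sum_(z <- q') w z <= \sum_(z <- q) w z.
  by move=> [_ h] q' q'x lq'; case: (eqVneq q' q) => [->//|/(h q' q'x lq')/ltW].
have e12 : z + e1 != z + e2 by rewrite (inj_eq (addrI z)).
rewrite greedyS big_cons; case: ltP aE => h aE.
  have -> : site_step (arrow_to v) z = z + e1 by rewrite /site_step aE.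
  have i0 : (0 < i)%N.
    by case: (posnP i) h => // ->; have [_ ->] := plain_axis c j.+1; rewrite ltNge plain_ge0.
  have [h1 h2 h3] := right i.-1 (prednK i0).
  split => //.
  apply: strict_max_cons => //; first by rewrite /up_right eqxx.
  move=> u' q' u'1 /orP[/eqP u'E|/eqP ->]; first by rewrite u'E eqxx in u'1.
  rewrite h3 h2 => uq lq; apply: le_lt_trans h.
  have j0 : (0 < j)%N.
    by have := up_right_path_le uq; rewrite lq /le_pt vE2 /=; lia.
  have [h1' h2' <-] := up j.-1 (prednK j0).
  by rewrite lerD2l; apply: (sub _ _ h1') => //; rewrite h2'.
(* On the row of [v] an upward arrow would need [plain w c i 1 = 0 = plain w c i.+1 0], an excluded
   tie. *)
have j0 : (0 < j)%N.
  case: (posnP j) h => // j0; have i0 : (0 < i)%N by lia.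
  rewrite j0; have [-> _] := plain_axis c i.+1 => h.
  have : plain w c i 1 = 0 by apply/le_anti; rewrite h plain_ge0.
  case: (posnP i) => [i1|]; first by lia.
  rewrite -(plain_axis c i.+1).1 => {}i0 E.
  by case: (no_tie (c := c) (i := i.-1) (j := 0)); rewrite prednK.
have -> : site_step (arrow_to v) z = z + e2 by rewrite /site_step aE.
have [h1 h2 h3] := up j.-1 (prednK j0).
split => //.
apply: strict_max_cons => //; first by rewrite /up_right eqxx orbT.
move=> u' q' u'1 /orP[/eqP ->|/eqP u'E]; last by rewrite u'E eqxx in u'1.
rewrite h3 h2 => uq lq.
have i0 : (0 < i)%N.
  by have := up_right_path_le uq; rewrite lq /le_pt vE1 /=; lia.
have [h1' h2' E] := right i.-1 (prednK i0).
apply: (@le_lt_trans _ _ (plain w c i j.+1)).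
  by rewrite -E lerD2l; apply: (sub _ _ h1') => //; rewrite h2'.
rewrite lt_neqAle h andbT; apply/eqP => E'.
by case: (no_tie (c := c) (i := i.-1) (j := j)); rewrite prednK.
Qed.

Lemma up_right_path_mem x p z : path up_right x p -> z \in p -> x.1 + x.2 < z.1 + z.2.
Proof.
elim: p x => //= y p IH x /andP[xy yp]; have xy' : x.1 + x.2 < y.1 + y.2.
  by move: xy => /orP[]/eqP -> /=; lia.
rewrite inE => /orP[/eqP -> //|zp]; apply: lt_trans xy' _; exact: IH.
Qed.

Lemma greedyD v z n k : greedy v z (n + k) =
  greedy v z n ++ greedy v (iter n (site_step (arrow_to v)) z) k.
Proof.
elim: n z => [//|n IH] z; rewrite addSn !greedyS IH /=; congr (_ :: (_ ++ greedy v _ k)).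
by rewrite -iterSr.
Qed.

Definition ray x k : site := iter k (site_step (lim_arrow w)) x.

Lemma raySr x k : ray x k.+1 = ray (site_step (lim_arrow w) x) k.
Proof. exact: iterSr. Qed.

Lemma rayD x k n : ray (ray x k) n = ray x (k + n).
Proof. by rewrite /ray -iterD addnC. Qed.

Lemma ray_step x k : up_right (ray x k) (ray x k.+1).
Proof. exact: site_step_up_right. Qed.

Lemma ray_sum x k : (ray x k).1 + (ray x k).2 = x.1 + x.2 + k%:Z.
Proof.
elim: k => [|k IH]; first by rewrite addr0.
rewrite /ray iterS -/(ray x k) /site_step; case: ifP => _ /=; lia.
Qed.

Lemma greedy_ray v x n : (forall i, (i < n)%N -> arrow_to v (ray x i) = lim_arrow w (ray x i)) ->
  greedy v x n = [seq ray x i.+1 | i <- iota 0 n] /\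
  iter n (site_step (arrow_to v)) x = ray x n.
Proof.
elim: n x => [//|n IH] x h; have E : site_step (arrow_to v) x = site_step (lim_arrow w) x.
  by rewrite /site_step (h 0%N).
have [|h1 h2] := IH (site_step (lim_arrow w) x).
  by move=> i i_n; rewrite -raySr h.
rewrite greedyS iterSr E h1 h2 -raySr; split => //=.
by congr (_ :: _); rewrite (iotaDl 1 0 n) -map_comp; apply: eq_map => i /=; rewrite -raySr.
Qed.

Lemma last_ray x n : last x [seq ray x i.+1 | i <- iota 0 n] = ray x n.
Proof.
case: n => [//|n]; rewrite -{1}[n.+1]addn1 iotaD map_cat last_cat /=.
by rewrite add0n.
Qed.

Hypothesis arrow_cvg : forall z, exists k N, forall i j, cone k N i j ->
  arrow w z i j = lim_arrow w z.

(** A translation changes [|a - b|] by at most [S]; a cone twice as narrow, far from its tip, has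
    room for this. *)
Lemma cone_translate (a b k N S : nat) (s1 s2 : int) : (`|s1| + `|s2| <= S)%N ->
  (((a - b) + (b - a)) * (2 * k.+1) < a)%N -> (6 * (k.+1 * S.+1 + N) <= a + b)%N ->
  [/\ s1 <= a%:Z, s2 <= b%:Z & cone k N `|a%:Z - s1|%N `|b%:Z - s2|%N].
Proof.
move=> sS; set D := ((a - b) + (b - a))%N => Da ab.
have Sk : (k.+1 * S.+1 = S * k + S + k + 1)%N by rewrite mulSn mulnS mulnC; lia.
have Dk : (D * (2 * k.+1) = 2 * (D * k) + 2 * D)%N by rewrite mulnCA mulnS; lia.
rewrite Sk in ab; rewrite Dk in Da.
have s1a : s1 <= a%:Z by move: Da; rewrite /D; move: (D * k)%N (S * k)%N ab; lia.
have s2b : s2 <= b%:Z by move: Da; rewrite /D; move: (D * k)%N (S * k)%N ab; lia.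
split => //.
have E1 : (a + b <= `|a%:Z - s1| + `|b%:Z - s2| + S)%N by lia.
have E2 : ((`|a%:Z - s1| - `|b%:Z - s2|) + (`|b%:Z - s2| - `|a%:Z - s1|) <= D + S)%N.
  by rewrite /D; lia.
rewrite /cone; move: E1 E2; set i := `|_|%N; set j := `|_|%N => E1 E2.
apply/andP; split; first by move: (S * k)%N ab; lia.
apply: leq_trans (leq_mul E2 (leqnn k)) _; rewrite mulnDl.
by move: (S * k)%N (D * k)%N ab Da; lia.
Qed.

Lemma diagonal_cone (y : nat -> site) k N (s : site) : to_diagonal_infinity (R := R) y ->
  \forall n \near \oo, [/\ s.1 <= (y n).1, s.2 <= (y n).2 &
    cone k N `|(y n).1 - s.1|%N `|(y n).2 - s.2|%N].
Proof.
move=> [y0 yoo y1]; pose S := (`|s.1| + `|s.2|)%N.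
have d0 : 0 < (2 * k.+1)%:R^-1 :> R by rewrite invr_gt0 ltr0n.
have /cvgrPdist_lt /(_ _ d0) near1 := y1.
have /cvgryPge /(_ (6 * (k.+1 * S.+1 + N))%:R) near2 := yoo.
near=> n.
have : 6 * (k.+1 * S.+1 + N)%:R <= (`|(y n).1| + `|(y n).2|)%:~R :> R.
  by rewrite -natrM; near: n.
have : `|1 - (y n).2%:~R / (y n).1%:~R| < (2 * k.+1)%:R^-1 :> R by near: n.
have /andP := y0 n; case: (y n) => -[a|?] [b|?] [] //= _ _ h1 h2.
  apply: (@cone_translate a b k N S) => //; last first.
    by move: h2; rewrite (_ : `|a%:Z| + `|b%:Z| = (a + b)%N%:Z)// -pmulrn -natrM ler_nat.
  have a0 : (0 < a)%N.
    (* For [a = 0] the quotient is 0 by convention, at distance 1 from its limit. *)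
    case: a h1 {h2} => // h1; exfalso; move: h1; rewrite invr0 mulr0 subr0 normr1.
    by rewrite ltNge invf_le1 ?ltr0n// ler1n.
  have aR : 0 < a%:R :> R by rewrite ltr0n.
  move: h1; rewrite -(ltr_pM2r aR) -[X in _ * X < _](gtr0_norm aR) -normrM mulrBl mul1r.
  rewrite divfK ?gt_eqF// ltr_pdivlMl ?ltr0n// => h1.
  rewrite -(ltr_nat R) natrM mulrC; apply: le_lt_trans h1; rewrite ler_wpM2l// ?ler0n//.
  case: (leqP a b) => ab.
    by rewrite (eqP (_ : a - b == 0)%N) ?subn_eq0// add0n natrB// distrC ler_norm.
  by rewrite (eqP (_ : b - a == 0)%N) ?subn_eq0 1?ltnW// addn0 natrB 1?ltnW// ler_norm.
Unshelve. all: by end_near.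
Qed.

Lemma diagonal_arrows x (y : nat -> site) n : to_diagonal_infinity (R := R) y ->
  \forall N \near \oo, [/\ n%:Z <= (y N).1, n%:Z <= (y N).2 &
    forall i, (i < n)%N -> arrow_to (x + y N) (ray x i) = lim_arrow w (ray x i)].
Proof.
move=> yd; have near0 := diagonal_cone 0 0 (n%:Z, n%:Z) yd.
have : \forall N \near \oo, forall i, (i < n)%N ->
    arrow_to (x + y N) (ray x i) = lim_arrow w (ray x i).
  elim: n {near0} => [|n IH]; first by near=> N.
  have [k [N0 H]] := arrow_cvg (ray x n).
  pose s := ray x n - x; have near1 := diagonal_cone k N0 s yd.
  near=> N => i; rewrite ltnS leq_eqVlt => /orP[/eqP ->|]; last first.
    by move: i; near: N.
  rewrite /arrow_to H//.
  have : cone k N0 `|(y N).1 - s.1|%N `|(y N).2 - s.2|%N.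
    by near: N; apply: filterS near1 => N [].
  have -> : (y N).1 - s.1 = (x + y N).1 - (ray x n).1 by rewrite /s /=; lia.
  by have -> : (y N).2 - s.2 = (x + y N).2 - (ray x n).2 by rewrite /s /=; lia.
move=> near1; near=> N; split; last by near: N.
- by near: N; apply: filterS near0 => N [].
- by near: N; apply: filterS near0 => N [].
Unshelve. all: by end_near.
Qed.

Lemma diagonal_sequence : to_diagonal_infinity (R := R) (fun n => (n%:Z, n%:Z)).
Proof.
split => //=.
  apply/cvgryPge => A; near=> n.
  have : A <= n%:R by near: n; exact: nbhs_infty_ger.
  rewrite (_ : `|n%:Z| + `|n%:Z| = (n + n)%N%:Z)// -pmulrn natrD => An.
  by apply: (le_trans An); rewrite lerDl.
apply: cvg_near_cst; near=> n.
by rewrite divff// -pmulrn pnatr_eq0 -lt0n; near: n; exists 1%N.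
Unshelve. all: by end_near.
Qed.

Lemma greedy_to x v n : x.1 <= v.1 -> x.2 <= v.2 -> n%:Z = (v.1 - x.1) + (v.2 - x.2) ->
  strict_max w x (greedy v x n) /\ last x (greedy v x n) = v.
Proof.
move=> h1 h2 nE; pose i := `|v.1 - x.1|%N; pose j := `|v.2 - x.2|%N.
have xv : x + (i%:Z, j%:Z) = v by apply: site_eq; rewrite /i /j /=; lia.
have -> : n = (i + j)%N by rewrite /i /j; lia.
by have [? ? _] := greedy_strict_max xv.
Qed.

(** The greedy path to a far diagonal target starts with [k + n] steps of the ray, and pieces of
    strict maximizers are strict maximizers. *)
Lemma geodesic_ray x k n :
  geodesic w (ray x k) (ray x (k + n)) = [seq ray x i | i <- iota k n.+1].
Proof.
have [N _ /(_ N (leqnn N)) /= [h1 h2 H]] := diagonal_arrows x (k + n) diagonal_sequence.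
set v := x + _ in H; set r := (N + N - (k + n))%N.
have [M _] : strict_max w x (greedy v x (k + n + r)) /\ last x (greedy v x (k + n + r)) = v.
  by apply: greedy_to; rewrite /v /r /=; lia.
have [Hk Ek] := greedy_ray (fun i (ik : (i < k)%N) => H i (ltn_addr n ik)).
have Hn i : (i < n)%N -> arrow_to v (ray (ray x k) i) = lim_arrow w (ray (ray x k) i).
  by move=> i_n; rewrite rayD H// ltn_add2l.
have [Gn _] := greedy_ray Hn.
move: M; rewrite -addnA !greedyD => /strict_max_infix.
have -> : last x (greedy v x k) = ray x k.
  by rewrite Hk last_ray.
rewrite Ek => /geodesic_strict_max.
have -> : last (ray x k) (greedy v (ray x k) n) = ray x (k + n).
  by rewrite Gn last_ray rayD.
move=> ->; rewrite Gn /=; congr (_ :: _).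
by rewrite -[k.+1]addn0 iotaDl -map_comp; apply: eq_map => i;
  exact: (etrans (rayD x k i.+1) (congr1 (ray x) (addnS k i))).
Qed.

Lemma ray_diagonal_geodesic x : is_diagonal_geodesic w x (ray x).
Proof.
split => //.
- exact: ray_step.
- by move=> k n kn; rewrite -{1}(subnKC (ltnW kn)) geodesic_ray.
(* All points of [K] are at distance less than [B] from [x], so [K] is visited only during the first
   [B] steps, which the geodesic and the ray share. *)
move=> y yd K; pose B := (\max_(z <- K) (`|z.1 - x.1| + `|z.2 - x.2|)).+1.
have zB z : z \in K -> (`|(z.1 - x.1)%R| + `|(z.2 - x.2)%R| < B)%N.
  move=> zK; rewrite /B ltnS.
  exact: (@leq_bigmax_seq _ (enum_fset K) xpredT (fun z : site => `|(z.1 - x.1)%R| + `|(z.2 - x.2)%R|)%N z zK isT).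
have near1 := diagonal_arrows x B yd.
apply: filterS near1 => n [h1 h2 H].
move=> z zK; set v := x + y n in H *; pose r := (`|(y n).1| + `|(y n).2| - B)%N.
have [M vE] : strict_max w x (greedy v x (B + r)) /\ last x (greedy v x (B + r)) = v.
  by apply: greedy_to; rewrite /v /r /=; lia.
have [HB EB] := greedy_ray H.
have := geodesic_strict_max M; rewrite vE => ->.
have [path_g _] := M; move: path_g; rewrite greedyD cat_path => /andP[_].
have -> : last x (greedy v x B) = ray x B.
  by rewrite HB last_ray.
rewrite EB => path_r; rewrite inE mem_cat; split.
  move=> /or3P[/eqP -> | |zr]; first by exists 0%N.
    by rewrite HB => /mapP[i _ ->]; exists i.+1.
  have := up_right_path_mem path_r zr; rewrite ray_sum; have := zB z zK; lia.
move=> [[|i] _ E]; first by rewrite -E eqxx.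
apply/orP; right; apply/orP; left; rewrite HB -E; apply/mapP; exists i => //.
rewrite mem_iota /= add0n; have := zB z zK; have := ray_sum x i.+1; rewrite E; lia.
Qed.

Lemma up_right_sum (g : nat -> site) k : (forall k, up_right (g k) (g k.+1)) ->
  (g k).1 + (g k).2 = (g 0%N).1 + (g 0%N).2 + k%:Z.
Proof.
move=> gS; elim: k => [|k IH]; first by rewrite addr0.
by case/orP: (gS k) => /eqP ->; rewrite /=; lia.
Qed.

(** For uniqueness, the convergence property along the diagonal sequence, tested on one point of a
    competing path, puts that point on the ray; its antidiagonal gives the index. *)
Lemma diagonal_geodesicE x : diagonal_geodesic w x = ray x.
Proof.
apply: xget_unique; first exact: ray_diagonal_geodesic.
move=> h [h0 hS _ hd]; have [_ _ _ rd] := ray_diagonal_geodesic x.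
apply/funext => k; pose K := [fset h k]%fset.
have hK : h k \in K by rewrite in_fset1.
have near1 := hd _ diagonal_sequence K; have near2 := rd _ diagonal_sequence K.
have [n [/(_ _ hK) [_ h1] /(_ _ hK) [h2 _]]] := filter_ex (filterI near1 near2).
have [l _ E] := h2 (h1 (ex_intro2 _ _ k I erefl)).
have := up_right_sum k hS; rewrite -E h0 ray_sum => /eqP.
by rewrite (inj_eq (addrI _)) eqz_nat => /eqP <-.
Qed.

Lemma is_concatenation_ray x c :
  is_concatenation (diagonal_geodesic w x) (geodesic w x c) (diagonal_geodesic w c) <->
  exists k, ray x k = c.
Proof.
rewrite !diagonal_geodesicE; split=> -[k].
  by move=> [_ /(_ 0%N)]; rewrite addn0 => cE; exists k; rewrite -cE.
move=> <-; exists k; split; last by move=> i; rewrite rayD.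
by have := geodesic_ray x 0 k.
Qed.

Lemma meeting_point_ray (m : int) c :
  is_meeting_point w (m, 0) (0, m) c <->
  exists k, ray (m, 0) k = c /\ ray (0, m) k = c.
Proof.
rewrite /is_meeting_point !is_concatenation_ray; split.
  move=> [[k kE] [l lE]]; exists k; split => //; rewrite -lE; congr ray.
  have := ray_sum (m, 0) k; have := ray_sum (0, m) l; rewrite kE lE /=; lia.
by move=> [k [k1 k2]]; split; exists k.
Qed.

Lemma ray_le x k n : (k <= n)%N -> le_pt (ray x k) (ray x n).
Proof.
move=> /subnKC <-; rewrite -rayD; elim: (n - k)%N => [|l IH]; first by rewrite /le_pt !lexx.
have := IH; have := site_step_up_right (lim_arrow w) (ray (ray x k) l).
rewrite [ray _ l.+1]iterS -/(ray _ l) => /orP[]/eqP ->; rewrite /le_pt /=; lia.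
Qed.

(** The earliest common point of the two rays is also the lowest. Without a common point the time is
    [+oo] and both sides fail. *)
Lemma coalescence_time_lt (m n : int) :
  (coalescence_time w m < n%:E)%E <->
  exists k, ray (m, 0) k = ray (0, m) k /\ (ray (m, 0) k).2 < n.
Proof.
pose C := [set (c : site).2%:E | c in is_coalescence_point w (m, 0) (0, m)].
have [[k0 k0E]|none] := pselect (exists k, ray (m, 0) k = ray (0, m) k); last first.
  have C0 : C = set0.
    rewrite -subset0 => e [c [/meeting_point_ray[k [k1 k2]] _] _].
    by apply: none; exists k; rewrite k1 k2.
  have -> : coalescence_time w m = +oo%E.
    by rewrite /coalescence_time -/C C0; apply: xgetPN => e [].
  split=> [|[k [k1 _]]]; first by [].
  by exfalso; apply: none; exists k.
have exk : exists k, ray (m, 0) k == ray (0, m) k by exists k0; apply/eqP.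
case: (ex_minnP exk) => k /eqP kE kmin.
have cP : is_coalescence_point w (m, 0) (0, m) (ray (m, 0) k).
  split; first by apply/meeting_point_ray; exists k.
  move=> c' /meeting_point_ray[l [l1 l2]]; rewrite -l1; apply: ray_le.
  by apply: kmin; rewrite l1 l2.
have CE : coalescence_time w m = (ray (m, 0) k).2%:E.
  apply: xget_unique; first by exists (ray (m, 0) k).
  move=> _ [c [cm cmin] <-]; congr (_ _); have := cmin _ cP.1; have := cP.2 _ cm.
  rewrite /le_pt; lia.
rewrite CE; split; first by rewrite lte_fin => h; exists k.
move=> [l [lE ln]]; rewrite lte_fin; apply: le_lt_trans ln.
by have /andP[] := ray_le (m, 0) (kmin l (introT eqP lE)).
Qed.

End GreedyPaths.

(** * Exit points and dual paths *)

Section DualPaths.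
Implicit Types (b : nat * nat -> bool) (z : nat * nat) (i j k l m n x : nat).

(* Last axis point of the path ending at [(i, j)] whose backward steps are
   horizontal exactly when the dual arrow crossed is horizontal. *)
Fixpoint exit_site b i : nat -> nat * nat :=
  match i with
  | 0 => fun j => (0, j)
  | i'.+1 => fix column j :=
      if j is j'.+1 then if b (i', j') then exit_site b i' j else column j' else (i'.+1, 0)
  end%N.

Lemma exit_site0 b i : exit_site b i 0 = (i, 0%N). Proof. by case: i. Qed.

Lemma exit_siteSS b i j : exit_site b i.+1 j.+1 =
  if b (i, j) then exit_site b i j.+1 else exit_site b i.+1 j.
Proof. by []. Qed.

Lemma exit_site_axis b i j : ((exit_site b i j).1 == 0%N) || ((exit_site b i j).2 == 0%N).
Proof.
move: i j; apply: grow_ind => //= i j h1 h2.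
by case: ifP.
Qed.

Definition transpose b z : bool := ~~ b (z.2, z.1).

Lemma walk_transpose b z k :
  walk (transpose b) (z.2, z.1) k = ((walk b z k).2, (walk b z k).1).
Proof.
elim: k => [//|k IH]; rewrite !walkS IH /step /transpose /=.
by rewrite -surjective_pairing; case: (b _).
Qed.

Lemma exit_site_transpose b i j :
  exit_site (transpose b) j i = ((exit_site b i j).2, (exit_site b i j).1).
Proof.
move: i j; apply: grow_ind.
- by [].
- by move=> i _; rewrite exit_site0.
- by move=> j _; rewrite exit_site0.
- by move=> i j h1 h2; rewrite !exit_siteSS h1 h2 /transpose /=; case: (b _).
Qed.

Lemma walk_le b z k l : (k <= l)%N ->
  ((walk b z k).1 <= (walk b z l).1)%N /\ ((walk b z k).2 <= (walk b z l).2)%N.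
Proof.
move=> /subnKC <-; elim: (l - k)%N => [|d [h1 h2]]; first by rewrite addn0.
by rewrite addnS walkS /step; case: ifP => _ /=; split => //; exact: ltnW.
Qed.

Section sides.
Variables (b : nat * nat -> bool) (m : nat).

(** The dual site [(i, j)] stands for the point [(i + 1/2, j + 1/2)], which is why one inequality is
    weak and the other strict. Dual steps cross only edges that the backward primal paths omit. *)
Definition left_of_upper z : Prop :=
  exists k, (z.1 <= (walk b (0%N, m) k).1)%N /\ ((walk b (0%N, m) k).2 < z.2)%N.

Definition right_of_lower z : Prop :=
  exists k, (z.2 <= (walk b (m, 0%N) k).2)%N /\ ((walk b (m, 0%N) k).1 < z.1)%N.

(** In column [i] the walk could climb past row [j] only through [(i, j)], where it turns right; so
    it leaves the column at height at most [j]. *)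
Lemma left_of_upper_horizontal i j : b (i, j) ->
  left_of_upper (i, j.+1) -> left_of_upper (i.+1, j.+1).
Proof.
move=> bij [k /= [ik kj]]; move: {2}(j - _)%N (leqnn (j - (walk b (0%N, m) k).2)) => d.
elim: d k ik kj => [|d IH] k ik kj dk.
all: case: (ltnP i (walk b (0%N, m) k).1) => ki; first by exists k.
all: have E1 : (walk b (0%N, m) k).1 = i by apply/eqP; rewrite eqn_leq ki.
all: case: (boolP (b (walk b (0%N, m) k))) => bk;
  [by exists k.+1; rewrite walkS /step bk /= E1|].
  have E2 : (walk b (0%N, m) k).2 = j by lia.
  by move: bk; rewrite (surjective_pairing (walk _ _ _)) E1 E2 bij.
have E2 : ((walk b (0%N, m) k).2 < j)%N.
  rewrite ltn_neqAle -ltnS kj andbT; apply: contraNneq bk => E2.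
  by rewrite (surjective_pairing (walk _ _ _)) E1 E2.
apply: (IH k.+1); rewrite walkS /step (negbTE bk) /= ?E1//; lia.
Qed.

(** Follow the walk backwards to a vertical step or to its entry into column [i.+1]; the entry is
    not along row [j], where the arrow is vertical. *)
Lemma left_of_upper_vertical i j : ~~ b (i, j) ->
  left_of_upper (i.+1, j.+1) -> left_of_upper (i.+1, j).
Proof.
move=> bij [k /=]; elim: k => [[]//|k IH]; rewrite walkS /step.
case: (boolP (b (walk b (0%N, m) k))) => bk /= [ik kj]; last by exists k => /=; split; lia.
case: (ltnP i (walk b (0%N, m) k).1) => ki; first exact: IH.
have E1 : (walk b (0%N, m) k).1 = i by lia.
exists k.+1; rewrite walkS /step bk /= E1; split => //.
rewrite ltn_neqAle -ltnS kj andbT; apply: contraNneq bij => <-.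
by rewrite -E1 -surjective_pairing.
Qed.

(* A primal path never crosses a dual path. *)
Lemma left_exit i j : left_of_upper (i, j) <-> (m < (exit_site b i j).2)%N.
Proof.
move: i j.
have L0 j : left_of_upper (0%N, j) <-> (m < j)%N.
  split=> [[k /= [_ kj]]|mj]; last by exists 0%N.
  by apply: leq_ltn_trans kj; have [_] := walk_le b (0%N, m) (leq0n k).
apply: grow_ind.
- exact: L0.
- by move=> i _ /=; split=> [[k []]|].
- by move=> j _; exact: L0.
move=> i j h1 h2; rewrite exit_siteSS; case: ifPn => bij.
  rewrite -h1; split; last exact: left_of_upper_horizontal.
  by move=> [k /= [ik kj]]; exists k; split=> //; exact: ltnW.
rewrite -h2; split; first exact: left_of_upper_vertical.
by move=> [k /= [ik kj]]; exists k; split=> //; exact: ltnW.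
Qed.

End sides.

Lemma right_transpose b m i j :
  right_of_lower b m (i, j) <-> left_of_upper (transpose b) m (j, i).
Proof.
have E k := walk_transpose b (m, 0%N) k; rewrite /= in E.
by split=> -[k /= h]; exists k; move: h; rewrite E.
Qed.

Lemma right_exit b m i j : right_of_lower b m (i, j) <-> (m < (exit_site b i j).1)%N.
Proof. by rewrite right_transpose left_exit exit_site_transpose. Qed.

Section meeting.
Variables (b : nat * nat -> bool) (m n : nat).
Hypotheses (m0 : (0 < m)%N) (mn : (m < n)%N).

Let up := walk b (0%N, m).
Let low := walk b (m, 0%N).

Let low_sum k : ((low k).1 + (low k).2 = m + k)%N.
Proof. by rewrite /low walk_sum addn0. Qed.

Let up_sum k : ((up k).1 + (up k).2 = m + k)%N.
Proof. by rewrite /up walk_sum add0n. Qed.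

(** After the meeting there is one common walk; it is followed until it reaches column [x] below
    height [n], or height [n] before column [x]. *)
Lemma meet_side : (exists k, meet b m n k) ->
  forall x, left_of_upper b m (x, n) \/ right_of_lower b m (x, n).
Proof.
move=> [k /andP[/eqP E kn]] x.
rewrite -/(low k) -/(up k) in E kn *.
have : (x - (low k).1 + (n - (low k).2) <= x + n)%N by lia.
move: (x + n)%N => d; elim: d k E kn => [|d IH] k E kn hd; first by lia.
case: (leqP x (low k).1) => xk; first by left; exists k; rewrite -/(up k) -E.
have E' : low k.+1 = up k.+1 by rewrite /low /up !walkS -/(low k) -/(up k) E.
have S : low k.+1 = step b (low k) by [].
case: (ltnP (low k.+1).2 n) => kn'; last first.
  right; exists k.+1; rewrite -/(low k.+1); split => //.
  by move: kn'; rewrite S /step; case: ifP => _ //= h; lia.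
apply: (IH k.+1) => //; move: hd kn'; rewrite S /step; case: ifP => _ /=; lia.
Qed.

Lemma walk_crossing K : (forall k, (k <= K)%N -> low k <> up k) ->
  forall k, (k <= K)%N -> ((up k).1 < (low k).1)%N.
Proof.
move=> neq; elim=> [//|k IH] kK; have {}IH := IH (ltnW kK).
have s1 := low_sum k.+1; have s2 := up_sum k.+1.
rewrite ltn_neqAle; apply/andP; split.
  apply/eqP => E; apply: (neq _ kK); rewrite [RHS]surjective_pairing [LHS]surjective_pairing.
  congr (_, _); first by rewrite E.
  by apply: (@addnI (low k.+1).1); rewrite s1 -E s2.
have -> : low k.+1 = step b (low k) by [].
have -> : up k.+1 = step b (up k) by [].
rewrite /step; move: IH; move: (low k) (up k) => u v h.
by case: ifP => _; case: ifP => _ /=; lia.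
Qed.

(** Otherwise the walks are still apart when the upper one climbs to height [n], and the site just
    to the right of this crossing lies between them. *)
Lemma side_meet : (exists k, (n <= (up k).2)%N) ->
  (forall x, (0 < x)%N -> left_of_upper b m (x, n) \/ right_of_lower b m (x, n)) ->
  exists k, meet b m n k.
Proof.
move=> reach sides; case: (ex_minnP reach) => -[|K] Kn Kmin.
  by move: Kn; rewrite leqNgt mn.
have upK k : ((up k).2 < n)%N -> (k <= K)%N.
  move=> kn; rewrite leqNgt; apply/negP => Kk.
  have [_] := walk_le b (0%N, m) Kk; rewrite -/(up _) -/(up _) => h.
  by move: kn; rewrite ltnNge (leq_trans Kn h).
have Klt : ((up K).2 < n)%N.
  by rewrite ltnNge; apply/negP => /Kmin; rewrite ltnn.
apply: contrapT => nomeet.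
have neq k : (k <= K)%N -> low k <> up k.
  move=> kK E; apply: nomeet; exists k; rewrite /meet -/(low k) -/(up k) E eqxx /=.
  by apply: leq_ltn_trans Klt; have [_] := walk_le b (0%N, m) kK.
have cross := walk_crossing neq.
case: (sides (up K).1.+1 isT) => -[k /=]; rewrite -/(up k) -/(low k) => -[h1 h2].
  have := walk_le b (0%N, m) (upK _ h2); rewrite -/(up _) -/(up _) => -[]; lia.
case: (leqP k K) => kK.
  have [_ h3] := walk_le b (0%N, m) kK; rewrite -/(up _) -/(up _) in h3.
  have s1 := low_sum k; have s2 := up_sum k.
  have := cross k kK; lia.
have := walk_le b (m, 0%N) (ltnW kK); rewrite -/(low _) -/(low _) => -[].
have := cross K (leqnn K); lia.
Qed.

End meeting.

End DualPaths.

Section ExitPoints.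
Context {R : realType}.
Variable w : site -> R.
Implicit Types (i j m n : nat) (p q : seq site) (u x z : site).

Definition quadrant (z : nat * nat) : R := w (z.1%:Z, z.2%:Z).

Hypothesis no_tie : forall i j, grow quadrant i.+1 j <> grow quadrant i j.+1.

Lemma strict_max_rcons x p u : strict_max w x p -> up_right (last x p) u ->
  (forall q, path up_right x q -> last x q != last x p -> up_right (last x q) u ->
     \sum_(z <- q) w z < \sum_(z <- p) w z) ->
  strict_max w x (rcons p u).
Proof.
move=> [px pmax] pu alt; have pux : path up_right x (rcons p u) by rewrite rcons_path px.
split => // q; case: (lastP q) => [_ xE _|{}q u'].
  by have := up_right_path_sum pux; rewrite -xE size_rcons /=; lia.
have sum_rcons r v : \sum_(z <- rcons r v) w z = \sum_(z <- r) w z + w v.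
  by rewrite -cats1 big_cat big_seq1.
rewrite rcons_path !last_rcons => /andP[qx qu] u'u; rewrite u'u in qu *.
rewrite !sum_rcons ltrD2r => neq.
case: (eqVneq (last x q) (last x p)) => E; last exact: alt.
by apply: pmax => //; apply: contraNneq neq => ->.
Qed.

(** The paths are extended at their far end, following the growth recursion: the last steps are the
    dual arrows, from which [exit_site] computes the exit point. *)
Lemma path_from_origin i j : exists p,
  [/\ strict_max w 0 p, last 0 p = (i%:Z, j%:Z), \sum_(z <- p) w z = grow quadrant i j &
   last 0 [seq z <- (0 : site) :: p | on_axis z] =
     ((exit_site (dual_arrow quadrant) i j).1%:Z, (exit_site (dual_arrow quadrant) i j).2%:Z)].
Proof.
have sum_rcons r v : \sum_(z <- rcons r v) w z = \sum_(z <- r) w z + w v.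
  by rewrite -cats1 big_cat big_seq1.
have last_axis (p : seq site) u : last 0 [seq z <- (0 : site) :: rcons p u | on_axis z] =
    if on_axis u then u else last 0 [seq z <- (0 : site) :: p | on_axis z].
  by rewrite -rcons_cons filter_rcons; case: ifP => //; rewrite last_rcons.
have pred (q : seq site) u : path up_right 0 q -> up_right (last 0 q) u ->
    [/\ 0 <= (last 0 q).1, 0 <= (last 0 q).2 & last 0 q = u - e1 \/ last 0 q = u - e2].
  move=> q0 /orP qu; have /andP[h1 h2] := up_right_path_le q0; split => //.
  by case: qu => /eqP ->; rewrite addrK; [left|right].
have sub (q p : seq site) : strict_max w 0 p -> path up_right 0 q -> last 0 q = last 0 p ->
    \sum_(z <- q) w z <= \sum_(z <- p) w z.
  by move=> [_ h] q0 lq; case: (eqVneq q p) => [->//|/(h q q0 lq)/ltW].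
move: i j; apply: grow_ind.
- exists [::]; rewrite big_nil; split => //; exact: strict_max_nil.
- move=> i [p [h1 h2 h3 h4]]; exists (rcons p (i.+1%:Z, 0)); split.
  + apply: strict_max_rcons => //; first by rewrite h2 /up_right; apply/orP; left; apply/eqP/site_eq; rewrite /=; lia.
    move=> q q0 neq /(pred _ _ q0)[_ q2 [] E]; rewrite E in neq q2.
      by case/eqP: neq; rewrite h2; apply: site_eq; rewrite /=; lia.
    by move: q2; rewrite /=; lia.
  + by rewrite last_rcons.
  + by rewrite sum_rcons h3 [RHS]grow_xaxis.
  + by rewrite last_axis /on_axis /= ?orbT.
- move=> j [p [h1 h2 h3 h4]]; exists (rcons p (0, j.+1%:Z)); split.
  + apply: strict_max_rcons => //; first by rewrite h2 /up_right; apply/orP; right; apply/eqP/site_eq; rewrite /=; lia.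
    move=> q q0 neq /(pred _ _ q0)[q1 _ [] E]; rewrite E in neq q1.
      by move: q1; rewrite /=; lia.
    by case/eqP: neq; rewrite h2; apply: site_eq; rewrite /=; lia.
  + by rewrite last_rcons.
  + by rewrite sum_rcons h3 [RHS]grow_yaxis.
  + by rewrite last_axis /on_axis /=.
move=> i j [p [h1 h2 h3 h4]] [p' [h1' h2' h3' h4']].
set u : site := (i.+1%:Z, j.+1%:Z).
have uE1 : u - e1 = (i%:Z, j.+1%:Z) by apply: site_eq; rewrite /u /=; lia.
have uE2 : u - e2 = (i.+1%:Z, j%:Z) by apply: site_eq; rewrite /u /=; lia.
have u_off : on_axis u = false by [].
have up1 : up_right (u - e1) u by rewrite /up_right subrK eqxx.
have up2 : up_right (u - e2) u by rewrite /up_right subrK eqxx orbT.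
have wu r : r + w u = quadrant (i.+1, j.+1) + r by rewrite addrC.
have bE : dual_arrow quadrant (i, j) = (grow quadrant i.+1 j < grow quadrant i j.+1) by [].
rewrite exit_siteSS bE {bE}.
case: (ltP (grow quadrant i.+1 j) (grow quadrant i j.+1)) => [lt|].
  exists (rcons p u); split; [|by rewrite last_rcons| |by rewrite last_axis u_off].
    apply: strict_max_rcons => //; first by rewrite h2 -uE1.
    move=> q q0 neq /(pred _ _ q0)[_ _ [] E]; first by rewrite E h2 uE1 eqxx in neq.
    by rewrite h3; apply: le_lt_trans lt; rewrite -h3'; apply: sub => //; rewrite h2' -uE2.
  by rewrite sum_rcons h3 wu [RHS]growSS max_l// ltW.
rewrite le_eqVlt => /orP[/eqP/esym/no_tie//|lt].
exists (rcons p' u); split; [|by rewrite last_rcons| |by rewrite last_axis u_off].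
  apply: strict_max_rcons => //; first by rewrite h2' -uE2.
  move=> q q0 neq /(pred _ _ q0)[_ _ [] E]; last by rewrite E h2' uE2 eqxx in neq.
  by rewrite h3'; apply: le_lt_trans lt; rewrite -h3; apply: sub => //; rewrite h2 -uE1.
by rewrite sum_rcons h3' wu [RHS]growSS max_r// ltW.
Qed.

Lemma exit_pointE i j : exit_point w (i%:Z, j%:Z) =
  ((exit_site (dual_arrow quadrant) i j).1%:Z, (exit_site (dual_arrow quadrant) i j).2%:Z).
Proof.
have [p [h1 h2 h3 <-]] := path_from_origin i j.
by rewrite /exit_point -h2 geodesic_strict_max.
Qed.

Lemma exit_coordinate_window m i j :
  (- m%:Z <= exit_coordinate w (i%:Z, j%:Z) <= m%:Z) <->
  ~ (left_of_upper (dual_arrow quadrant) m (i, j) \/ right_of_lower (dual_arrow quadrant) m (i, j)).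
Proof.
rewrite left_exit right_exit /exit_coordinate exit_pointE.
have := exit_site_axis (dual_arrow quadrant) i j.
case: (exit_site _ i j) => a c /=; case: c => [|c] /=; lia.
Qed.

Lemma exit_measure_eq0 m n : exit_measure w n%:Z [set z : int | - m%:Z <= z <= m%:Z] = 0%E <->
  forall x : nat, (0 < x)%N -> left_of_upper (dual_arrow quadrant) m (x, n) \/
                         right_of_lower (dual_arrow quadrant) m (x, n).
Proof.
split=> [E x x0|H].
  apply: contrapT => /exit_coordinate_window hz.
  pose z := exit_coordinate w (x%:Z, n%:Z).
  have : (1 <= exit_measure w n%:Z [set z : int | (- m%:Z <= z <= m%:Z)%R])%E.
    apply: esum_ge; exists [set z]; first by split; [exact: finite_set1|move=> _ ->].
    rewrite fsbig_set1 /exit_indicator asboolT//; exists x%:Z => //; lia.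
  by rewrite E leNgt lte01.
apply: esum1 => z hz; rewrite /exit_indicator asboolF// => -[x x1 zE].
have /exit_coordinate_window : - m%:Z <= exit_coordinate w (`|x|%N%:Z, n%:Z) <= m%:Z.
  by rewrite gez0_abs ?(le_trans _ x1)// -zE.
by apply; apply: H; rewrite absz_gt0; lia.
Qed.

Lemma exit_measure_meet m n : (0 < m)%N -> (m < n)%N ->
  (exists k, (n <= (walk (dual_arrow quadrant) (0%N, m) k).2)%N) ->
  exit_measure w n%:Z [set z : int | - m%:Z <= z <= m%:Z] = 0%E <->
  exists k, meet (dual_arrow quadrant) m n k.
Proof.
move=> m0 mn reach; rewrite exit_measure_eq0; split; first exact: side_meet.
by move=> /meet_side h x _; exact: h.
Qed.

End ExitPoints.

Lemma indep_family_mutually_independent (R : realType) d (T : measurableType d)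
    (P : probability T R) (I K : choiceType) (D : set I) (W : I -> {RV P >-> R})
    (phi : K -> I) (mu : K -> set R -> \bar R) :
  mutually_independent D W -> injective phi -> (forall k, D (phi k)) ->
  (forall k A, measurable A -> P (W (phi k) @^-1` A) = mu k A) ->
  indep_family P (fun om k => W (phi k) om) mu.
Proof.
move=> iW phiI Dphi muE; split; first by move=> k; exact: measurable_funPT.
move=> s A us mA; pose S := seq_fset tt (map phi s).
have uphi : uniq (map phi s) by rewrite map_inj_uniq.
have SE : perm_eq (enum_fset S) (map phi s).
  by rewrite -[X in perm_eq _ X]undup_id//; exact: seq_fset_perm.
pose A' i := nth setT (map A s) (index i (map phi s)).
have A'E k : k \in s -> A' (phi k) = A k.
  move=> ks; rewrite /A' index_map// (nth_map k) ?index_mem//.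
  by rewrite nth_index.
have SP i : i \in S -> exists2 k, k \in s & i = phi k.
  by rewrite (perm_mem SE) => /mapP.
rewrite (_ : _ @^-1` _ = \bigcap_(i in [set` S]) (W i @^-1` A' i)); last first.
  apply/seteqP; split => om /= H.
    by move=> i /SP[k ks ->]; rewrite A'E//; exact: H.
  move=> k ks; rewrite -A'E//; apply: (H (phi k)).
  by rewrite /= (perm_mem SE) map_f.
rewrite [LHS]iW.
- rewrite (perm_big _ SE) big_map big_seq [RHS]big_seq.
  by apply: eq_bigr => k ks; rewrite A'E// muE.
- by move=> i /SP[k _ ->].
- by move=> i /SP[k ks ->]; rewrite A'E.
Qed.

Section Environments.
Context {R : realType} d (T : measurableType d) (P : probability T R).
Variable W : site -> {RV P >-> R}.

Lemma iid_exp1_indep_family : iid_exp1_environment W ->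
  indep_family P (fun om z => W z om) (fun=> exponential_prob 1).
Proof.
by move=> [iW eW]; apply: (indep_family_mutually_independent iW (phi := id)).
Qed.

(** The Dirac law at the origin matches [corner_env], so that both models share one [stat_law]. *)
Lemma stationary_indep_family : stationary_environment W ->
  indep_family P (fun om => quadrant (fun z => W z om)) (stat_law (\d_(0 : R)) 2^-1).
Proof.
move=> [iW W0 W1 W2].
apply: (indep_family_mutually_independent iW (phi := fun z : nat * nat => (z.1%:Z, z.2%:Z))) => //.
  by move=> [i j] [i' j'] /= [-> ->].
have half : 1 - 2^-1 = 2^-1 :> R by lra.
move=> [[|i] [|j]] A mA /=; last exact: W1.
- rewrite diracE; case: (boolP (0 \in A)); rewrite ?inE => A0.
    rewrite (_ : _ @^-1` _ = setT) ?probability_setT//.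
    by apply/seteqP; split => om //= _; rewrite W0.
  rewrite (_ : _ @^-1` _ = set0) ?measure0//.
  apply/seteqP; split => om //=; rewrite W0 => /mem_set A0'.
  by rewrite A0' in A0.
- by rewrite half; exact: W2.
- by apply: W2.
Qed.

End Environments.

(** * Null events of the stationary model *)

Section HorizontalDualPaths.
Context {R : realType} d (T : measurableType d) (P : probability T R).
Variables (Y : T -> nat * nat -> R) (m0 : set R -> \bar R).
Implicit Types (i j k n : nat).

Lemma grow_row1 (y : nat * nat -> R) n : (forall k, dual_arrow y (k, 0%N)) ->
  grow y n 1 = y (0%N, 1%N) + \sum_(k < n) y (k.+1, 1%N).
Proof.
move=> H; elim: n => [|n IH]; first by rewrite big_ord0 addr0 grow_yaxis add0r.
rewrite growSS max_l; last exact/ltW/(H n).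
by rewrite IH big_ord_recr /=; ring.
Qed.

(** If all these arrows were horizontal, row 1 would be travelled along weights of mean 1, yet its
    time at [n] would exceed the sum of [n.+1] axis weights of mean 2. *)
Lemma row0_horizontal (indepY : indep_family P Y (stat_law m0 2^-1)) :
  measurable [set om | forall k, dual_arrow (Y om) (k, 0%N)] /\
  P [set om | forall k, dual_arrow (Y om) (k, 0%N)] = 0%E.
Proof.
have half : 1 - 2^-1 = 2^-1 :> R by lra.
have h0 : 0 < 2^-1 :> R by lra.
have h1 : 2^-1 < 1 :> R by lra.
set H := [set om | _].
have mH : measurable H.
  rewrite [X in measurable X](_ : _ = \bigcap_k [set om | dual_arrow (Y om) (k, 0%N)]).
    by apply: bigcapT_measurable => k; exact: (measurable_env_pre indepY (measurable_dual_arrow (k, 0%N))).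
  by apply/seteqP; split => om /= h k; [move=> _|]; exact: h.
split => //; set q := chernoff_rate (4^-1 : R).
have [e0 e1] : 0 < 4^-1 :> R /\ 4^-1 < 1 :> R by split; lra.
have /andP[q0 q1] := chernoff_rate_bounds e0 e1; rewrite -/q in q0 q1.
(* With relative error 1/4 the axis sum exceeds [3 / 2 * n.+1], while row 1 stays below [5 / 4 * n]
   plus an initial weight of at most [n / 4]. *)
have key n : (P H <= (q ^+ n.+1 + q ^+ n + expR (- 8^-1) ^+ n)%:E)%E.
  have fI : injective (fun k : nat => (k.+1, 0%N)) by move=> k l [].
  have gI : injective (fun k : nat => (k.+1, 1%N)) by move=> k l [].
  have [L _] := exponential_sum_sequence n.+1 indepY fI h0 e0 e1 (fun=> erefl).
  have [_ U] := exponential_sum_sequence n indepY gI ltr01 e0 e1 (fun=> erefl).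
  have n4 : 0 <= n%:R / 4 :> R by rewrite divr_ge0.
  pose B : set R := `]n%:R / 4, +oo[%classic.
  have tail : (P ((fun om => Y om (0%N, 1%N)) @^-1` B) <= (expR (- 8^-1) ^+ n)%:E)%E.
    have E : P ((fun om => Y om (0%N, 1%N)) @^-1` B) = exponential_prob (1 - 2^-1) B.
      by apply: (indep_family_marginal indepY (0%N, 1%N)); exact: measurable_itv.
    rewrite E half exponential_prob_tail//.
    by rewrite -expRM_natr lee_fin ler_expR; lra.
  have mY (k : nat * nat) : measurable_fun setT (fun om => Y om k) := indepY.1 k.
  have mS l (f : nat -> nat * nat) : measurable_fun setT (fun om => \sum_(k < l) Y om (f k)).
    by apply: measurable_sum => k; exact: mY.
  have mA : measurable [set om | \sum_(k < n.+1) Y om (k.+1, 0%N) <= (1 - 4^-1) * n.+1%:R / 2^-1].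
    by apply: measurable_set_ler => //; exact: (mS _ (fun k => (k.+1, 0%N))).
  have mB : measurable [set om | (1 + 4^-1) * n%:R / 1 <= \sum_(k < n) Y om (k.+1, 1%N)].
    by apply: measurable_set_ler => //; exact: (mS _ (fun k => (k.+1, 1%N))).
  have mC : measurable ((fun om => Y om (0%N, 1%N)) @^-1` B).
    by rewrite -[X in measurable X]setTI; apply: mY => //; exact: measurable_itv.
  have LU : (P ([set om | (\sum_(k < n.+1) Y om (k.+1, 0%N) <= (1 - 4^-1) * n.+1%:R / 2^-1)%R] `|`
      [set om | ((1 + 4^-1) * n%:R / 1 <= \sum_(k < n) Y om (k.+1, 1%N))%R]) <= (q ^+ n.+1 + q ^+ n)%:E)%E.
    by rewrite EFinD; apply: (measure_le_setU (measurableU _ _ mA mB) mA mB _ L U).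
  rewrite EFinD; apply: (measure_le_setU mH (measurableU _ _ mA mB) mC _ LU tail).
  move=> om Hom; apply: contrapT => /not_orP[/not_orP[/= /negP n1 /negP n2] /= n3].
  have := Hom n; rewrite /dual_arrow [snd _]/= [fst _]/= grow_row1// grow_boundary big_ord0 addr0.
  move: n3; rewrite /B /= in_itv /= andbT => /negP; move: n1 n2; rewrite -leNgt -!ltNge.
  rewrite (_ : n.+1%:R = n%:R + 1); last by rewrite natr1.
  move: (\sum_(_ < _) _) (\sum_(_ < _) _) (Y om _) (n%:R : R) => a c e v; lra.
apply/eqP; rewrite eq_le [in X in _ && X]measure_ge0 andbT; apply/lee_addgt0Pr => e e_gt0.
rewrite add0e; have e3 : 0 < e / 3 by lra.
have small (r : R) : 0 <= r -> r < 1 -> \forall n \near \oo, r ^+ n < e / 3.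
  move=> r0 r1; have r1' : `|r| < 1 by rewrite ger0_norm.
  have /cvgrPdist_lt /(_ _ e3) := cvg_expr r1'; apply: filterS => n.
  by rewrite sub0r normrN ger0_norm// exprn_ge0.
have s1 := small q (ltW q0) q1.
have s2 : \forall n \near \oo, expR (- 8^-1) ^+ n < e / 3 :> R.
  by apply: small; [exact: expR_ge0|rewrite expR_lt1; lra].
have [n [h1' h2']] := filter_ex (filterI s1 s2).
apply: (le_trans (key n)); rewrite lee_fin.
have : q ^+ n.+1 <= q ^+ n by rewrite exprS ler_piMl ?exprn_ge0// ltW.
lra.
Qed.

End HorizontalDualPaths.

Section StationaryNullSets.
Context {R : realType} d (T : measurableType d) (P : probability T R).
Variables (Y : T -> nat * nat -> R) (m0 : set R -> \bar R).
Hypothesis indepY : indep_family P Y (stat_law m0 2^-1).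
Implicit Types (i j k n : nat).

Lemma dual_arrow_window (y : nat * nat -> R) i j k :
  dual_arrow (window i j y) (k, 0%N) = dual_arrow y ((i + k)%N, j).
Proof. by rewrite /dual_arrow !grow_window addn0 !addnS addn0 ltrD2r. Qed.

(** A window moves any half-row to row 0. Outside this event [walk_rises] applies, so the upper dual
    walk reaches height [n]. *)
Lemma horizontal_dual_path_null : P.-negligible
  [set om | exists ij : nat * nat, forall k, dual_arrow (Y om) ((ij.1 + k)%N, ij.2)].
Proof.
have h0 : 0 < 2^-1 :> R by lra.
have h1 : 2^-1 < 1 :> R by lra.
pose F (ij : nat * nat) : set T :=
  [set om | forall k, dual_arrow (window ij.1 ij.2 (Y om)) (k, 0%N)].
have HF ij := row0_horizontal (stat_window h0 h1 indepY ij.1 ij.2).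
exists [set om | exists ij, F ij om]; split.
- by apply: (@measurable_exists _ T) => ij; have [] := HF ij.
- by apply: (@null_exists _ _ T P) => ij; have [] := HF ij.
by move=> om /= [ij H]; exists ij => k; rewrite dual_arrow_window.
Qed.

Lemma stat_tie_null : P.-negligible
  [set om | exists ij : nat * nat, grow (Y om) ij.1.+1 ij.2 = grow (Y om) ij.1 ij.2.+1].
Proof.
have h0 : 0 < 2^-1 :> R by lra.
have h1 : 2^-1 < 1 :> R by lra.
have mG i j : measurable_fun setT (fun om => grow (Y om) i j).
  apply: (measurableT_comp (f := fun x : env R _ => grow x i j)).
    exact: measurable_grow.
  exact: indep_family_env indepY.
have mF (ij : nat * nat) : measurable
    [set om | grow (Y om) ij.1.+1 ij.2 = grow (Y om) ij.1 ij.2.+1].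
  by apply: measurable_set_eqr; exact: mG.
exists [set om | exists ij : nat * nat, grow (Y om) ij.1.+1 ij.2 = grow (Y om) ij.1 ij.2.+1].
split => //; first exact: (@measurable_exists _ T).
apply: (@null_exists _ _ T P) => // -[i j].
rewrite -[RHS](stat_hinc_tie h0 h1 indepY i j); congr (P _).
by apply/seteqP; split => om; rewrite /mkset /hinc /vinc /fst /snd; [move=> ->|move=> /addIr].
Qed.

End StationaryNullSets.

Lemma walk_rises (b : nat * nat -> bool) z n :
  (forall i j, exists k, ~~ b ((i + k)%N, j)) -> exists k, (n <= (walk b z k).2)%N.
Proof.
move=> H; elim: n => [|n [k nk]]; first by exists 0%N.
case: (ltnP n (walk b z k).2) => [h|h]; first by exists k.
have [l] := H (walk b z k).1 (walk b z k).2.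
elim: l k nk h => [|l IH] k nk h bl.
  exists k.+1; rewrite walkS /step; move: bl; rewrite addn0 -surjective_pairing.
  by move=> /negbTE -> /=.
case: (boolP (b (walk b z k))) => bk; last first.
  by exists k.+1; rewrite walkS /step (negbTE bk).
apply: (IH k.+1); rewrite walkS /step bk //=.
by rewrite addSnnS.
Qed.

Lemma ray_walk (R : realType) (w : site -> R) (i j k : nat) :
  ray w (i%:Z, j%:Z) k =
  ((walk (lim_arrow_nat w) (i, j) k).1%:Z, (walk (lim_arrow_nat w) (i, j) k).2%:Z).
Proof.
elim: k => [//|k IH]; rewrite /ray iterS -/(ray w (i%:Z, j%:Z) k) IH walkS.
rewrite /site_step /step -[lim_arrow w _]/(lim_arrow_nat w (walk (lim_arrow_nat w) (i, j) k)).
by move: (walk _ _ _) => u; case: ifP => _; apply: site_eq; rewrite /=; lia.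
Qed.

Lemma coalescence_time_meet (R : realType) (w : site -> R) (m n : nat) :
  (forall z, 0 <= w z) -> (forall c i j, plain w c i.+2 j <> plain w c i.+1 j.+1) ->
  (forall z, exists k N, forall i j, cone k N i j -> arrow w z i j = lim_arrow w z) ->
  (coalescence_time w m%:Z < n%:Z%:E)%E <-> exists k, meet (lim_arrow_nat w) m n k.
Proof.
move=> w0 tie conv; rewrite (coalescence_time_lt w0 tie conv); split=> -[k].
  have := ray_walk w m 0 k; have := ray_walk w 0 m k; rewrite /= => -> -> [[h1 h2] h3].
  exists k; apply/andP; split; last by rewrite -ltz_nat.
  by apply/eqP; rewrite [LHS]surjective_pairing h1 h2 -surjective_pairing.
have := ray_walk w m 0 k; have := ray_walk w 0 m k; rewrite /= => E1 E2 /andP[/eqP h1 h2].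
by exists k; rewrite E1 E2 h1; split => //=; rewrite -h1.
Qed.

(** * Coalescence and exit points *)

Lemma has_probability_ae (R : realType) d (T : measurableType d) (P : probability T R)
    (A E N : set T) p : measurable A -> P.-negligible N ->
  (forall om, ~ N om -> A om <-> E om) -> P A = p -> has_probability P E p.
Proof.
move=> mA N0 AE PA; exists A; split => //; apply: negligibleS N0 => om.
have [//|/AE h] := pselect (N om).
by move=> [[/h Eom /(_ Eom)]|[/h Aom /(_ Aom)]].
Qed.

Theorem theorem1
  (R : realType)
  (d : measure_display) (T : measurableType d) (P : probability T R)
  (W : int * int -> {RV P >-> R})
  (d' : measure_display) (T' : measurableType d') (P' : probability T' R)
  (W' : int * int -> {RV P' >-> R})
  (hW : iid_exp1_environment W)
  (hW' : stationary_environment W')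
  (m n : int) (hm : 0 < m) (hmn : m < n) :
  exists p : \bar R,
    has_probability P
      [set om | (coalescence_time (fun z => W z om) m < n%:E)%E] p /\
    has_probability P'
      [set om | exit_measure (fun z => W' z om) n
                  [set z : int | - m <= z <= m] = 0%E] p.
Proof.
have iW := iid_exp1_indep_family hW; have iW' := stationary_indep_family hW'.
case: m n hm hmn => // m [] // n m0 mn.
rewrite ltz_nat in m0; rewrite ltz_nat in mn.
(* The meeting event of the limit arrows is measurable; it represents the coalescence event, and
   [meet_lim] carries its probability to the stationary model. *)
exists (P [set om | exists k, meet (lim_arrow_nat (fun z => W z om)) m n k]); split.
  have [mNeg Neg0] := negative_weight_null iW; have [mTie Tie0] := plain_tie_null iW.
  have nNeg : P.-negligible [set om | exists z, W z om < 0] by apply/negligibleP.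
  have nTie : P.-negligible [set om | exists cij : (int * int) * (nat * nat),
      plain_tie (fun om z => W z om) cij.1 cij.2.1 cij.2.2 om] by apply/negligibleP.
  apply: (has_probability_ae _ (negligibleU (negligibleU nNeg nTie) (arrow_limit iW)) _ erefl).
    by apply: (@measurable_exists _ T nat) => k; exact: (measurable_meet_lim iW).
  move=> om /not_orP[/not_orP[neg tie] /contrapT lim]; apply: iff_sym.
  apply: coalescence_time_meet => //.
  - by move=> z; rewrite leNgt; apply/negP => h; apply: neg; exists z.
  - by move=> c i j h; apply: tie; exists (c, (i, j)).
apply: (has_probability_ae _
  (negligibleU (stat_tie_null iW') (horizontal_dual_path_null iW'))).
- apply: (@measurable_exists _ T' nat) => k.
  exact: (measurable_env_pre iW' (measurable_meet_dual m n k)).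
- move=> om /not_orP[tie horiz]; apply: iff_sym; apply: exit_measure_meet => //.
    by move=> i j h; apply: tie; exists (i, j).
  apply: walk_rises => i j; apply: contrapT => none; apply: horiz; exists (i, j) => k.
  by apply: contrapT => /negP h; apply: none; exists k.
- by rewrite (meet_lim iW iW').
Qed.
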